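(* Let $\Gamma=\Gamma_2\subset SL(n,\mathbb Z)$ be the congruence subgroup of level $2$, and let $M'$ be the volume-preserving Katok–Lewis example, i.e. the manifold with $\Gamma$-action obtained from the standard action on $\mathbb T^n$ by blowing up and gluing, with a radial modification of the gluing, at the two $\Gamma$-fixed points $p_+=(\frac12,0,\dots,0)$ and $p_-=(0,\frac12,0,\dots,0)$, as described in the context. Then there is no $\Gamma$-invariant rigid A-structure on $M'$.
   Context: **A-structures.** For an $n$-manifold $N$, $F^kN$ is the $k$-th order frame bundle ($k$-jets at $0$ of germs of diffeomorphisms from $(\mathbb R^n,0)$ into $N$). $D^k$ is the real algebraic group of $k$-jets at $0$ of germs of diffeomorphisms of $\mathbb R^n$ fixing $0$; it acts naturally on $F^kN$ by precomposition. Given an algebraic action of $D^k$ on a smooth algebraic variety $Z$, an A-structure on $N$ of order $k$ and type $Z$ is a smooth map $\phi:F^kN\to Z$ equivariant for the $D^k$-actions. $J^{n,r}X$ denotes the bundle of $r$-jets at $0$ of maps $\mathbb R^n\to X$. The $r$-th prolongation $\phi^r:F^{k+r}N\to J^{n,r}Z$ is the composition of the natural inclusion $F^{k+r}N\to J^{n,r}(F^kN)$ with the map $J^{n,r}(F^kN)\to J^{n,r}Z$ induced by $\phi$. A diffeomorphism $h$ of $N$ is an isometry of $\phi$ if $\phi\circ j^k(h)=\phi$, where $j^k(h):F^kN\to F^kN$ is the induced map; $\phi$ is invariant under a group acting on $N$ if every group element acts by an isometry. **Rigidity.** For $p\in N$ and $l\ge k$ ($k$ the order of $\phi$), $Is^l_p(\phi)$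 is the group of $l$-jets $j^l_p(h)$ of germs of diffeomorphisms $h$ of $N$ fixing $p$ such that $\phi^{l-k}\circ j^l_p(h)=\phi^{l-k}$ on the fiber of $F^lN$ over $p$. For $m<l$, $r^{l;m}_p:Is^l_p(\phi)\to Is^m_p(\phi)$ is the natural (truncation) homomorphism. $\phi$ is $m$-rigid if $r^{m+1;m}_p$ is injective for every $p$, and rigid if it is $m$-rigid for some $m$. **The manifold $M'$.** Let $A\in SL(n,\mathbb Z)$ be such that $Ap_+=p_-$, let $l_+:\{v\in\mathbb R^n:\|v\|<.5\}\to\mathbb T^n$ be a linear coordinate system at $p_+$, and let $l_-=A\circ l_+$ be the corresponding coordinates at $p_-$. Let $S=(\mathbb R^n\setminus\{0\})/\mathbb R^\times$, let $[v]$ be the class of $v$ in $S$, and let $$L=\{([v],u)\in S\times\mathbb R^n : u=yv\text{ for some }y\in\mathbb R\},\qquad q:L\to\mathbb R^n,\ q([v],u)=u.$$ Let $E=\{([v],0)\}\subset L$ (the exceptional divisor), and let $L^+$ (resp. $L^-$) be the subset of those $([v],u)$ with $u=yv$ for some $y>0$ (resp. $y<0$). Let $V=\{([v],u)\in L:\|u\|<10^{-n}\}$, $V^\pm=V\cap L^\pm$, and $U=\mathbb T^n\setminus\{p_+,p_-\}$. Let $\rho:\mathbb R^n\setminus\{0\}\to\mathbb R^n\setminus\{0\}$, $\rho(u)=\|u\|^{-\alpha}u$, where $\alpha=\frac{n-1}{n}$. $M'$ is formed by gluing $U$ and $V$: $l\in V^+$ is glued to $l_+(\rho(q(l)))$ and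 $l\in V^-$ is glued to $l_-(\rho(q(l)))$. $\Gamma$ acts on $M'$ by the standard actions on $U$ and on $E\subset V$.
   Formalization: S is the quotient of R^n minus 0 by the positive reals instead of R^×, since with R^× the sets L^+ and L^- coincide and the gluing is ill-defined; l_- may be either A∘l_+ or the parallel coordinates v ↦ p_- + v, for which Γ acts on M' by diffeomorphisms. *)

(* Defs.v *)
From HB Require Import structures.
From mathcomp Require Import all_boot all_order all_algebra.
From mathcomp Require Import generic_quotient ring_quotient.
From mathcomp Require Import all_classical all_reals all_analysis.
From mathcomp.multinomials Require mpoly.

Set Implicit Arguments.
Unset Strict Implicit.
Unset Printing Implicit Defensive.

Import Order.TTheory GRing.Theory Num.Theory.
Import numFieldNormedType.Exports.

Local Open Scope classical_set_scope.
Local Open Scope ring_scope.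

(** * Smooth maps, jets and germs of diffeomorphisms of R^n *)

Section Calculus.
Context {R : realType}.

(* Iterated partial derivatives, along the entries of the variable. *)
Definition partials p q (s : seq ('I_p * 'I_q)) (f : 'M[R]_(p, q) -> R) :
    'M[R]_(p, q) -> R :=
  foldr (fun e g x => 'D_(delta_mx e.1 e.2) g x) f s.

(* C^oo on a neighbourhood of x: near x, all the iterated partial derivatives
   exist and are continuous. *)
Definition smooth_at p q m (f : 'M[R]_(p, q) -> 'cV[R]_m) (x : 'M[R]_(p, q)) :
    Prop :=
  \forall y \near x, forall (i : 'I_m) (s : seq ('I_p * 'I_q)),
    let g := partials s (fun z => f z i ord0) in
    {for y, continuous g} /\
    forall (a : 'I_p) (b : 'I_q), derivable g y (delta_mx a b).

Definition multi_index n k :=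
  {a : {ffun 'I_n -> 'I_k.+1} | (\sum_(i < n) a i <= k)%N}.

Definition njet n k := #|{: multi_index n k}|.

Definition partial_multi n k (a : multi_index n k) (f : 'cV[R]_n -> R) :
    'cV[R]_n -> R :=
  partials (flatten [seq nseq (val a i) (i, ord0) | i <- enum 'I_n]) f.

(* The k-jet of f at x, in the standard coordinates: all the partial
   derivatives of order at most k, the value f x included (null multi-index). *)
Definition jet k n m (f : 'cV[R]_n -> 'cV[R]_m) (x : 'cV[R]_n) :
    'M[R]_(m, njet n k) :=
  \matrix_(i, j) partial_multi (enum_val j) (fun y => f y i ord0) x.

Definition diffeo_germ n (g : 'cV[R]_n -> 'cV[R]_n) (x : 'cV[R]_n) : Prop :=
  exists g' : 'cV[R]_n -> 'cV[R]_n,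
    [/\ smooth_at g x, smooth_at g' (g x),
        \forall y \near x, g' (g y) = y &
        \forall y \near g x, g (g' y) = y].

Definition fix0_diffeo n (g : 'cV[R]_n -> 'cV[R]_n) : Prop :=
  g 0 = 0 /\ diffeo_germ g 0.

(* The underlying set of the group D^k, in jet coordinates. *)
Definition Dk n k : set 'M[R]_(n, njet n k) :=
  [set jet k g 0 | g in [set g | fix0_diffeo g]].

End Calculus.

(** * Smooth real algebraic varieties and algebraic actions of D^k *)

Section Varieties.
Context {R : realType}.

Definition peval m (p : mpoly.mpoly m R) (x : 'cV[R]_m) : R :=
  mpoly.meval (fun i => x i ord0) p.

Definition zariski_closed m (X : set 'cV[R]_m) : Prop :=
  exists F : set (mpoly.mpoly m R), X = [set x | forall p, F p -> peval p x = 0].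

(* Jacobian criterion: near x (in the Zariski topology), X is defined by c
   polynomials vanishing on X, with linearly independent differentials at x. *)
Definition nonsingular_at m (X : set 'cV[R]_m) (x : 'cV[R]_m) : Prop :=
  exists (c : nat) (P : 'I_c -> mpoly.mpoly m R) (q : mpoly.mpoly m R),
    [/\ forall a y, X y -> peval (P a) y = 0,
        peval q x != 0,
        forall y, peval q y != 0 -> (forall a, peval (P a) y = 0) -> X y &
        row_free (\matrix_(a < c, b < m) peval (mpoly.mderiv b (P a)) x)].

(* The set of real points of a smooth real algebraic variety: finitely many
   affine charts, glued along Zariski open sets by regular maps, with a closed
   diagonal (separatedness). *)
Record variety := Variety {
  vpt :> Type;
  vnum : nat;
  vdim : 'I_vnum -> nat;
  vdom : 'I_vnum -> set vpt;
  vcoord : forall c : 'I_vnum, vpt -> 'cV[R]_(vdim c);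
  vcover : forall z, exists c, vdom c z;
  vinj : forall c z w,
    vdom c z -> vdom c w -> vcoord c z = vcoord c w -> z = w;
  vclosed : forall c, zariski_closed (vcoord c @` vdom c);
  vsmooth : forall c z, vdom c z ->
    nonsingular_at (vcoord c @` vdom c) (vcoord c z);
  vregular : forall c d z, vdom c z -> vdom d z ->
    exists (q : mpoly.mpoly (vdim c) R)
           (P : 'I_(vdim d) -> mpoly.mpoly (vdim c) R),
      peval q (vcoord c z) != 0 /\
      forall w, vdom c w -> peval q (vcoord c w) != 0 ->
        vdom d w /\ forall a,
          vcoord d w a ord0 = peval (P a) (vcoord c w) / peval q (vcoord c w);
  vseparated : forall c d, zariski_closed
    [set col_mx (vcoord c z) (vcoord d z) | z in vdom c `&` vdom d]
}.

(* Smooth maps on an open set O into the real manifold Z. Each chart of Z is a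
   closed submanifold of some R^m. *)
Definition smooth_into (Z : variety) p q (O : set 'M[R]_(p, q))
    (F : 'M[R]_(p, q) -> Z) : Prop :=
  forall a, O a -> forall c, vdom c (F a) ->
    (\forall b \near a, vdom c (F b)) /\ smooth_at (vcoord c \o F) a.

(* Equality of r-jets at 0 of smooth maps from R^n to Z. *)
Definition same_jet_into (Z : variety) n r (F1 F2 : 'cV[R]_n -> Z) : Prop :=
  F1 0 = F2 0 /\
  forall c, vdom c (F1 0) -> jet r (vcoord c \o F1) 0 = jet r (vcoord c \o F2) 0.

(* D^k is a principal open subset of an affine space, so that a map on D^k x Z
   is regular when it is locally a quotient of polynomials in the jet
   coordinates and the coordinates of a chart of Z. *)
Definition regular_action (Z : variety) n k
    (act : Z -> 'M[R]_(n, njet n k) -> Z) : Prop :=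
  forall z d, @Dk R n k d -> exists (c c' : 'I_(vnum Z)),
    let xy (d : 'M[R]_(n, njet n k)) (z : Z) :=
      col_mx (mxvec d)^T (vcoord c z) in
    exists (q : mpoly.mpoly (n * njet n k + vdim c) R)
           (P : 'I_(vdim c') -> mpoly.mpoly (n * njet n k + vdim c) R),
      [/\ vdom c z, peval q (xy d z) != 0 &
          forall z' d', vdom c z' -> @Dk R n k d' -> peval q (xy d' z') != 0 ->
            vdom c' (act z' d') /\ forall a,
              vcoord c' (act z' d') a ord0
                = peval (P a) (xy d' z') / peval q (xy d' z')].

(* Algebraic actions of D^k, as right actions since D^k acts on frames by
   precomposition; act z d is only meaningful for d in D^k. *)
Definition algebraic_action (Z : variety) n k
    (act : Z -> 'M[R]_(n, njet n k) -> Z) : Prop :=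
  [/\ forall z, act z (jet k (@id 'cV[R]_n) 0) = z,
      forall z g1 g2, fix0_diffeo g1 -> fix0_diffeo g2 ->
        act z (jet k (g1 \o g2) 0) = act (act z (jet k g1 0)) (jet k g2 0) &
      regular_action act].

End Varieties.

Arguments variety R : clear implicits.

(** * A-structures and rigidity *)

(* An n-manifold, given by local parametrizations: par i is meant to be a local
   diffeomorphism from the open set pdom i to the manifold (not necessarily
   injective on all of pdom i). *)
Record manifold (R : realType) (n : nat) := Manifold {
  mpt :> Type;
  pidx : Type;
  pdom : pidx -> set 'cV[R]_n;
  par : pidx -> 'cV[R]_n -> mpt
}.

Section AStructures.
Context {R : realType} {n : nat} {N : manifold R n}.

(* Germs at 0 of diffeomorphisms from (R^n, 0) into N; their k-jets are the
   elements of F^k N. *)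
Definition frame (f : 'cV[R]_n -> N) : Prop :=
  exists (i : pidx N) (g : 'cV[R]_n -> 'cV[R]_n),
    [/\ diffeo_germ g 0, pdom i (g 0) & \forall t \near (0 : 'cV[R]_n), f t = par i (g t)].

Definition same_jet k (f1 f2 : 'cV[R]_n -> N) : Prop :=
  exists (i : pidx N) (g1 g2 : 'cV[R]_n -> 'cV[R]_n),
    [/\ [/\ smooth_at g1 0, smooth_at g2 0 & pdom i (g1 0)],
        \forall t \near (0 : 'cV[R]_n), f1 t = par i (g1 t),
        \forall t \near (0 : 'cV[R]_n), f2 t = par i (g2 t) &
        jet k g1 0 = jet k g2 0].

(* The image in F^k N of the fiber coordinates attached to a parametrization. *)
Definition frame_coord k (i : pidx N) : set 'M[R]_(n, njet n k) :=
  [set jet k g 0 | g in [set g | diffeo_germ g 0 /\ pdom i (g 0)]].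

(* A-structures of order k and type Z. The map phi : F^k N -> Z is encoded as a
   function of frame germs which factors through k-jets; its values outside
   frames are irrelevant. *)
Definition A_structure k (Z : variety R) (act : Z -> 'M[R]_(n, njet n k) -> Z)
    (phi : ('cV[R]_n -> N) -> Z) : Prop :=
  [/\ forall f1 f2, frame f1 -> frame f2 -> same_jet k f1 f2 ->
        phi f1 = phi f2,
      forall i : pidx N, exists F : 'M[R]_(n, njet n k) -> Z,
        smooth_into (@frame_coord k i) F /\
        forall g, diffeo_germ g 0 -> pdom i (g 0) ->
          phi (par i \o g) = F (jet k g 0) &
      forall f g, frame f -> fix0_diffeo g ->
        phi (f \o g) = act (phi f) (jet k g 0)].

(* The map x |-> phi (j^k_0 (f o translation by x)) from (R^n, 0) to Z, whose
   r-jet at 0 is the value of the prolongation phi^r at j^{k+r}_0 f. *)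
Definition prolong (Z : variety R) (phi : ('cV[R]_n -> N) -> Z)
    (f : 'cV[R]_n -> N) : 'cV[R]_n -> Z :=
  fun x => phi (fun t => f (x + t)).

Definition diffeomorphism (h : N -> N) : Prop :=
  bijective h /\ forall f, frame f <-> frame (h \o f).

Definition is_isometry (Z : variety R) (phi : ('cV[R]_n -> N) -> Z) (h : N -> N) :
    Prop :=
  diffeomorphism h /\ forall f, frame f -> phi (h \o f) = phi f.

(* h is (a representative of) a germ at p of diffeomorphisms fixing p. *)
Definition germ_fixing (p : N) (h : N -> N) : Prop :=
  h p = p /\ forall f, frame f -> f 0 = p -> frame (h \o f).

Definition same_jet_at (l : nat) (p : N) (h1 h2 : N -> N) : Prop :=
  forall f, frame f -> f 0 = p -> same_jet l (h1 \o f) (h2 \o f).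

(* The l-jet of h at p belongs to Is^l_p(phi), for phi of order k. *)
Definition Is k (Z : variety R) (phi : ('cV[R]_n -> N) -> Z) (l : nat) (p : N)
    (h : N -> N) : Prop :=
  germ_fixing p h /\
  forall f, frame f -> f 0 = p ->
    same_jet_into (l - k) (prolong phi (h \o f)) (prolong phi f).

Definition m_rigid k (Z : variety R) (phi : ('cV[R]_n -> N) -> Z) (m : nat) :
    Prop :=
  forall (p : N) (h1 h2 : N -> N),
    Is k phi m.+1 p h1 -> Is k phi m.+1 p h2 ->
    same_jet_at m p h1 h2 -> same_jet_at m.+1 p h1 h2.

Definition rigid k (Z : variety R) (phi : ('cV[R]_n -> N) -> Z) : Prop :=
  exists m, (k <= m)%N /\ m_rigid k phi m.

End AStructures.

(** * The Katok-Lewis example M' *)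

Section KatokLewis.
Context (R : realType) (n : nat).

Definition Zn_equiv (x y : 'cV[R]_n) : bool := x - y \is a mxOver Num.int.

Lemma Zn_equiv_class : equiv_class_of Zn_equiv.
Proof.
rewrite /Zn_equiv; split=> [x | x y | y x z].
- by apply/mxOverP => i j; rewrite !mxE subrr rpred0.
- by apply/mxOverP/mxOverP => h i j; have := h i j; rewrite !mxE -opprB rpredN.
- move=> /mxOverP hxy /mxOverP hyz; apply/mxOverP => i j.
  have := rpredD (hxy i j) (hyz i j).
  by rewrite !mxE addrA subrK.
Qed.

Canonical Zn_equiv_rel := EquivRelPack Zn_equiv_class.
Canonical Zn_equiv_enc := defaultEncModRel Zn_equiv.

(* R^n / Z^n *)
Definition torus : Type := {eq_quot Zn_equiv}%qT.
HB.instance Definition _ := EqQuotient.on torus.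
HB.instance Definition _ := Choice.on torus.

Definition to_torus (x : 'cV[R]_n) : torus := (\pi_(torus) x)%qT.

Definition torus_act (g : 'M[int]_n) (t : torus) : torus :=
  to_torus (map_mx intr g *m repr t).

(* (1/2, 0, ..., 0) and (0, 1/2, 0, ..., 0) *)
Definition half_vec (j : nat) : 'cV[R]_n :=
  \col_i (if val i == j then 2^-1 else 0).
Definition p_plus : torus := to_torus (half_vec 0).
Definition p_minus : torus := to_torus (half_vec 1).

Definition l_plus (v : 'cV[R]_n) : torus := to_torus (half_vec 0 + v).

Definition Gamma2 : set 'M[int]_n :=
  [set g | \det g = 1 /\ forall i j, (g i j = (i == j)%:Z %[mod 2])%Z].

Definition enorm (v : 'cV[R]_n) : R := Num.sqrt (\sum_i v i ord0 ^+ 2).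

Lemma enorm_gt0 v : v != 0 -> 0 < enorm v.
Proof.
move=> v0; rewrite sqrtr_gt0 lt_neqAle sumr_ge0 ?andbT; last first.
  by move=> i _; exact: sqr_ge0.
rewrite eq_sym; apply: contra v0 => s0; apply/eqP/colP => i; rewrite mxE.
move: s0; rewrite psumr_eq0; last by move=> j _; exact: sqr_ge0.
by move=> /allP/(_ i (mem_index_enum i)); rewrite sqrf_eq0 => /eqP.
Qed.

Lemma enorm_unit v : v != 0 -> enorm ((enorm v)^-1 *: v) == 1.
Proof.
move=> v0; have vp := enorm_gt0 v0.
rewrite {1}/enorm; under eq_bigr do rewrite mxE exprMn.
rewrite -mulr_sumr sqrtrM ?sqr_ge0// sqrtr_sqr normfV gtr0_norm//.
by rewrite -/(enorm v) mulVf // gt_eqF.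
Qed.

(* S = (R^n \ {0}) / R_{>0}, each class being represented by its unit vector. *)
Definition rays : Type := {s : 'cV[R]_n | enorm s == 1}.
HB.instance Definition _ := SubType.on rays.
HB.instance Definition _ := Choice.on rays.

Definition ray_of (v : 'cV[R]_n) (v0 : v != 0) : rays :=
  exist (fun s : 'cV[R]_n => enorm s == 1) _ (enorm_unit v0).

(* The open set U *)
Definition punctured_torus : Type :=
  {t : torus | (t != p_plus) && (t != p_minus)}.
HB.instance Definition _ := SubType.on punctured_torus.
HB.instance Definition _ := Choice.on punctured_torus.

(* Standard affine charts of the blow-up L. The vector v(x) has entry +1 or -1
   at i, and the entries of x elsewhere; the point of L with coordinates x is
   ([v(x)], x_i v(x)). *)
Definition chart_vec (i : 'I_n) (b : bool) (x : 'cV[R]_n) : 'cV[R]_n :=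
  \col_j (if j == i then (-1) ^+ b else x j ord0).

Lemma chart_vec_neq0 i b x : chart_vec i b x != 0.
Proof.
apply/eqP => /colP/(_ i); rewrite !mxE eqxx => /eqP.
by rewrite signr_eq0.
Qed.

Definition L_chart (i : 'I_n) (b : bool) (x : 'cV[R]_n) : rays * 'cV[R]_n :=
  (ray_of (chart_vec_neq0 i b x), x i ord0 *: chart_vec i b x).

Definition rho (u : 'cV[R]_n) : 'cV[R]_n :=
  (enorm u `^ (- ((n%:R - 1) / n%:R))) *: u.

(* Every point of V outside of E is glued to exactly one point of U, hence the
   underlying set of the gluing of U and V is the disjoint union of U and E,
   and E is identified with S. *)
Definition M'pt : Type := (punctured_torus + rays)%type.

(* The map V -> M'. The point ([s], u) of L, with u = y s, lies in E, L^+ or L^-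
   according to the sign of y = <s, u>. For ([s], u) in V, the points of the
   torus given by the gluing are in U, and insub succeeds. *)
Definition V_map (l_minus : 'cV[R]_n -> torus) (l : rays * 'cV[R]_n) : M'pt :=
  let: (s, u) := l in
  if u == 0 then inr s else
  let t := if 0 < ((val s)^T *m u) ord0 ord0 then l_plus (rho u)
           else l_minus (rho u) in
  if insub t is Some w then inl w else inr s.

Definition M'idx : Type := (punctured_torus + 'I_n * bool)%type.

Definition M'dom (i : M'idx) : set 'cV[R]_n :=
  match i with
  | inl _ => [set x | to_torus x != p_plus /\ to_torus x != p_minus]
  | inr (i, b) => [set x | enorm (L_chart i b x).2 < 10 ^- n]
  end.

(* In the parametrizations of U, the index w is only a default value outside of
   the domain. *)
Definition M'par (l_minus : 'cV[R]_n -> torus) (i : M'idx) (x : 'cV[R]_n) :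
    M'pt :=
  match i with
  | inl w => inl (insubd w (to_torus x))
  | inr (i, b) => V_map l_minus (L_chart i b x)
  end.

(* l_minus is a parameter: with l_minus = A o l_plus, the map induced by g on
   V^- is the conjugate of g by A, and the action on M' is not continuous along
   E unless g and A commute; with l_minus v = p_minus + v, it is
   an action by diffeomorphisms. *)
Definition M' (l_minus : 'cV[R]_n -> torus) : manifold R n :=
  @Manifold R n M'pt M'idx M'dom (M'par l_minus).

(* The standard actions on U and on E (the default values of insubd are not
   used when g is invertible and congruent to 1 modulo 2). *)
Definition M'act (g : 'M[int]_n) (p : M'pt) : M'pt :=
  match p with
  | inl w => inl (insubd w (torus_act g (val w)))
  | inr s => let v := map_mx intr g *m val s in
             inr (insubd s ((enorm v)^-1 *: v))
  end.

End KatokLewis.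

(* Main.v *)
Require Import Defs.
From mathcomp Require Import all_boot all_order all_algebra.
From mathcomp Require Import generic_quotient.
From mathcomp Require Import all_classical all_reals all_analysis.
From mathcomp.multinomials Require mpoly.
From mathcomp Require Import ring lra.

(** In the torus, let [sigma u] be the value of the structure at the standard
frame at [u].  Integral shears [1 + 2K E_10] fix the points with suitable
rational coordinate along the axis 0; as the action on [Z] is algebraic, the
values [sigma u] at such points are fixed by the whole one-parameter group of
shears.  Hence [sigma] is invariant under the translations along the axis 1 by
which these shears move points with rational coordinate, and by density and
continuity under all translations along the axis 1, over a strip adjacent to
[p_plus].  So these translations are local isometries there.

Read in the blow-up chart, where [x_0] is the defining function of [E], the
translation by [t] is, to first order, [x_1 |-> x_1 + t x_0 ^ (- 1/n)], which is
singular along [E].  Taking [t = eps ^ (m + 1 + 1/n)] at the points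
[x_0 = eps], the [(m+1)]-jets of these isometries converge as [eps -> 0] to the
jet at a point of [E] of [x |-> x + c x_0 ^ (m+1) e_1] with [c != 0].  By
continuity this limit belongs to [Is^(m+1)], yet it has the [m]-jet of the
identity: the structure is not [m]-rigid. *)

Set Implicit Arguments.
Unset Strict Implicit.
Unset Printing Implicit Defensive.

Import Order.TTheory GRing.Theory Num.Theory.
Import numFieldNormedType.Exports.

Local Open Scope classical_set_scope.
Local Open Scope ring_scope.

(** * Scalar calculus of several variables *)

Section ChainRule.
Context {R : realType}.

(** An integral shear moves the base point of a frame and also shears the frame itself, and
    invariance alone does not separate the two effects. The translations are shown to be isometries
    only on the side [x_0 > 0] of [E]. This suffices: membership of a jet in [Is] is a closed
    condition, so it can be tested at base points approaching [E] from that side. Hence a notion of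
    convergence of jets in which functions and base points vary together. The exponent [- 1/n] comes
    from dividing [t] by the length of the glued vector, which is of order [x_0 ^ (1/n)]. The
    constant [c] is a product of the factors [- 1/n - i] up to a factorial: it is nonzero for every
    [m] because the exponent is negative. *)

Lemma is_derive_line (V : normedModType R) (f : V -> R) (v z : V) (s : R) :
  derivable f (s *: v + z) v ->
  is_derive s 1 (fun s : R => f (s *: v + z)) ('D_v f (s *: v + z)).
Proof.
move=> df.
have E : (fun h : R => h^-1 *: (((fun s : R => f (s *: v + z)) \o shift s) (h *: 1)
   - f (s *: v + z))) = (fun h => h^-1 *: ((f \o shift (s *: v + z)) (h *: v)
   - f (s *: v + z))).
  apply/funext => h /=; congr (_ *: (f _ - _)).
  by rewrite scalerDl -addrA /GRing.scale /= mulr1.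
by split; [rewrite /derivable E|rewrite /derive E].
Qed.

Lemma difference_quotient_cvg (V : normedModType R) (f : V -> R) (v y : V)
    (T : Type) (F : set_system T) {FF : Filter F} (z : T -> V) (t : T -> R) :
  (\forall w \near y, derivable f w v) ->
  {for y, continuous ('D_v f)} ->
  z @ F --> y -> t @ F --> (0 : R) ->
  (fun i => if t i == 0 then 'D_v f y
            else (t i)^-1 * (f (t i *: v + z i) - f (z i))) @ F --> 'D_v f y.
Proof.
move=> df cf zy t0; apply/cvgrPdist_le => e e0.
have : \forall w \near y, derivable f w v /\ `|'D_v f y - 'D_v f w| <= e.
  near=> w; split; first by near: w.
  by near: w; move/cvgrPdist_le : cf; exact.
move=> /nbhs_ballP[r /= r0 ball_r].
have zr : \forall i \near F, ball y (r / 2) (z i).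
  by move/cvg_ballP : zy; apply; rewrite divr_gt0.
have tr : \forall i \near F, `|t i| * `|v| < r / 2.
  have : (fun i => `|t i| * `|v|) @ F --> `|0 : R| * `|v|.
    by apply: cvgMl; exact: cvg_norm.
  rewrite normr0 mul0r => /cvgr_lt; apply.
  by rewrite divr_gt0.
near=> i; have zi : ball y (r / 2) (z i) by near: i.
have ti : `|t i| * `|v| < r / 2 by near: i.
case: eqP => [_|/eqP ti0]; first by rewrite subrr normr0 ltW.
have inb (s : R) : `|s| <= `|t i| -> ball y r (s *: v + z i).
  move=> st; rewrite -ball_normE /= opprD addrCA addrC.
  have := ler_normB (y - z i) (s *: v).
  move=> /le_lt_trans; apply.
  rewrite [r]splitr ltrD//; first by rewrite -ball_normE in zi.
  by rewrite normrZ (le_lt_trans _ ti)// ler_wpM2r.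
pose g (s : R) := f (s *: v + z i); pose dg (s : R) := 'D_v f (s *: v + z i).
have isd (s : R) : `|s| <= `|t i| -> is_derive s 1 g (dg s).
  by move=> st; apply: is_derive_line; have [] := ball_r _ (inb _ st).
have key : exists2 c : R, `|c| <= `|t i| & g (t i) - g 0 = dg c * t i.
  have cont a b : (forall x, x \in `[a, b] -> `|x| <= `|t i|) ->
      {within `[a, b], continuous g}.
    move=> ab; apply: derivable_within_continuous => x xab.
    by have := isd _ (ab _ xab); case.
  have [tneg|tpos|E] := ltgtP 0 (t i); last by rewrite -E eqxx in ti0.
    have H x : x \in `[0, t i] -> `|x| <= `|t i|.
      by rewrite in_itv /= => /andP[x0 xt]; rewrite !ger0_norm// ltW.
    have [||c cab ->] := MVT tneg (df := dg) (f := g).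
    - by move=> x xab; exact/isd/H/subset_itv_oo_cc.
    - exact: cont.
    - by exists c; [exact/H/subset_itv_oo_cc|rewrite subr0].
  have H x : x \in `[t i, 0] -> `|x| <= `|t i|.
    rewrite in_itv /= => /andP[x0 xt]; rewrite !ler0_norm ?lerN2// ltW//.
  have [||c cab Ec] := MVT tpos (df := dg) (f := g).
  - by move=> x xab; exact/isd/H/subset_itv_oo_cc.
  - exact: cont.
  - exists c; first exact/H/subset_itv_oo_cc.
    by rewrite -[LHS]opprB Ec sub0r mulrN opprK.
case: key => c cti; rewrite {1}/g {1}/g scale0r add0r => ->.
rewrite mulrCA mulVf// mulr1 /dg.
by have [] := ball_r _ (inb _ cti).
Unshelve. all: by end_near. Qed.

Lemma cvg_mx (p q : nat) (T : Type) (F : set_system T) {FF : Filter F}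
    (g : T -> 'M[R]_(p, q)) (l : 'M[R]_(p, q)) :
  (forall i j, (fun t => g t i j) @ F --> l i j) -> g @ F --> l.
Proof.
move=> gl; apply/cvg_ballP => e e0.
suff : \forall t \near F, forall ij : 'I_p * 'I_q, ball (l ij.1 ij.2) e (g t ij.1 ij.2).
  by apply: filterS => t H; split=> // i j; exact: (H (i, j)).
apply: filter_forall => -[i j] /=.
by have /cvg_ballP := gl i j; apply.
Qed.

(* The increment of f along the curve is telescoped into increments along one
   entry of the matrix at a time, each controlled by the mean value theorem. *)
Lemma is_derive_chain (V : normedModType R) p q (f : 'M[R]_(p, q) -> R)
    (g : V -> 'M[R]_(p, q)) (x v : V) :
  (forall e : 'I_p * 'I_q, \forall w \near g x, derivable f w (delta_mx e.1 e.2)) ->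
  (forall e : 'I_p * 'I_q, {for g x, continuous ('D_(delta_mx e.1 e.2) f)}) ->
  (forall e : 'I_p * 'I_q, derivable (fun y => g y e.1 e.2) x v) ->
  is_derive x v (f \o g)
    (\sum_(e : 'I_p * 'I_q) 'D_(delta_mx e.1 e.2) f (g x) * 'D_v (fun y => g y e.1 e.2) x).
Proof.
move=> df cf dg.
pose t (e : 'I_p * 'I_q) (h : R) := g (h *: v + x) e.1 e.2 - g x e.1 e.2.
have tder e : (fun h => h^-1 * t e h) @ 0^' --> 'D_v (fun y => g y e.1 e.2) x.
  exact: (dg e).
have t0 e : t e @ 0^' --> (0 : R).
  have : (fun h => h * (h^-1 * t e h)) @ 0^' --> (0 : R) * 'D_v (fun y => g y e.1 e.2) x.
    by apply: cvgM (tder e); exact/cvg_within.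
  rewrite mul0r; apply: cvg_trans; apply: near_eq_cvg.
  near=> h; rewrite mulrA divff ?mul1r//.
  by near: h; exact: nbhs_dnbhs_neq.
pose G (s : seq ('I_p * 'I_q)) (h : R) := g x + \sum_(e <- s) t e h *: delta_mx e.1 e.2.
have G0 s : G s @ 0^' --> g x.
  rewrite -[X in _ --> X]addr0; apply: cvgD; first exact: cvg_cst.
  elim: s => [|e s IH].
    by under eq_fun do rewrite big_nil; exact: cvg_cst.
  under eq_fun do rewrite big_cons.
  have := cvgD (cvgZ (t0 e) (cvg_cst (delta_mx e.1 e.2 : 'M[R]_(p, q)))) IH.
  by rewrite scale0r addr0 => C; exact: C.
have key s : (fun h => h^-1 * (f (G s h) - f (g x))) @ 0^' -->
    \sum_(e <- s) 'D_(delta_mx e.1 e.2) f (g x) * 'D_v (fun y => g y e.1 e.2) x.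
  elim: s => [|e s IH].
    rewrite big_nil /G.
    under eq_fun do rewrite big_nil addr0 subrr mulr0.
    exact: cvg_cst.
  rewrite big_cons.
  have Q := difference_quotient_cvg (FF := dnbhs_filter _) (df e) (cf e) (G0 s) (t0 e).
  apply: (cvg_trans _ (cvgD (cvgM Q (tder e)) IH)).
  apply: near_eq_cvg; near=> h.
  have EG : G (e :: s) h = t e h *: delta_mx e.1 e.2 + G s h.
    by rewrite /G big_cons addrCA.
  rewrite EG; set a := t e h; set D := delta_mx _ _.
  change ((if a == 0 then 'D_D f (g x) else a^-1 * (f (a *: D + G s h) - f (G s h)))
     * (h^-1 * a) + h^-1 * (f (G s h) - f (g x)) = h^-1 * (f (a *: D + G s h) - f (g x))).
  case: eqP => [->|/eqP a0].
    by rewrite !mulr0 add0r scale0r add0r.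
  move: (f _) (f _) (f _) (h^-1) => u1 u2 u3 k.
  by field.
have E : (fun h : R => h^-1 *: (((f \o g) \o shift x) (h *: v) - (f \o g) x))
    = (fun h => h^-1 * (f (G (index_enum _) h) - f (g x))).
  apply/funext => h /=; congr (_ *: (f _ - _)).
  rewrite /G; apply/matrixP => i j; rewrite mxE summxE.
  rewrite (bigD1 (i, j))//= big1 ?addr0; last first.
    move=> [i' j'] ne; rewrite !mxE /=; have [ii|] := eqVneq i i'; last by rewrite mulr0.
    have [jj|] := eqVneq j j'; last by rewrite mulr0.
    by rewrite ii jj eqxx in ne.
  by rewrite !mxE !eqxx mulr1 /t /= addrC subrK.
have := key (index_enum _); rewrite -E => K.
split; first by apply/cvg_ex; eexists; exact: K.
exact/cvg_lim.
Unshelve. all: by end_near. Qed.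

End ChainRule.

(** * Closure properties of smooth functions *)

Section SmoothFunctions.
Context {R : realType}.

Lemma is_derive_scalar_comp (V : normedModType R) (f : V -> R) (h : R -> R)
    (x v : V) (d : R) :
  is_derive (f x) 1 h d -> derivable f x v ->
  is_derive x v (h \o f) (d * 'D_v f x).
Proof.
move=> dh df.
have df' : derivable f (0 *: v + x) v by rewrite scale0r add0r.
have := is_derive_line df'; rewrite scale0r add0r => dl.
have dh' : is_derive (f (0 *: v + x)) 1 h d by rewrite scale0r add0r.
have [D1 D2] := is_derive1_comp dh' dl.
have E : (fun t : R => t^-1 *: (((h \o f) \o shift x) (t *: v) - (h \o f) x))
    = (fun t : R => t^-1 *: (((h \o (fun s : R => f (s *: v + x))) \o shift 0) (t *: 1)
         - (h \o (fun s : R => f (s *: v + x))) 0)).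
  apply/funext => t /=; congr (_ *: (h (f _) - h (f _))).
    by rewrite addr0 /GRing.scale /= mulr1.
  by rewrite scale0r add0r.
by split; [rewrite /derivable E|rewrite /derive E].
Qed.

Lemma near_eq_continuous_at (T U : topologicalType) (f g : T -> U) (x : T) :
  (\forall y \near x, f y = g y) -> {for x, continuous f} -> {for x, continuous g}.
Proof.
move=> fg; rewrite /prop_for /continuous_at -(nbhs_singleton fg).
by apply: cvg_trans; apply: near_eq_cvg.
Qed.

Lemma continuous_mx (T : topologicalType) p q (g : T -> 'M[R]_(p, q)) (x : T) :
  (forall i j, {for x, continuous (fun y => g y i j)}) -> {for x, continuous g}.
Proof. by move=> gx; apply: (cvg_mx (FF := nbhs_filter x)) => i j; exact: gx. Qed.

Definition pd p q (e : 'I_p * 'I_q) (f : 'M[R]_(p, q) -> R) : 'M[R]_(p, q) -> R :=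
  fun x => 'D_(delta_mx e.1 e.2) f x.

Lemma partials_rcons p q s e (f : 'M[R]_(p, q) -> R) :
  partials (rcons s e) f = partials s (pd e f).
Proof. by elim: s => //= e' s ->. Qed.

Lemma partials_cat p q s t (f : 'M[R]_(p, q) -> R) :
  partials (s ++ t) f = partials s (partials t f).
Proof. by elim: s => //= e' s ->. Qed.

(** A recursive form of class C^k on a set: unlike a condition on all iterated partial derivatives
    at once, it lets the Leibniz and chain rules be proved by induction on [k]. *)
Fixpoint Ck k p q (O : set 'M[R]_(p, q)) (f : 'M[R]_(p, q) -> R) : Prop :=
  (forall y, O y -> {for y, continuous f}) /\
  (if k is k'.+1 then
     forall e, (forall y, O y -> derivable f y (delta_mx e.1 e.2)) /\ Ck k' O (pd e f)
   else True).

Lemma Ck_continuous k p q O (f : 'M[R]_(p, q) -> R) y :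
  Ck k O f -> O y -> {for y, continuous f}.
Proof. by case: k => [|k] [+ _]; apply. Qed.

Lemma Ck_eq k p q (O : set 'M[R]_(p, q)) (f g : 'M[R]_(p, q) -> R) :
  open O -> (forall y, O y -> f y = g y) -> Ck k O f -> Ck k O g.
Proof.
move=> oO; have nE (h h' : 'M[R]_(p, q) -> R) : (forall y, O y -> h y = h' y) ->
    forall y, O y -> \forall z \near y, h z = h' z.
  by move=> hh y Oy; apply: filterS (open_nbhs_nbhs (conj oO Oy)); exact: hh.
elim: k f g => [|k IH] f g fg /= [cf df].
  by split=> // y Oy; apply: near_eq_continuous_at (cf _ Oy); exact: nE.
split=> [y Oy|e]; first by apply: near_eq_continuous_at (cf _ Oy); exact: nE.
have [dfe Cfe] := df e; split=> [y Oy|].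
  by apply: (near_eq_derivable _ (dfe _ Oy)); exact: nE.
by apply: IH Cfe => y Oy; apply: near_eq_derive; exact: nE.
Qed.

Lemma CkS k p q O (f : 'M[R]_(p, q) -> R) : Ck k.+1 O f -> Ck k O f.
Proof.
elim: k f => [|k IH] f /= [cf df]; split=> // e.
by have [dfe Cfe] := df e; split=> //; exact: IH.
Qed.

Lemma sub_Ck k p q (O O' : set 'M[R]_(p, q)) f : O `<=` O' -> Ck k O' f -> Ck k O f.
Proof.
move=> OO'; elim: k f => [|k IH] f /= [cf df]; split=> //.
- by move=> y /OO'; exact: cf.
- by move=> y /OO'; exact: cf.
- move=> e; have [dfe Cfe] := df e.
  by split; [move=> y /OO'; exact: dfe|exact: IH].
Qed.

Lemma Ck_cst k p q (O : set 'M[R]_(p, q)) (a : R) : Ck k O (fun=> a).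
Proof.
elim: k a => [|k IH] a /=; first by split=> // y _; exact: cst_continuous.
split=> [y _|e]; first exact: cst_continuous.
split=> [y _|]; first exact: derivable_cst.
have -> : pd e (fun=> a) = fun=> 0 by apply/funext => x; exact: derive_cst.
exact: IH.
Qed.

Lemma is_derive_coord p q (x v : 'M[R]_(p, q)) i j :
  is_derive x v (fun M : 'M[R]_(p, q) => M i j) (v i j).
Proof.
have E : (fun h : R => h^-1 *: (((fun M : 'M[R]_(p, q) => M i j) \o shift x) (h *: v)
    - x i j)) @ 0^' --> v i j.
  apply: cvg_near_cst; near=> h => /=.
  have h0 : h != 0 by near: h; exact: nbhs_dnbhs_neq.
  by rewrite !mxE addrK /GRing.scale /= mulrA mulVf// mul1r.
split; first by apply/cvg_ex; eexists; exact: E.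
exact/cvg_lim.
Unshelve. all: by end_near. Qed.

Lemma pd_coord p q (e : 'I_p * 'I_q) i j :
  pd e (fun M => M i j) = fun=> ((e == (i, j))%:R : R).
Proof.
apply/funext => x; rewrite /pd.
have [_ ->] := is_derive_coord x (delta_mx e.1 e.2) i j.
by rewrite mxE eq_sym [j == _]eq_sym [e]surjective_pairing.
Qed.

Lemma Ck_coord k p q (O : set 'M[R]_(p, q)) i j : Ck k O (fun M => M i j).
Proof.
case: k => [|k] /=; first by split=> // y _; exact: coord_continuous.
split=> [y _|e]; first exact: coord_continuous.
split=> [y _|]; last by rewrite pd_coord; exact: Ck_cst.
by have [] := is_derive_coord y (delta_mx e.1 e.2) i j.
Qed.

Lemma CkD k p q (O : set 'M[R]_(p, q)) f g : open O ->
  Ck k O f -> Ck k O g -> Ck k O (fun x => f x + g x).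
Proof.
move=> oO; elim: k f g => [|k IH] f g /= [cf df] [cg dg].
  by split=> // y Oy; apply: continuousD; [exact: cf|exact: cg].
split=> [y Oy|e]; first by apply: continuousD; [exact: cf|exact: cg].
have [dfe Cfe] := df e; have [dge Cge] := dg e; split=> [y Oy|].
  by apply: derivableD; [exact: dfe|exact: dge].
apply: Ck_eq (IH _ _ Cfe Cge) => // y Oy.
by apply/esym/deriveD; [exact: dfe|exact: dge].
Qed.

Lemma CkM k p q (O : set 'M[R]_(p, q)) f g : open O ->
  Ck k O f -> Ck k O g -> Ck k O (fun x => f x * g x).
Proof.
move=> oO; elim: k f g => [|k IH] f g Cf Cg.
  by case: Cf Cg => cf _ [cg _]; split=> // y Oy; apply: continuousM; [exact: cf|exact: cg].
split=> [y Oy|e].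
  by apply: continuousM; [exact: (Ck_continuous Cf)|exact: (Ck_continuous Cg)].
have Cf' := CkS Cf; have Cg' := CkS Cg.
have [_ /(_ e)[dfe Cfe]] := Cf; have [_ /(_ e)[dge Cge]] := Cg; split=> [y Oy|].
  by apply: derivableM; [exact: dfe|exact: dge].
apply: (Ck_eq oO _ (CkD oO (IH _ _ Cf' Cge) (IH _ _ Cg' Cfe))) => y Oy.
by apply/esym/deriveM; [exact: dfe|exact: dge].
Qed.

Lemma Ck_sum k p q (O : set 'M[R]_(p, q)) (I : Type) (s : seq I) F : open O ->
  (forall i, Ck k O (F i)) -> Ck k O (fun x => \sum_(i <- s) F i x).
Proof.
move=> oO CF; elim: s => [|i s IH].
  by under eq_fun do rewrite big_nil; exact: Ck_cst.
by under eq_fun do rewrite big_cons; exact: CkD.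
Qed.

Lemma Ck_chain k p q (O : set 'M[R]_(p, q)) f y : Ck k.+1 O f -> open O -> O y ->
  (forall e : 'I_p * 'I_q, \forall w \near y, derivable f w (delta_mx e.1 e.2)) /\
  (forall e : 'I_p * 'I_q, {for y, continuous ('D_(delta_mx e.1 e.2) f)}).
Proof.
move=> [_ df] oO Oy; split=> e; have [dfe Cfe] := df e.
  by apply: filterS (open_nbhs_nbhs (conj oO Oy)); exact: dfe.
exact: (Ck_continuous Cfe).
Qed.

Lemma Ck_comp k p q p' q' (O : set 'M[R]_(p, q)) (O' : set 'M[R]_(p', q'))
    (f : 'M[R]_(p', q') -> R) (g : 'M[R]_(p, q) -> 'M[R]_(p', q')) :
  open O -> open O' -> (forall x, O x -> O' (g x)) ->
  Ck k O' f -> (forall i j, Ck k O (fun x => g x i j)) -> Ck k O (fun x => f (g x)).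
Proof.
move=> oO oO' OO'; elim: k f => [|k IH] f Cf Cg.
  have [cf _] := Cf; split=> // y Oy; apply: continuous_comp; last exact/cf/OO'.
  by apply: continuous_mx => i j; have [cg _] := Cg i j; exact: cg.
have Cg' i j := CkS (Cg i j).
split=> [y Oy|e].
  apply: continuous_comp; last exact/(Ck_continuous Cf)/OO'.
  by apply: continuous_mx => i j; exact: (Ck_continuous (Cg i j)).
have D y : O y -> is_derive y (delta_mx e.1 e.2) (f \o g)
    (\sum_(e' : 'I_p' * 'I_q') pd e' f (g y) * pd e (fun x => g x e'.1 e'.2) y).
  move=> Oy; have [d1 d2] := Ck_chain Cf oO' (OO' _ Oy).
  apply: is_derive_chain => // e'.
  by have [_ /(_ e)[dge _]] := Cg e'.1 e'.2; exact: dge.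
split=> [y Oy|]; first by have [] := D _ Oy.
apply: (Ck_eq oO (f := fun y => \sum_(e' : 'I_p' * 'I_q')
    pd e' f (g y) * pd e (fun x => g x e'.1 e'.2) y)).
  by move=> y Oy; have [_ <-] := D _ Oy.
apply: Ck_sum => // e'; apply: CkM => //.
  by apply: IH => //; have [_ /(_ e')[]] := Cf.
by have [_ /(_ e)[]] := Cg e'.1 e'.2.
Qed.

Lemma continuous_powR (a t : R) : 0 < t -> {for t, continuous (fun t => t `^ a)}.
Proof.
move=> t0; have [+ _] := is_derive1_powR a t0.
by move=> /derivable1_diffP/differentiable_continuous.
Qed.

Lemma Ck_powR k p q (O : set 'M[R]_(p, q)) f a : open O ->
  (forall x, O x -> 0 < f x) -> Ck k O f -> Ck k O (fun x => f x `^ a).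
Proof.
move=> oO f0; elim: k a f f0 => [|k IH] a f f0 Cf.
  split=> // y Oy; apply: (@continuous_comp _ _ _ f (fun t => t `^ a)); first exact: (Ck_continuous Cf).
  exact/continuous_powR/f0.
split=> [y Oy|e].
  apply: (@continuous_comp _ _ _ f (fun t => t `^ a)); first exact: (Ck_continuous Cf).
  exact/continuous_powR/f0.
have Cf' := CkS Cf; have [_ /(_ e)[dfe Cfe]] := Cf.
have D y : O y -> is_derive y (delta_mx e.1 e.2) ((fun t => t `^ a) \o f)
    (a * f y `^ (a - 1) * pd e f y).
  move=> Oy; apply: is_derive_scalar_comp; last exact: dfe.
  exact/is_derive1_powR/f0.
split=> [y Oy|]; first by have [] := D _ Oy.
apply: (Ck_eq oO (f := fun y => a * f y `^ (a - 1) * pd e f y)).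
  by move=> y Oy; have [_ <-] := D _ Oy.
by apply: CkM => //; apply: CkM => //; [exact: Ck_cst|exact: IH].
Qed.

(* Scalar version of [smooth_at]; a record rather than a definition, to stop
   unification from unfolding it. *)
Record sm p q (f : 'M[R]_(p, q) -> R) (x : 'M[R]_(p, q)) : Prop := Sm {
  sm_near : \forall y \near x, forall s : seq ('I_p * 'I_q),
    {for y, continuous (partials s f)} /\
    forall a b, derivable (partials s f) y (delta_mx a b) }.

(** The open set is the same for all [k], so the closure properties of [Ck] transfer to smooth
    functions one class at a time. *)
Lemma smP p q (f : 'M[R]_(p, q) -> R) x :
  sm f x <-> exists O, [/\ open O, O x & forall k, Ck k O f].
Proof.
split=> [|[ O [oO Ox Cf]]].
  move=> /sm_near/nbhs_interior; set P := (X in X^°) => Px.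
  exists P^°; split=> [||k]; [exact: open_interior|exact: nbhs_singleton|].
  have H s : Ck k P^° (partials s f).
    elim: k s => [|k IH] s; first by split=> // y /interior_subset/(_ s)[].
    split=> [y /interior_subset/(_ s)[]//|e].
    by split=> [y /interior_subset/(_ s)[_ d]|]; [exact: d|exact: (IH (e :: s))].
  exact: (H [::]).
split; apply: filterS (open_nbhs_nbhs (conj oO Ox)) => y Oy s.
have H k : Ck k O (partials s f).
  elim: s k => [|e s IH] k //=.
  by have [_ /(_ e)[]] := IH k.+1.
split; first exact: (Ck_continuous (H 0%N)).
by move=> a b; have [_ /(_ (a, b))[+ _]] := H 1%N; apply.
Qed.

Lemma smooth_atP p q m (f : 'M[R]_(p, q) -> 'cV[R]_m) x :
  smooth_at f x <-> forall i, sm (fun y => f y i ord0) x.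
Proof.
split=> [sf i|sf]; first by split; apply: filterS sf => y /(_ i).
have := filter_forall (F := nbhs x) (f := fun i y =>
  forall s, {for y, continuous (partials s (fun y => f y i ord0))} /\
    forall a b, derivable (partials s (fun y => f y i ord0)) y (delta_mx a b))
  (nbhs_filter x) (fun i => sm_near (sf i)).
by rewrite /smooth_at; apply: filterS => y H i s; exact: H.
Qed.

Lemma sm_open p q (f : 'M[R]_(p, q) -> R) x : sm f x -> \forall y \near x, sm f y.
Proof. by move=> /sm_near/near_join; apply: filterS => y; exact: Sm. Qed.

Lemma sm_continuous p q (f : 'M[R]_(p, q) -> R) x : sm f x -> {for x, continuous f}.
Proof. by move=> /sm_near/nbhs_singleton/(_ [::])[]. Qed.

Lemma sm_pd p q e (f : 'M[R]_(p, q) -> R) x : sm f x -> sm (pd e f) x.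
Proof.
move=> /sm_near sf; split; apply: filterS sf => y H s.
by rewrite -partials_rcons; exact: H.
Qed.

Lemma sm_partials p q s (f : 'M[R]_(p, q) -> R) x : sm f x -> sm (partials s f) x.
Proof.
by elim: s => [//|e s IH] sf; have := sm_pd e (IH sf).
Qed.

Lemma sm_near_eq p q (f g : 'M[R]_(p, q) -> R) x :
  (\forall y \near x, f y = g y) -> sm f x -> sm g x.
Proof.
move=> fg /smP[ O [oO Ox Cf]]; apply/smP.
move: fg => /nbhs_interior; set P := (X in X^°) => Px.
exists (O `&` P^°); split=> [||k].
- by apply: openI => //; exact: open_interior.
- by split=> //; exact: nbhs_singleton.
- apply: (@Ck_eq _ _ _ _ f) (sub_Ck _ (Cf k)) => [|y [_ /interior_subset]//|y []//].
  by apply: openI => //; exact: open_interior.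
Qed.

Lemma partials_near_eq p q (f g : 'M[R]_(p, q) -> R) s x :
  (\forall y \near x, f y = g y) -> partials s f x = partials s g x.
Proof.
elim: s x => [|e s IH] x fg /=; first exact: nbhs_singleton fg.
apply: near_eq_derive.
by move: fg => /near_join; apply: filterS => y; exact: IH.
Qed.

Lemma sm_cst p q (a : R) (x : 'M[R]_(p, q)) : sm (fun=> a) x.
Proof. by apply/smP; exists setT; split=> [||k]; [exact: openT|by []|exact: Ck_cst]. Qed.

Lemma sm_coord p q i j (x : 'M[R]_(p, q)) : sm (fun M => M i j) x.
Proof. by apply/smP; exists setT; split=> [||k]; [exact: openT|by []|exact: Ck_coord]. Qed.

Lemma smD p q (f g : 'M[R]_(p, q) -> R) x :
  sm f x -> sm g x -> sm (fun y => f y + g y) x.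
Proof.
move=> /smP[ O [oO Ox Cf]] /smP[ O' [oO' Ox' Cg]]; apply/smP.
have oI := openI oO oO'; exists (O `&` O'); split=> // k.
by apply: CkD => //; [apply: sub_Ck (Cf k)|apply: sub_Ck (Cg k)] => y [].
Qed.

Lemma smM p q (f g : 'M[R]_(p, q) -> R) x :
  sm f x -> sm g x -> sm (fun y => f y * g y) x.
Proof.
move=> /smP[ O [oO Ox Cf]] /smP[ O' [oO' Ox' Cg]]; apply/smP.
have oI := openI oO oO'; exists (O `&` O'); split=> // k.
by apply: CkM => //; [apply: sub_Ck (Cf k)|apply: sub_Ck (Cg k)] => y [].
Qed.

Lemma sm_sum p q (I : Type) (s : seq I) (F : I -> 'M[R]_(p, q) -> R) x :
  (forall i, sm (F i) x) -> sm (fun y => \sum_(i <- s) F i y) x.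
Proof.
move=> CF; elim: s => [|i s IH].
  by under eq_fun do rewrite big_nil; exact: sm_cst.
by under eq_fun do rewrite big_cons; exact: smD.
Qed.

Lemma sm_exp p q (f : 'M[R]_(p, q) -> R) k x : sm f x -> sm (fun y => f y ^+ k) x.
Proof.
move=> sf; elim: k => [|k IH].
  by under eq_fun do rewrite expr0; exact: sm_cst.
by under eq_fun do rewrite exprS; exact: smM.
Qed.

Lemma sm_comp p q p' q' (f : 'M[R]_(p', q') -> R) (g : 'M[R]_(p, q) -> 'M[R]_(p', q')) x :
  sm f (g x) -> (forall i j, sm (fun y => g y i j) x) -> sm (fun y => f (g y)) x.
Proof.
move=> /smP[ O' [oO' Ox' Cf]] sg.
have gx : {for x, continuous g} by apply: continuous_mx => i j; exact: sm_continuous (sg i j).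
have Pn : \forall y \near x, O' (g y) /\ forall ij : 'I_p' * 'I_q',
    forall s, {for y, continuous (partials s (fun y => g y ij.1 ij.2))} /\
    forall a b, derivable (partials s (fun y => g y ij.1 ij.2)) y (delta_mx a b).
  apply: filterI; first by apply: gx; exact: open_nbhs_nbhs.
  exact: (filter_forall (nbhs_filter x) (fun ij => sm_near (sg ij.1 ij.2))).
apply/smP; move: Pn => /nbhs_interior; set P := (X in X^°) => Px.
exists P^°; split=> [||k]; [exact: open_interior|exact: nbhs_singleton|].
apply: (Ck_comp _ oO' _ (Cf k)) => [|y /interior_subset[]//|i j]; first exact: open_interior.
have H s : Ck k P^° (partials s (fun y => g y i j)).
  elim: k s => [|k IH] s; first by split=> // y /interior_subset[_ /(_ (i, j))/(_ s)[]].
  split=> [y /interior_subset[_ /(_ (i, j))/(_ s)[]]//|e].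
  by split=> [y /interior_subset[_ /(_ (i, j))/(_ s)[_ d]]|]; [exact: d|exact: (IH (e :: s))].
exact: (H [::]).
Qed.

Lemma sm_powR p q (f : 'M[R]_(p, q) -> R) a x :
  0 < f x -> sm f x -> sm (fun y => f y `^ a) x.
Proof.
move=> fx sf; have sf' := sf; move: sf => /smP[ O [oO Ox Cf]]; apply/smP.
have : \forall y \near x, 0 < f y by exact: (cvgr_gt _ (sm_continuous sf')).
move=> /nbhs_interior; set P := (X in X^°) => Px.
have oI := openI oO (open_interior P); exists (O `&` P^°); split=> // [|k].
  by split=> //; exact: nbhs_singleton.
by apply: Ck_powR => // [y [_ /interior_subset]//|]; apply: sub_Ck (Cf k) => y [].
Qed.

Lemma pd_cst p q e (a : R) : pd e (fun _ : 'M[R]_(p, q) => a) = fun=> 0.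
Proof. by apply/funext => x; exact: derive_cst. Qed.

Lemma sm_derivable p q e (f : 'M[R]_(p, q) -> R) x :
  sm f x -> derivable f x (delta_mx e.1 e.2).
Proof. by move=> /sm_near/nbhs_singleton/(_ [::])[_]; apply. Qed.

(** This rule and the next ones hold on a neighbourhood, and not only at [x], so that both sides can
    be differentiated again. *)
Lemma pdD p q e (f g : 'M[R]_(p, q) -> R) x : sm f x -> sm g x ->
  \forall y \near x, pd e (fun y => f y + g y) y = pd e f y + pd e g y.
Proof.
move=> /sm_open sf /sm_open sg; near=> y.
have hf : sm f y by near: y.
have hg : sm g y by near: y.
exact: (deriveD (sm_derivable (e := e) hf) (sm_derivable (e := e) hg)).
Unshelve. all: by end_near. Qed.

Lemma pdM p q e (f g : 'M[R]_(p, q) -> R) x : sm f x -> sm g x ->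
  \forall y \near x, pd e (fun y => f y * g y) y = f y * pd e g y + g y * pd e f y.
Proof.
move=> /sm_open sf /sm_open sg; near=> y.
have hf : sm f y by near: y.
have hg : sm g y by near: y.
exact: (deriveM (sm_derivable (e := e) hf) (sm_derivable (e := e) hg)).
Unshelve. all: by end_near. Qed.

Lemma pd_comp p q p' q' e (f : 'M[R]_(p', q') -> R) (g : 'M[R]_(p, q) -> 'M[R]_(p', q')) x :
  sm f (g x) -> (forall i j, sm (fun y => g y i j) x) ->
  \forall y \near x, pd e (fun y => f (g y)) y =
    \sum_(e' : 'I_p' * 'I_q') pd e' f (g y) * pd e (fun x => g x e'.1 e'.2) y.
Proof.
move=> sf sg.
have gx : {for x, continuous g} by apply: continuous_mx => i j; exact: sm_continuous (sg i j).
have : \forall y \near x, sm f (g y) /\ forall ij : 'I_p' * 'I_q', sm (fun y => g y ij.1 ij.2) y.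
  apply: filterI; first by apply: gx; exact: sm_open.
  exact: (filter_forall (nbhs_filter x) (fun ij => sm_open (sg ij.1 ij.2))).
apply: filterS => y [sfy sgy].
have [|||_ <-] := @is_derive_chain _ _ _ _ f g y (delta_mx e.1 e.2) => // e'.
- by move: (sm_open sfy); apply: filterS => w; exact: sm_derivable.
- exact: sm_continuous (sm_pd e' sfy).
- exact: sm_derivable.
Qed.

End SmoothFunctions.

(** * Jets *)

Section JetConvergence.
Context {R : realType}.

(* Convergence of the M-jet of f n at x n to the M-jet of g at y; both the
   functions and the base points vary. *)
Definition jet_cvg M p q (f : nat -> 'M[R]_(p, q) -> R) (x : nat -> 'M[R]_(p, q))
    (g : 'M[R]_(p, q) -> R) (y : 'M[R]_(p, q)) : Prop :=
  [/\ \forall n \near \oo, sm (f n) (x n), sm g y &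
      forall s, (size s <= M)%N ->
        (fun n => partials s (f n) (x n)) @ \oo --> partials s g y].

Lemma jet_cvg_le M M' p q f x g (y : 'M[R]_(p, q)) : (M' <= M)%N ->
  jet_cvg M f x g y -> jet_cvg M' f x g y.
Proof. by move=> MM [s1 s2 c]; split=> // s sM; apply: c; exact: leq_trans MM. Qed.

Lemma jet_cvg_value M p q f x g (y : 'M[R]_(p, q)) : jet_cvg M f x g y ->
  (fun n => f n (x n)) @ \oo --> g y.
Proof. by move=> [_ _ /(_ [::])]; exact. Qed.

Lemma jet_cvg0 p q f x g (y : 'M[R]_(p, q)) :
  (\forall n \near \oo, sm (f n) (x n)) -> sm g y ->
  (fun n => f n (x n)) @ \oo --> g y -> jet_cvg 0 f x g y.
Proof. by move=> s1 s2 c; split=> // -[]. Qed.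

Lemma jet_cvg_pd M p q e f x g (y : 'M[R]_(p, q)) : jet_cvg M.+1 f x g y ->
  jet_cvg M (fun n => pd e (f n)) x (pd e g) y.
Proof.
move=> [s1 s2 c]; split.
- by apply: filterS s1 => n; exact: sm_pd.
- exact: sm_pd.
- move=> s sM; rewrite -partials_rcons.
  by under eq_fun do rewrite -partials_rcons; apply: c; rewrite size_rcons.
Qed.

(** Peeling off the innermost derivative gives the induction on the order that the sum, product and
    composition rules below share. *)
Lemma jet_cvg_succ M p q f x g (y : 'M[R]_(p, q)) :
  jet_cvg 0 f x g y -> (forall e, jet_cvg M (fun n => pd e (f n)) x (pd e g) y) ->
  jet_cvg M.+1 f x g y.
Proof.
move=> [s1 s2 c0] c; split=> // s; case/lastP: s => [_|s e]; first exact: c0.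
rewrite size_rcons ltnS partials_rcons => sM.
by under eq_fun do rewrite partials_rcons; have [_ _] := c e; apply.
Qed.

Lemma jet_cvg_eq M p q f f' x g g' (y : 'M[R]_(p, q)) :
  (\forall n \near \oo, \forall z \near x n, f n z = f' n z) ->
  (\forall z \near y, g z = g' z) -> jet_cvg M f x g y -> jet_cvg M f' x g' y.
Proof.
move=> ff gg [s1 s2 c]; split.
- by near=> n; apply: (@sm_near_eq _ _ _ (f n)); near: n.
- exact: sm_near_eq gg s2.
- move=> s sM; rewrite -(partials_near_eq s gg).
  apply: cvg_trans (c s sM); apply: near_eq_cvg; near=> n.
  by apply: partials_near_eq; near: n.
Unshelve. all: by end_near. Qed.

Lemma jet_cvg_sm M p q g x (y : 'M[R]_(p, q)) : sm g y -> x @ \oo --> y ->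
  jet_cvg M (fun=> g) x g y.
Proof.
move=> sg xy; split=> //; first by apply: xy; exact: sm_open.
move=> s _; apply: (cvg_comp _ _ xy).
exact/sm_continuous/sm_partials.
Qed.

Lemma jet_cvg_sm_comp M p q p' q' (g : 'M[R]_(p', q') -> R)
    (u : nat -> 'M[R]_(p, q) -> 'M[R]_(p', q')) (v : 'M[R]_(p, q) -> 'M[R]_(p', q')) x y :
  sm g (v y) -> (forall i j, jet_cvg M (fun n z => u n z i j) x (fun z => v z i j) y) ->
  jet_cvg M (fun=> g) (fun n => u n (x n)) g (v y).
Proof.
move=> sg cu; apply: jet_cvg_sm => //.
by apply: cvg_mx => i j; exact: jet_cvg_value (cu i j).
Qed.

Lemma jet_cvgD M p q f1 f2 x g1 g2 (y : 'M[R]_(p, q)) :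
  jet_cvg M f1 x g1 y -> jet_cvg M f2 x g2 y ->
  jet_cvg M (fun n z => f1 n z + f2 n z) x (fun z => g1 z + g2 z) y.
Proof.
elim: M f1 f2 g1 g2 => [|M IH] f1 f2 g1 g2 c1 c2.
all: have [s1 s1' _] := c1; have [s2 s2' _] := c2.
all: have B : jet_cvg 0 (fun n z => f1 n z + f2 n z) x (fun z => g1 z + g2 z) y
  by [apply: jet_cvg0; [near=> n; apply: smD; near: n|exact: smD|
      apply: cvgD; [exact: jet_cvg_value c1|exact: jet_cvg_value c2]]].
  by [].
apply: jet_cvg_succ => // e.
apply: (jet_cvg_eq _ _ (IH _ _ _ _ (jet_cvg_pd e c1) (jet_cvg_pd e c2))).
- near=> n; have := @pdD _ _ _ e (f1 n) (f2 n) (x n).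
  have h1 : sm (f1 n) (x n) by near: n.
  have perturb_germ : sm (f2 n) (x n) by near: n.
  by move=> /(_ h1 perturb_germ); apply: filterS => z ->.
- by have := pdD e s1' s2'; apply: filterS => z ->.
Unshelve. all: by end_near. Qed.

Lemma jet_cvgM M p q f1 f2 x g1 g2 (y : 'M[R]_(p, q)) :
  jet_cvg M f1 x g1 y -> jet_cvg M f2 x g2 y ->
  jet_cvg M (fun n z => f1 n z * f2 n z) x (fun z => g1 z * g2 z) y.
Proof.
elim: M f1 f2 g1 g2 => [|M IH] f1 f2 g1 g2 c1 c2.
all: have [s1 s1' _] := c1; have [s2 s2' _] := c2.
all: have B : jet_cvg 0 (fun n z => f1 n z * f2 n z) x (fun z => g1 z * g2 z) y
  by [apply: jet_cvg0; [near=> n; apply: smM; near: n|exact: smM|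
      apply: cvgM; [exact: jet_cvg_value c1|exact: jet_cvg_value c2]]].
  by [].
have c1' := jet_cvg_le (leqnSn M) c1; have c2' := jet_cvg_le (leqnSn M) c2.
apply: jet_cvg_succ => // e.
apply: (jet_cvg_eq _ _ (jet_cvgD (IH _ _ _ _ c1' (jet_cvg_pd e c2))
  (IH _ _ _ _ c2' (jet_cvg_pd e c1)))).
- near=> n; have := @pdM _ _ _ e (f1 n) (f2 n) (x n).
  have h1 : sm (f1 n) (x n) by near: n.
  have perturb_germ : sm (f2 n) (x n) by near: n.
  by move=> /(_ h1 perturb_germ); apply: filterS => z ->.
- by have := pdM e s1' s2'; apply: filterS => z ->.
Unshelve. all: by end_near. Qed.

Lemma jet_cvg_cst M p q (a : R) x (y : 'M[R]_(p, q)) :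
  jet_cvg M (fun n => fun=> a) x (fun=> a) y.
Proof.
elim: M a => [|M IH] a.
  by apply: jet_cvg0; [apply: nearW => n; exact: sm_cst|exact: sm_cst|exact: cvg_cst].
apply: jet_cvg_succ => [|e].
  by apply: jet_cvg0; [apply: nearW => n; exact: sm_cst|exact: sm_cst|exact: cvg_cst].
by rewrite !pd_cst.
Qed.

Lemma jet_cvg_sum M p q (I : Type) (s : seq I) f x g (y : 'M[R]_(p, q)) :
  (forall i, jet_cvg M (f i) x (g i) y) ->
  jet_cvg M (fun n z => \sum_(i <- s) f i n z) x (fun z => \sum_(i <- s) g i z) y.
Proof.
move=> c; elim: s => [|i s IH].
  rewrite (_ : (fun n z => _) = fun n => fun=> 0); last first.
    by apply/funext => n; apply/funext => z; rewrite big_nil.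
  rewrite [X in jet_cvg _ _ _ X _](_ : _ = fun=> 0); last first.
    by apply/funext => z; rewrite big_nil.
  exact: jet_cvg_cst.
rewrite (_ : (fun n z => _) = fun n z => f i n z + \sum_(i <- s) f i n z); last first.
  by apply/funext => n; apply/funext => z; rewrite big_cons.
rewrite [X in jet_cvg _ _ _ X _](_ : _ = fun z => g i z + \sum_(i <- s) g i z); last first.
  by apply/funext => z; rewrite big_cons.
exact: jet_cvgD.
Qed.

(** The chain rule writes the partial derivatives of the composite as sums of products, to which the
    induction hypothesis at order [M] and [jet_cvgM] apply. *)
Lemma jet_cvg_comp M p q p' q' (f : nat -> 'M[R]_(p', q') -> R) g
    (u : nat -> 'M[R]_(p, q) -> 'M[R]_(p', q')) (v : 'M[R]_(p, q) -> 'M[R]_(p', q')) x y :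
  jet_cvg M f (fun n => u n (x n)) g (v y) ->
  (forall i j, jet_cvg M (fun n z => u n z i j) x (fun z => v z i j) y) ->
  jet_cvg M (fun n z => f n (u n z)) x (fun z => g (v z)) y.
Proof.
elim: M f g => [|M IH] f g cf cu.
all: have [sf sg _] := cf.
all: have su : \forall n \near \oo, forall ij : 'I_p' * 'I_q', sm (fun z => u n z ij.1 ij.2) (x n)
  by [apply: filter_forall => -[i j]; have [] := cu i j].
all: have sv i j : sm (fun z => v z i j) y by have [] := cu i j.
all: have B : jet_cvg 0 (fun n z => f n (u n z)) x (fun z => g (v z)) y
  by [apply: jet_cvg0; [|exact: sm_comp|exact: jet_cvg_value cf]; near=> n; apply: sm_comp;
     [near: n|move=> i j; have : forall ij, sm (fun z => u n z ij.1 ij.2) (x n); [near: n|move/(_ (i, j))]]].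
  by [].
have cf' := jet_cvg_le (leqnSn M) cf.
have cu' i j := jet_cvg_le (leqnSn M) (cu i j).
apply: jet_cvg_succ => // e.
apply: (jet_cvg_eq _ _ (jet_cvg_sum (index_enum ('I_p' * 'I_q')%type) (fun e' => jet_cvgM
   (IH _ _ (jet_cvg_pd e' cf) cu') (jet_cvg_pd e (cu e'.1 e'.2))))).
- near=> n; have := @pd_comp _ _ _ _ _ e (f n) (u n) (x n).
  have h1 : sm (f n) (u n (x n)) by near: n.
  have perturb_germ : forall ij, sm (fun z => u n z ij.1 ij.2) (x n) by near: n.
  by move=> /(_ h1 (fun i j => perturb_germ (i, j))); apply: filterS => z ->.
- by have := pd_comp e sg sv; apply: filterS => z ->.
Unshelve. all: by end_near. Qed.

(** Equality of jets is encoded as convergence of a constant sequence, so that every rule for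
    [jet_cvg] is also a rule for jets at one point. *)
Definition jet_eq M p q (f g : 'M[R]_(p, q) -> R) (x : 'M[R]_(p, q)) : Prop :=
  jet_cvg M (fun=> f) (fun=> x) g x.

Lemma jet_eqP M p q (f g : 'M[R]_(p, q) -> R) x : sm f x -> sm g x ->
  jet_eq M f g x <-> forall s, (size s <= M)%N -> partials s f x = partials s g x.
Proof.
move=> sf sg; split=> [[_ _ c] s sM|fg].
  rewrite -(cvg_lim (@Rhausdorff R) (c s sM)) lim_cst//; exact: Rhausdorff.
by split=> // [|s sM]; [exact: nearW|rewrite fg//; exact: cvg_cst].
Qed.

Lemma jet_eq_smooth M p q (f g : 'M[R]_(p, q) -> R) x :
  jet_eq M f g x -> sm f x /\ sm g x.
Proof.
move=> [sf sg _]; split=> //.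
by have [n _ /(_ _ (leqnn n))] := sf.
Qed.

Lemma jet_cvg_trans M p q f x g g' (y : 'M[R]_(p, q)) :
  jet_cvg M f x g y -> jet_eq M g g' y -> jet_cvg M f x g' y.
Proof.
move=> [s1 s2 c] gg'; have [_ sg'] := jet_eq_smooth gg'; split=> // s sM.
by have /(_ s sM) <- := (jet_eqP M s2 sg').1 gg'; exact: c.
Qed.

Lemma jet_cvg_unique M p q f x g g' (y : 'M[R]_(p, q)) :
  jet_cvg M f x g y -> jet_cvg M f x g' y -> jet_eq M g g' y.
Proof.
move=> [_ sg c] [_ sg' c']; apply/jet_eqP => // s sM.
by rewrite -(cvg_lim (@Rhausdorff R) (c s sM)) (cvg_lim (@Rhausdorff R) (c' s sM)).
Qed.

Lemma jet_cvg_points M p q f x x' g (y : 'M[R]_(p, q)) :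
  (\forall j \near \oo, x j = x' j) -> jet_cvg M f x g y -> jet_cvg M f x' g y.
Proof.
move=> xx [s1 s2 c]; split=> //; first by apply: filterS2 xx s1 => j <-.
move=> s sM; apply: (cvg_trans _ (c s sM)); apply: near_eq_cvg.
by apply: filterS xx => j <-.
Qed.

(** A factor vanishing at [x] gains one order: in the Leibniz formula, either the factor [l] is
    left, which gains the order by induction, or it is differentiated and the order of [f] is
    enough. *)
Lemma jet_eq_vanishM M p q l f g (x : 'M[R]_(p, q)) : sm l x -> l x = 0 ->
  jet_eq M f g x -> jet_eq M.+1 (fun z => l z * f z) (fun z => l z * g z) x.
Proof.
move=> sl lx; elim: M f g => [|M IH] f g fg; have [sf sg] := jet_eq_smooth fg.
all: have lE N (h : 'M[R]_(p, q) -> R) : sm h x -> jet_eq N h h x by move=> sh; apply/jet_eqP.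
all: apply: jet_cvg_succ;
  first by [apply: jet_cvg0; [apply: nearW => _; exact: smM|exact: smM|rewrite lx !mul0r; exact: cvg_cst]].
all: move=> e; have Ef := pdM e sl sf; have Eg := pdM e sl sg.
  apply: (@jet_cvg_eq _ _ _ (fun=> fun z => l z * pd e f z + f z * pd e l z) _ _
    (fun z => l z * pd e g z + g z * pd e l z)).
  - by apply: nearW => _; apply: filterS Ef => z ->.
  - by apply: filterS Eg => z ->.
  - apply: jet_cvgD; last by apply: jet_cvgM => //; apply: lE; exact: sm_pd.
    apply: jet_cvg0; [apply: nearW => _; apply: smM => //; exact: sm_pd|apply: smM => //; exact: sm_pd|].
    by rewrite lx !mul0r; exact: cvg_cst.
apply: (@jet_cvg_eq _ _ _ (fun=> fun z => l z * pd e f z + f z * pd e l z) _ _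
  (fun z => l z * pd e g z + g z * pd e l z)).
- by apply: nearW => _; apply: filterS Ef => z ->.
- by apply: filterS Eg => z ->.
- apply: jet_cvgD; last by apply: jet_cvgM => //; apply: lE; exact: sm_pd.
  by apply: IH; exact: jet_cvg_pd fg.
Qed.

End JetConvergence.

(** * Germs of smooth maps and of diffeomorphisms *)

Section Germs.
Local Opaque smooth_at.
Context {R : realType}.

Lemma smooth_at_sm p q m (f : 'M[R]_(p, q) -> 'cV[R]_m) x i j :
  smooth_at f x -> sm (fun y => f y i j) x.
Proof. by rewrite ord1 => /smooth_atP. Qed.

Lemma smooth_at_continuous p q m (f : 'M[R]_(p, q) -> 'cV[R]_m) x :
  smooth_at f x -> {for x, continuous f}.
Proof. by move=> sf; apply: continuous_mx => i j; exact/sm_continuous/smooth_at_sm. Qed.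

Lemma smooth_at_near p q m (f : 'M[R]_(p, q) -> 'cV[R]_m) x :
  smooth_at f x -> \forall y \near x, smooth_at f y.
Proof.
move=> /smooth_atP sf.
have := filter_forall (nbhs_filter x) (fun i => sm_open (sf i)).
by apply: filterS => y H; apply/smooth_atP.
Qed.

Lemma smooth_at_near_eq p q m (f g : 'M[R]_(p, q) -> 'cV[R]_m) x :
  (\forall y \near x, f y = g y) -> smooth_at f x -> smooth_at g x.
Proof.
move=> fg /smooth_atP sf; apply/smooth_atP => i.
by apply: sm_near_eq (sf i); apply: filterS fg => y ->.
Qed.

Lemma smooth_at_comp p q m l (f : 'cV[R]_m -> 'cV[R]_l) (g : 'M[R]_(p, q) -> 'cV[R]_m) x :
  smooth_at f (g x) -> smooth_at g x -> smooth_at (f \o g) x.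
Proof.
move=> /smooth_atP sf sg; apply/smooth_atP => i.
by apply: (sm_comp (sf i)) => a b; exact: smooth_at_sm.
Qed.

Lemma smooth_at_translation m (c : 'cV[R]_m) (x : 'cV[R]_m) :
  smooth_at (fun y : 'cV[R]_m => c + y) x.
Proof.
apply/smooth_atP => i.
rewrite (_ : (fun y : 'cV[R]_m => _) = fun y => c i ord0 + y i ord0).
  by apply: smD; [exact: sm_cst|exact: sm_coord].
by apply/funext => y; rewrite mxE.
Qed.

Lemma partials_translation p q s (f : 'M[R]_(p, q) -> R) x t :
  partials s (fun y => f (x + y)) t = partials s f (x + t).
Proof.
elim: s t => //= e s IH t; rewrite /derive.
have -> : partials s (fun y => f (x + y)) = fun y => partials s f (x + y).
  exact/funext.
suff -> : (fun h : R => h^-1 *: (((fun y => partials s f (x + y)) \o shift t)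
    (h *: delta_mx e.1 e.2) - partials s f (x + t))) =
  (fun h : R => h^-1 *: ((partials s f \o shift (x + t))
    (h *: delta_mx e.1 e.2) - partials s f (x + t))) by [].
by apply/funext => h /=; rewrite addrCA.
Qed.

Lemma jet_translation k n (g : 'cV[R]_n -> 'cV[R]_n) x :
  jet k (fun t => g (x + t)) 0 = jet k g x.
Proof.
apply/matrixP => i j; rewrite !mxE /partial_multi.
by rewrite (partials_translation _ (fun y => g y i ord0)) addr0.
Qed.

Lemma jet_near_eq k n m (f g : 'cV[R]_n -> 'cV[R]_m) x :
  (\forall y \near x, f y = g y) -> jet k f x = jet k g x.
Proof.
move=> fg; apply/matrixP => i j; rewrite !mxE.
by apply: partials_near_eq; apply: filterS fg => y ->.
Qed.

Lemma cvg_translation n (x : 'cV[R]_n) : (fun t => x + t) @ (0 : 'cV[R]_n) --> x.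
Proof.
rewrite -[X in _ --> X]addr0.
by apply: (smooth_at_continuous (smooth_at_translation x 0)).
Qed.

Lemma near_translation n (x : 'cV[R]_n) (P : set 'cV[R]_n) :
  (\forall y \near x, P y) -> \forall t \near (0 : 'cV[R]_n), P (x + t).
Proof. exact: cvg_translation. Qed.

Lemma diffeo_germ_near_eq n (f g : 'cV[R]_n -> 'cV[R]_n) x :
  (\forall y \near x, f y = g y) -> diffeo_germ f x -> diffeo_germ g x.
Proof.
move=> fg [f' [sf sf' f'f ff']]; have fx := nbhs_singleton fg.
exists f'; rewrite -fx; split; [exact: smooth_at_near_eq fg sf|exact: sf'| |].
- by apply: filterS2 fg f'f => y <-.
- have fg' : \forall y \near f' (f x), f y = g y by rewrite (nbhs_singleton f'f).
  by have := smooth_at_continuous sf' fg'; apply: filterS2 ff' => y /= E1 E2; rewrite -E2.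
Qed.

Lemma diffeo_germ_comp n (f g : 'cV[R]_n -> 'cV[R]_n) x :
  diffeo_germ f (g x) -> diffeo_germ g x -> diffeo_germ (f \o g) x.
Proof.
move=> [f' [sf sf' f'f ff']] [g' [sg sg' g'g gg']]; exists (g' \o f').
have Ef : f' (f (g x)) = g x by exact: (nbhs_singleton f'f).
split.
- exact: smooth_at_comp.
- by apply: smooth_at_comp sf'; rewrite /= Ef.
- have H := smooth_at_continuous sg f'f.
  by near=> y => /=; rewrite (_ : f' (f (g y)) = g y); near: y.
- have H : \forall y \near f' (f (g x)), g (g' y) = y by rewrite Ef.
  have {}H := smooth_at_continuous sf' H.
  by near=> y => /=; rewrite (_ : g (g' (f' y)) = f' y); near: y.
Unshelve. all: by end_near. Qed.

Lemma diffeo_germ_near n (g : 'cV[R]_n -> 'cV[R]_n) x :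
  diffeo_germ g x -> \forall y \near x, diffeo_germ g y.
Proof.
move=> [g' [sg sg' g'g gg']].
have c := smooth_at_continuous sg.
have h1 := smooth_at_near sg; have h3 := near_join g'g.
have perturb_germ : \forall y \near x, smooth_at g' (g y) := c _ (smooth_at_near sg').
have h4 : \forall y \near x, \forall z \near g y, g (g' z) = z := c _ (near_join gg').
apply: filterS2 (filterI h1 perturb_germ) (filterI h3 h4) => y [s1 s2] [d1 d2].
by exists g'.
Qed.

Lemma diffeo_germ_continuous n (g : 'cV[R]_n -> 'cV[R]_n) x :
  diffeo_germ g x -> {for x, continuous g}.
Proof. by case=> g' [/smooth_at_continuous]. Qed.

Lemma diffeo_germ_translation n (c x : 'cV[R]_n) : diffeo_germ (fun t => c + t) x.
Proof.
exists (fun t => - c + t); split; try exact: smooth_at_translation.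
- exact: (filterS (fun y _ => addKr c y) filterT).
- exact: (filterS (fun y _ => addNKr c y) filterT).
Qed.

Lemma diffeo_germ_shift n (g : 'cV[R]_n -> 'cV[R]_n) x :
  diffeo_germ g x -> diffeo_germ (fun t => g (x + t)) 0.
Proof.
move=> dg; apply: (@diffeo_germ_comp _ g (fun t => x + t)); first by rewrite addr0.
exact: diffeo_germ_translation.
Qed.

Lemma fix0_diffeo_shift n (g : 'cV[R]_n -> 'cV[R]_n) x :
  diffeo_germ g x -> fix0_diffeo (fun t => - g x + g (x + t)).
Proof.
move=> dg; split; first by rewrite addr0 addNr.
apply: (@diffeo_germ_comp _ (fun t => - g x + t) (fun t => g (x + t))).
  exact: diffeo_germ_translation.
exact: diffeo_germ_shift.
Qed.

Lemma size_multi_index n k (a : multi_index n k) :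
  (size (flatten [seq nseq (val a i) (i, ord0 : 'I_1) | i <- enum 'I_n]) <= k)%N.
Proof.
rewrite size_flatten /shape -map_comp sumnE big_map /= big_enum /=.
under eq_bigr do rewrite size_nseq.
exact: (valP a).
Qed.

(** An entry of the [k]-jet is a derivative of order at most [k], so its [r]-jet involves orders up
    to [r + k] only. *)
Lemma jet_cvg_jet r k n m p (u : nat -> 'cV[R]_n -> 'M[R]_(m, p.+1)) x
    (v : 'cV[R]_n -> 'M[R]_(m, p.+1)) y i (a : multi_index n k) :
  jet_cvg (r + k) (fun j z => u j z i ord0) x (fun z => v z i ord0) y ->
  jet_cvg r (fun j => partial_multi a (fun z => u j z i ord0)) x
    (partial_multi a (fun z => v z i ord0)) y.
Proof.
move=> [s1 s2 c]; rewrite /partial_multi; split.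
- by apply: filterS s1 => j; exact: sm_partials.
- exact: sm_partials.
- move=> s sr; under eq_fun do rewrite -partials_cat.
  rewrite -partials_cat; apply: c.
  by rewrite size_cat leq_add// size_multi_index.
Qed.

Lemma jet_eq_jet k n m (f g : 'cV[R]_n -> 'cV[R]_m) x :
  (forall i, jet_eq k (fun z => f z i ord0) (fun z => g z i ord0) x) ->
  jet k f x = jet k g x.
Proof.
move=> fg; apply/matrixP => i j; rewrite !mxE.
have [sf sg] := jet_eq_smooth (fg i).
have /(jet_eqP _ sf sg) := fg i; apply; exact: size_multi_index.
Qed.

End Germs.

(** * Shears acting on a variety *)

Section ShearStabilizer.
Context {R : realType}.

Lemma partialsDZ p q s (a : R) (f g : 'M[R]_(p, q) -> R) x : sm f x -> sm g x ->
  partials s (fun y => f y + a * g y) x = partials s f x + a * partials s g x.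
Proof.
elim/last_ind: s f g => [//|s e IH] f g sf sg; rewrite !partials_rcons.
rewrite -IH; [|exact: sm_pd|exact: sm_pd]; apply: partials_near_eq.
have sag : sm (fun y => a * g y) x by apply: smM => //; exact: sm_cst.
apply: filterS2 (pdD e sf sag) (pdM e (sm_cst a x) sg) => y -> ->.
by rewrite pd_cst mulr0 addr0.
Qed.

Lemma poly_eq0_nat_multiples (p : {poly R}) (a : R) : a != 0 ->
  (forall j : nat, p.[a * j%:R] = 0) -> p = 0.
Proof.
move=> a0 H; apply/eqP; apply: contraT => p0.
have := @max_poly_roots _ p [seq a * j%:R | j <- iota 0 (size p)] p0.
rewrite size_map size_iota ltnn => -> //.
  by apply/allP => _ /mapP[j _ ->]; exact/rootP/H.
rewrite map_inj_uniq ?iota_uniq// => i j /(mulfI a0)/eqP.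
by rewrite eqr_nat => /eqP.
Qed.

Lemma peval_line m (q : mpoly.mpoly m R) (u w : 'cV[R]_m) :
  {p : {poly R} | forall s, p.[s] = peval q (u + s *: w)}.
Proof.
exists (mpoly.mmap (@polyC R) (fun i => (u i ord0)%:P + (w i ord0) *: 'X) q) => s.
rewrite /peval /mpoly.meval /mpoly.mmap horner_sum; apply: eq_bigr => m0 _.
rewrite hornerM hornerC; congr (_ * _).
rewrite /mpoly.mmap1 horner_prod; apply: eq_bigr => i _.
by rewrite horner_exp !hornerE !mxE mulrC.
Qed.

Context {n : nat} (i0 i1 : 'I_n).
Hypothesis i01 : i0 != i1.

Definition shear (s : R) (x : 'cV[R]_n) : 'cV[R]_n :=
  x + (s * x i0 ord0) *: delta_mx i1 ord0.

Lemma shearE s x i : shear s x i ord0 = x i ord0 + s * (x i0 ord0 * (i == i1)%:R).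
Proof. by rewrite !mxE eqxx andbT mulrA. Qed.

Lemma shearD s t : shear s \o shear t = shear (s + t).
Proof.
apply/funext => x; apply/colP => i; rewrite /= !shearE (negbTE i01) mulr0 mulr0 addr0.
by ring.
Qed.

Lemma shear0 : shear 0 = id.
Proof. by apply/funext => x; rewrite /shear mul0r scale0r addr0. Qed.

Lemma sm_shear s i x : sm (fun y => shear s y i ord0) x.
Proof.
under eq_fun do rewrite shearE.
apply: smD; first exact: sm_coord.
by apply: smM; [exact: sm_cst|apply: smM; [exact: sm_coord|exact: sm_cst]].
Qed.

Lemma fix0_shear s : fix0_diffeo (shear s).
Proof.
have K t x : shear (- t) (shear t x) = x.
  by rewrite -[LHS]/((shear (- t) \o shear t) x) shearD addNr shear0.
split; first by rewrite /shear mxE mulr0 scale0r addr0.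
exists (shear (- s)); split.
- by apply/smooth_atP => i; exact: sm_shear.
- by apply/smooth_atP => i; exact: sm_shear.
- exact: (filterS (fun y _ => K s y) filterT).
- by apply: (filterS _ filterT) => y _; rewrite -{1}[s]opprK K.
Qed.

(** The jets of the shears run along an affine line, on which the regular functions of jets become
    quotients of polynomials in [s]. *)
Lemma jet_shear k : {D : 'M[R]_(n, njet n k) |
  forall s, jet k (shear s) 0 = jet k id 0 + s *: D}.
Proof.
exists (\matrix_(i, j) partial_multi (enum_val j)
  (fun y : 'cV[R]_n => y i0 ord0 * (i == i1)%:R) 0) => s.
apply/matrixP => i j; rewrite /jet [LHS]mxE [RHS]mxE [X in _ = X + _]mxE.
rewrite [X in _ = _ + X]mxE [X in _ = _ + _ * X]mxE /partial_multi.
rewrite (_ : (fun y => shear s y i ord0) = (fun y : 'cV[R]_n => y i ord0 + s * (y i0 ord0 * (i == i1)%:R))).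
  rewrite partialsDZ//; first exact: sm_coord.
  by apply: smM; [exact: sm_coord|exact: sm_cst].
by apply/funext => y; rewrite shearE.
Qed.

(* The stabilizer of z meets the one-parameter group of shears in an
   algebraic subgroup, which is everything as soon as it is infinite. *)
Lemma shear_stabilizer k (Z : variety R) (act : Z -> 'M[R]_(n, njet n k) -> Z) z a :
  algebraic_action act -> a != 0 ->
  (forall j : nat, act z (jet k (shear (a * j%:R)) 0) = z) ->
  forall s, act z (jet k (shear s) 0) = z.
Proof.
move=> [act1 actM reg] a0 fixz.
have [D jetE] := jet_shear k.
have dk s : @Dk R n k (jet k (shear s) 0) by exists (shear s) => //; exact: fix0_shear.
(* The fraction describing the action is taken at the identity, that is at [s = 0]; its denominator
   is then a nonzero polynomial in [s], with finitely many roots. *)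
have [c [c' /= [q [P [zc q0 H]]]]] := reg z _ (dk 0).
pose u := col_mx (mxvec (jet k (@id 'cV[R]_n) 0))^T (vcoord c z).
pose w := col_mx (mxvec D)^T (0 : 'cV[R]_(vdim c)).
have xyE s : col_mx (mxvec (jet k (shear s) 0))^T (vcoord c z) = u + s *: w.
  rewrite jetE /u /w scale_col_mx add_col_mx scaler0 addr0.
  by rewrite linearD linearZ /= linearD linearZ.
have [Q QE] := peval_line q u w.
pose T b := sval (peval_line (P b) u w).
have TE b s : (T b).[s] = peval (P b) (u + s *: w) by rewrite /T; case: peval_line.
have {}H s : Q.[s] != 0 -> vdom c' (act z (jet k (shear s) 0)) /\
    forall b, vcoord c' (act z (jet k (shear s) 0)) b ord0 = (T b).[s] / Q.[s].
  rewrite QE => Qs; have := H z _ zc (dk s); rewrite xyE => /(_ Qs)[h1 perturb_germ].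
  by split=> // b; rewrite perturb_germ TE.
have Q0 : Q.[0] != 0 by rewrite QE -xyE.
have Qn0 : Q != 0 by apply: contra_neq Q0 => ->; rewrite horner0.
have fix0 : act z (jet k (shear 0) 0) = z by rewrite shear0 act1.
have zc' : vdom c' z by have [+ _] := H _ Q0; rewrite fix0.
have TQ b : T b = vcoord c' z b ord0 *: Q.
  (* The extra factor [Q] takes care of the multiples of [a] at which the denominator vanishes and
     the fraction gives no information. *)
  apply/eqP; rewrite -subr_eq0 -(mulIr_eq0 _ (mulIf Qn0)); apply/eqP.
  apply: (poly_eq0_nat_multiples a0) => j; rewrite hornerM.
  have [->|Qj] := eqVneq Q.[a * j%:R] 0; first by rewrite mulr0.
  have [_ /(_ b)] := H _ Qj; rewrite fixz => E.
  by rewrite hornerD hornerN hornerZ E mulfVK// subrr mul0r.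
have fixs s : Q.[s] != 0 -> act z (jet k (shear s) 0) = z.
  move=> Qs; have [h1 perturb_germ] := H _ Qs; apply: (@vinj _ _ c') => //.
  by apply/colP => b; rewrite perturb_germ TQ hornerZ mulfK.
(* To reach the roots of [Q], the shear by [s] is split into shears by [t] and [s - t] at which [Q]
   does not vanish. The product below is a nonzero polynomial in [t], since its second factor takes
   the value [Q.[0]] at [s]. *)
move=> s; have [t] : exists t, (Q * (Q \Po (s%:P - 'X))).[t] != 0.
  apply: contrapT => nt.
  suff : Q * (Q \Po (s%:P - 'X)) = 0.
    move/eqP; rewrite mulf_eq0 (negbTE Qn0) /= => /eqP E.
    have : (Q \Po (s%:P - 'X)).[s] = 0 by rewrite E horner0.
    by rewrite horner_comp !hornerE subrr => E0; rewrite E0 eqxx in Q0.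
  apply: (@poly_eq0_nat_multiples _ 1); first exact: oner_neq0.
  by move=> j; apply/eqP; apply: contraT => jt; exfalso; apply: nt; exists (1 * j%:R).
rewrite hornerM horner_comp !hornerE mulf_eq0 negb_or => /andP[t1 t2].
rewrite -(subrKC t s) -shearD actM; [|exact: fix0_shear|exact: fix0_shear].
by rewrite fixs// fixs.
Qed.

End ShearStabilizer.

(** * Invariance under translations of the torus *)

Section AStructureGerms.
Context {R : realType} {n : nat} {N : manifold R n}.

Lemma frame_par (i : pidx N) g : diffeo_germ g 0 -> pdom i (g 0) -> frame (par i \o g).
Proof.
move=> dg ig; exists i, g; split=> //.
exact: (filterS (fun y _ => erefl _) filterT).
Qed.

Lemma frame_near_eq (f1 f2 : 'cV[R]_n -> N) :
  (\forall t \near (0 : 'cV[R]_n), f1 t = f2 t) -> frame f1 -> frame f2.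
Proof.
move=> E [i [g [dg ig fg]]]; exists i, g; split=> //.
by apply: filterS2 E fg => t <-.
Qed.

Context {k : nat} {Z : variety R} {act : Z -> 'M[R]_(n, njet n k) -> Z}
  {phi : ('cV[R]_n -> N) -> Z}.
Hypothesis phiA : A_structure act phi.

Lemma phi_near_eq (f1 f2 : 'cV[R]_n -> N) : frame f1 ->
  (\forall t \near (0 : 'cV[R]_n), f1 t = f2 t) -> phi f1 = phi f2.
Proof.
move=> fr E; have fr2 := frame_near_eq E fr.
have [H _ _] := phiA; apply: H => //.
have [i [g [[g' [sg _ _ _]] ig fg]]] := fr; exists i, g, g; split=> //.
by apply: filterS2 E fg => t <-.
Qed.

(** The frame given by [g] at [x] is the standard frame at [g x] precomposed with a germ fixing the
    origin, so the structure is determined by its values at standard frames. *)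
Lemma phi_equivariant (i : pidx N) g x : diffeo_germ g x -> pdom i (g x) ->
  phi (par i \o (fun t => g (x + t))) =
  act (phi (par i \o (fun t => g x + t))) (jet k (fun t => - g x + g (x + t)) 0).
Proof.
move=> dg ig; have [_ _ <-] := phiA.
- by congr phi; apply/funext => t /=; rewrite addNKr.
- apply: frame_par; [exact: diffeo_germ_translation|by rewrite addr0].
- exact: fix0_diffeo_shift.
Qed.

End AStructureGerms.

Section Torus.
Context {R : realType} {n : nat}.

Lemma to_torus_eq (x y : 'cV[R]_n) :
  to_torus x = to_torus y <-> forall i, x i ord0 - y i ord0 \is a Num.int.
Proof.
have -> : to_torus x = to_torus y <-> x - y \is a mxOver Num.int.
  by split=> [/eqP|H]; [rewrite eqmodE|apply/eqP; rewrite eqmodE].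
split=> [/mxOverP H i|H]; first by have := H i ord0; rewrite !mxE.
by apply/mxOverP => i j; rewrite ord1 !mxE; exact: H.
Qed.

Lemma torus_act_to_torus (g : 'M[int]_n) (x : 'cV[R]_n) :
  torus_act g (to_torus x) = to_torus (map_mx intr g *m x).
Proof.
rewrite /torus_act; apply/to_torus_eq => i.
have : to_torus (repr (to_torus x)) = to_torus x by rewrite /to_torus reprK.
move/to_torus_eq => H.
rewrite !mxE -sumrB; apply: rpred_sum => j _.
by rewrite -mulrBr mxE rpredM// intr_int.
Qed.

Lemma not_int_between (x : R) (m : int) : m%:~R < x < (m + 1)%:~R -> x \isn't a Num.int.
Proof.
move=> /andP[h1 perturb_germ]; apply/negP => /intrP[k xk]; move: h1 perturb_germ.
by rewrite xk !ltr_int ltzD1 => h1; rewrite leNgt h1.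
Qed.

End Torus.

(** * From integral shears to real translations *)

Section TranslationInvariance.
Context {R : realType} {n : nat} (hn : (1 < n)%N) {l_minus : 'cV[R]_n -> torus R n}.

Definition i0 : 'I_n := Ordinal (ltnW hn).
Definition i1 : 'I_n := Ordinal hn.

Lemma i0_neq_i1 : i0 != i1. Proof. by []. Qed.

Definition shear_matrix (a : int) : 'M[int]_n := 1%:M + a *: delta_mx i1 i0.

Lemma shear_matrix_mul (a : int) (x : 'cV[R]_n) :
  map_mx intr (shear_matrix a) *m x = shear i0 i1 a%:~R x.
Proof.
apply/colP => i; rewrite shearE map_mxD map_mx1 map_mxZ map_delta_mx mulmxDl mul1mx.
rewrite -scalemxAl mxE [X in _ + X]mxE; congr (_ + _ * _).
rewrite mxE (bigD1 i0)//= big1 ?addr0; last first.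
  by move=> j jn; rewrite mxE (negbTE jn) andbF mul0r.
by rewrite mxE eqxx andbT mulrC.
Qed.

Lemma shear_matrix_Gamma2 (K : int) : Gamma2 (shear_matrix (2 * K)).
Proof.
split=> [|i j].
  rewrite det_trig; first by apply: big1 => i _; rewrite !mxE; case: (eqVneq i i1) => [->|_];
    rewrite ?eqxx /= ?mulr0 ?addr0//.
  apply/is_trig_mxP => i j ij; rewrite !mxE.
  have -> : (i == j) = false by apply/negbTE; rewrite neq_ltn ij.
  case: (eqVneq j i0) => [ji|_]; last by rewrite andbF mulr0.
  by move: ij; rewrite ji.
rewrite !mxE -mulrA; apply/eqP; rewrite eqz_mod_dvd.
have -> : (i == j)%:R = (i == j)%:Z :> int by case: (i == j).
by rewrite addrAC subrr add0r dvdz_mulr.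
Qed.

(** In these bounds coordinate 0 alone keeps the classes away from [p_plus] and [p_minus], whose
    coordinates 0 are 1/2 and 0, so the strip is stable under translations along the axis 1. The
    width 1/4 exceeds the size 1/10 of the glued neighbourhood. *)
Definition strip : set 'cV[R]_n := [set u | 1/2 < u i0 ord0 < 3/4].

Lemma open_strip u : strip u -> \forall v \near u, strip v.
Proof.
move=> /andP[u1 u2].
have c := @coord_continuous R n 1 i0 ord0 u.
by apply: filterS2 (cvgr_gt _ c _ u1) (cvgr_lt _ c _ u2) => v v1 v2; apply/andP.
Qed.

Lemma strip_punctured u : strip u -> to_torus u != p_plus R n /\ to_torus u != p_minus R n.
Proof.
move=> /= /andP[u1 u2]; split; apply/eqP => /to_torus_eq /(_ i0); rewrite mxE /=; apply/negP.
- by apply: (@not_int_between _ _ 0); apply/andP; split; rewrite ?add0r; lra.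
- by apply: (@not_int_between _ _ 0); apply/andP; split; rewrite ?add0r; lra.
Qed.

Lemma strip_dom u w : strip u -> M'dom (inl w : M'idx R n) u.
Proof. exact: strip_punctured. Qed.

Context {k : nat} {Z : variety R} {act : Z -> 'M[R]_(n, njet n k) -> Z}
  {phi : ('cV[R]_n -> M' l_minus) -> Z}.
Hypothesis actA : algebraic_action act.
Hypothesis phiA : A_structure act phi.
Hypothesis phiI : forall g : 'M[int]_n, Gamma2 g -> is_isometry phi (M'act g).
Context (w : punctured_torus R n).

Definition parU : 'cV[R]_n -> M' l_minus := @par _ _ (M' l_minus) (inl w).
Definition sigma (u : 'cV[R]_n) : Z := phi (parU \o (fun t => u + t)).

Lemma M'act_parU g x x' : strip x -> strip x' ->
  (forall i, (map_mx intr g *m x) i ord0 - x' i ord0 \is a Num.int) ->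
  M'act g (parU x) = parU x'.
Proof.
move=> sx sx' E; rewrite /parU /=; congr inl.
have dom y : strip y -> (to_torus y != p_plus R n) && (to_torus y != p_minus R n).
  by move=> /(strip_dom w)/= [h1 perturb_germ]; apply/andP.
have Ew : val (insubd w (to_torus x)) = to_torus x by apply: insubdK; exact: dom.
rewrite Ew torus_act_to_torus.
have -> : to_torus (map_mx intr g *m x) = to_torus x' by apply/to_torus_eq.
apply: val_inj; transitivity (to_torus x'); [|symmetry]; apply: insubdK; exact: dom.
Qed.

Lemma shear_add (s : R) (x y : 'cV[R]_n) : shear i0 i1 s (x + y) = shear i0 i1 s x + shear i0 i1 s y.
Proof. by apply/colP => i; rewrite [RHS]mxE !shearE !mxE; ring. Qed.

(** The isometry sends the standard frame at [u] to the one at [u'] precomposed with the linear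
    shear, hence the action of the shear in the relation between the two values. *)
Lemma sigma_shear (K : int) u u' : strip u -> strip u' ->
  (forall i, shear i0 i1 (2 * K)%:~R u i ord0 - u' i ord0 \is a Num.int) ->
  act (sigma u') (jet k (shear i0 i1 (2 * K)%:~R) 0) = sigma u.
Proof.
move=> su su' E; set s := (2 * K)%:~R in E *.
have fr v : strip v -> frame (parU \o (fun t => v + t)).
  move=> sv; apply: frame_par; first exact: diffeo_germ_translation.
  by rewrite addr0; exact: strip_dom.
have [_ _ <-] := phiA; [|exact: fr|exact: fix0_shear i0_neq_i1 s].
have [_ iso] := phiI (shear_matrix_Gamma2 K).
rewrite /sigma -(iso _ (fr _ su)); apply: (phi_near_eq phiA).
  apply: (@frame_par _ _ (M' l_minus) (inl w) (fun t => u' + shear i0 i1 s t)).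
    apply: (@diffeo_germ_comp _ _ (fun t => u' + t)).
      exact: diffeo_germ_translation.
    by have [] := fix0_shear i0_neq_i1 s.
  by rewrite (fix0_shear i0_neq_i1 s).1 addr0; exact: strip_dom.
have [s0 [s' [/smooth_at_continuous c _ _ _]]] := fix0_shear i0_neq_i1 s.
have nu := near_translation (open_strip su).
have nu' := near_translation (open_strip su').
rewrite -s0 in nu'; have {}nu' := c _ nu'.
apply: filterS2 nu nu' => t st st' /=.
apply/esym/M'act_parU => // i.
rewrite shear_matrix_mul -/s shear_add [X in X - _]mxE [X in _ - X]mxE.
by rewrite opprD addrACA subrr addr0; exact: E.
Qed.

Definition axis1 : 'cV[R]_n := delta_mx i1 ord0.

Lemma strip_axis1 u t : strip u -> strip (u + t *: axis1).
Proof. by rewrite /strip /= !mxE mulr0 addr0. Qed.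

(** The shears of parameter [2 * N * j] move [u] by the integral vector [2 * j * a] along the axis
    1. They fix its class in the torus and so stabilize [sigma u], and [shear_stabilizer] passes
    from these to all parameters. *)
Lemma sigma_stabilizer (a : int) (N : nat) u s : strip u -> (0 < N)%N ->
  u i0 ord0 = a%:~R / N%:R -> act (sigma u) (jet k (shear i0 i1 s) 0) = sigma u.
Proof.
move=> su N0 uE.
have Nn0 : N%:R != 0 :> R by rewrite pnatr_eq0 -lt0n.
apply: (@shear_stabilizer _ _ _ _ i0_neq_i1 _ _ _ _ (2 * N%:R)) => //.
  by rewrite mulf_neq0// pnatr_eq0.
move=> j; have -> : 2 * N%:R * j%:R = (2 * (N * j)%:Z)%:~R :> R.
  by rewrite intrM -pmulrn natrM mulrA.
apply: sigma_shear => // i.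
rewrite shearE addrAC subrr add0r uE intrM -pmulrn natrM.
have -> : 2%:~R * (N%:R * j%:R) * (a%:~R / N%:R * (i == i1)%:R) =
   (2 * j%:Z * a * (i == i1)%:Z)%:~R :> R.
  by rewrite !intrM -!pmulrn; field.
exact: intr_int.
Qed.

(** Coordinate 0 is [b / Q + 1 / Q ^ 2]: multiplied by the shear parameter [2 * Q * q], the first
    term gives an integer and the second the displacement [2 * q / Q]. The linear part of the shear
    is then removed by [sigma_stabilizer], with denominator [Q ^ 2]. *)
Lemma sigma_rational (b q : int) (Q : nat) u : strip u -> (0 < Q)%N ->
  u i0 ord0 = (b%:~R * Q%:R + 1) / (Q%:R ^+ 2) ->
  sigma (u + (2 * q%:~R / Q%:R) *: axis1) = sigma u.
Proof.
move=> su Q0 uE; set u' := u + _.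
have Qn0 : Q%:R != 0 :> R by rewrite pnatr_eq0 -lt0n.
have su' : strip u' by exact: strip_axis1.
rewrite -(@sigma_stabilizer (b * Q + 1) (Q ^ 2) u' (2 * (Q%:Z * q))%:~R)//.
- apply: sigma_shear => // i.
  rewrite shearE !mxE uE eqxx andbT.
  set d := (i == i1)%:R.
  have -> : u i ord0 + (2 * (Q%:Z * q))%:~R * ((b%:~R * Q%:R + 1) / Q%:R ^+ 2 * d) -
      (u i ord0 + 2 * q%:~R / Q%:R * d) = (2 * q * b * (i == i1)%:Z)%:~R.
    by rewrite !intrM -!pmulrn /d; field.
  exact: intr_int.
- by rewrite expn_gt0 Q0.
- by rewrite mxE [X in _ + X]mxE mxE /= mulr0 addr0 uE natrX intrD intrM.
Qed.

Lemma floor_approx (x : R) :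
  (fun m : nat => (Num.floor (m.+1%:R * x))%:~R / m.+1%:R) @ \oo --> x.
Proof.
apply/cvgrPdist_le => e e0.
near=> m; have m0 : (0 : R) < m.+1%:R by rewrite ltr0n.
have me : m.+1%:R^-1 < e by near: m; exact: (near_infty_natSinv_lt (PosNum e0)).
apply: le_trans (ltW me).
have := floor_itv (m.+1%:R * x); rewrite intrD => /andP[h1 perturb_germ].
set f := (Num.floor _)%:~R in h1 perturb_germ *.
have -> : x - f / m.+1%:R = (m.+1%:R * x - f) / m.+1%:R by field; rewrite gt_eqF.
rewrite ger0_norm; last by rewrite divr_ge0// subr_ge0.
by rewrite ler_pdivrMr// mulVf ?gt_eqF// lerBlDl ltW.
Unshelve. all: by end_near. Qed.

Lemma cvg_natSinv : (fun m : nat => m.+1%:R^-1 : R) @ \oo --> (0 : R).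
Proof.
apply/cvgrPdist_lt => e e0; near=> m.
rewrite sub0r normrN ger0_norm ?invr_ge0//.
by near: m; exact: (near_infty_natSinv_lt (PosNum e0)).
Unshelve. all: by end_near. Qed.

(** The [k]-jet of the standard frame at [v] is [jet k id v], which is smooth in [v]; this turns the
    smoothness of the structure into that of [sigma]. *)
Lemma sigma_chart u c : strip u -> vdom c (sigma u) ->
  \forall v \near u, vdom c (sigma v) /\
    forall a, sm (fun v => vcoord c (sigma v) a ord0) v.
Proof.
move=> su uc; have [_ /(_ (inl w))[F [sF phiF]] _] := phiA.
pose J (v : 'cV[R]_n) := jet k (@id 'cV[R]_n) v.
have sigmaE v : strip v -> sigma v = F (J v).
  move=> sv; rewrite -[J v](jet_translation k id v) -phiF//.
    exact: diffeo_germ_translation.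
  by rewrite addr0; exact: strip_dom.
have cJ a b : sm (fun v => J v a b) u.
  rewrite (_ : (fun v => _) = partial_multi (enum_val b) (fun y => y a ord0)).
    exact/sm_partials/sm_coord.
  by apply/funext => v; rewrite mxE.
have cJ' : {for u, continuous J} by apply: continuous_mx => a b; exact: sm_continuous.
have [||nF smF] := sF (J u) _ c.
- exists (fun t => u + t); last exact: (jet_translation k id u).
  by split; [exact: diffeo_germ_translation|rewrite addr0; exact: strip_dom].
- by rewrite -sigmaE.
have nst := open_strip su.
have H1 : \forall v \near u, vdom c (sigma v).
  have nF' : \forall v \near u, vdom c (F (J v)) := cJ' _ nF.
  by apply: filterS2 nst nF' => v sv; rewrite sigmaE.
have H2 : \forall v \near u, forall a, sm (fun v => vcoord c (sigma v) a ord0) v.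
  have sa a : sm (fun v => vcoord c (F (J v)) a ord0) u.
    by have /smooth_atP/(_ a) sFa := smF; exact: (sm_comp sFa cJ).
  have := filter_forall (nbhs_filter u) (fun a => sm_open (sa a)).
  apply: filterS2 (near_join nst) => v nv H a.
  by apply: sm_near_eq (H a); apply: filterS nv => v' sv'; rewrite sigmaE.
exact: filterI H1 H2.
Qed.

Lemma cvg_addZ (u d : 'cV[R]_n) (x : nat -> R) (l : R) :
  x @ \oo --> l -> (fun m => u + x m *: d) @ \oo --> u + l *: d.
Proof. by move=> xl; exact: (cvgD (cvg_cst u) (cvgZ xl (cvg_cst d))). Qed.

(** Only small [t] are treated at first because the limit is taken in the coordinates of one chart
    of [Z], which has to contain the values at both ends. *)
Lemma sigma_locally_invariant u : strip u ->
  \forall t \near (0 : R), sigma (u + t *: axis1) = sigma u.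
Proof.
move=> su; have [c uc] := vcover (sigma u).
have H := sigma_chart su uc.
have te : (fun t : R => u + t *: axis1) @ (0 : R) --> u.
  have c0 : (fun t : R => t) @ (0 : R) --> (0 : R) by exact: cvg_id.
  have := cvgD (cvg_cst u) (cvgZ c0 (cvg_cst axis1)).
  by rewrite scale0r addr0 => C; exact: C.
have {}te : \forall t \near (0 : R), vdom c (sigma (u + t *: axis1)) /\
    forall a, sm (fun v => vcoord c (sigma v) a ord0) (u + t *: axis1) := te _ H.
apply: filterS te => t [tc smt].
have [_ smu] := nbhs_singleton H.
apply: (@vinj _ _ c) => //; apply/colP => a.
(* With [Q = m + 1], the integers [b m] and [q m] are such that the admissible coordinate 0 of
   [sigma_rational] tends to that of [u], with error [x m], while the admissible displacement [r m]
   tends to [t]. *)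
pose b m : int := Num.floor (m.+1%:R * u i0 ord0).
pose q m : int := Num.floor (m.+1%:R * (t / 2)).
pose x m : R := ((b m)%:~R * m.+1%:R + 1) / m.+1%:R ^+ 2 - u i0 ord0.
pose r m : R := 2 * (q m)%:~R / m.+1%:R.
have x0 : x @ \oo --> (0 : R).
  have m2 : (fun m : nat => m.+1%:R^-1 * m.+1%:R^-1 : R) @ \oo --> (0 * 0 : R).
    by apply: cvgM; exact: cvg_natSinv.
  have C : (fun m : nat => (b m)%:~R / m.+1%:R + m.+1%:R^-1 * m.+1%:R^-1 - u i0 ord0)
      @ \oo --> u i0 ord0 + 0 * 0 - u i0 ord0.
    by apply: cvgB; [apply: cvgD => //; exact: floor_approx|exact: cvg_cst].
  rewrite mulr0 addr0 subrr in C; rewrite (_ : x = (fun m : nat =>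
    (b m)%:~R / m.+1%:R + m.+1%:R^-1 * m.+1%:R^-1 - u i0 ord0))//.
  apply/funext => m; rewrite /x.
  have m0 : m.+1%:R != 0 :> R by rewrite pnatr_eq0.
  by field.
have rt : r @ \oo --> t.
  have C : (fun m : nat => 2 * ((q m)%:~R / m.+1%:R)) @ \oo --> 2 * (t / 2).
    by apply: cvgM; [exact: cvg_cst|exact: floor_approx].
  rewrite mulrCA divff// mulr1 in C; rewrite (_ : r = (fun m : nat =>
    2 * ((q m)%:~R / m.+1%:R)))//.
  by apply/funext => m; rewrite /r mulrA.
have v1 : (fun m => u + x m *: delta_mx i0 ord0) @ \oo --> u.
  by have := @cvg_addZ u (delta_mx i0 ord0) _ _ x0; rewrite scale0r addr0.
have v2 : (fun m => u + x m *: delta_mx i0 ord0 + r m *: axis1) @ \oo --> u + t *: axis1.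
  exact: (cvgD v1 (cvgZ rt (cvg_cst axis1))).
have st : \forall m \near \oo, strip (u + x m *: delta_mx i0 ord0) := v1 _ (open_strip su).
have L1 := cvg_comp _ _ v1 (sm_continuous (smu a)).
have L2 := cvg_comp _ _ v2 (sm_continuous (smt a)).
have L3 : (fun m => vcoord c (sigma (u + x m *: delta_mx i0 ord0)) a ord0) @ \oo
    --> vcoord c (sigma (u + t *: axis1)) a ord0.
  apply: (cvg_trans _ L2); apply: near_eq_cvg; apply: filterS st => m sm /=.
  rewrite (@sigma_rational (b m) (q m) m.+1)//.
  by rewrite mxE [X in _ + X]mxE mxE !eqxx mulr1 /x subrKC.
by rewrite -(cvg_lim (@Rhausdorff R) L3) -(cvg_lim (@Rhausdorff R) L1).
Qed.

(** Local constancy along the axis makes the set of parameters with a given value both open and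
    closed in a segment, which is connected. *)
Lemma sigma_invariant u t : strip u -> sigma (u + t *: axis1) = sigma u.
Proof.
move=> su.
suff pos v s : strip v -> 0 <= s -> sigma (v + s *: axis1) = sigma v.
  have [t0|/ltW t0] := leP 0 t; first exact: pos.
  rewrite -(pos (u + t *: axis1) (- t)) ?oppr_ge0//; last exact: strip_axis1.
  by rewrite -addrA -scalerDl subrr scale0r addr0.
move=> sv s0.
have loc (x : R) : \forall y \near x, sigma (v + y *: axis1) = sigma (v + x *: axis1).
  have := sigma_locally_invariant (strip_axis1 x sv).
  rewrite -{1}(subrr x) => H.
  have c : (fun y : R => y - x) @ x --> x - x.
    by apply: cvgB; [exact: cvg_id|exact: cvg_cst].
  have {}H : \forall y \near x, sigma (v + x *: axis1 + (y - x) *: axis1) = sigma (v + x *: axis1) := c _ H.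
  by apply: filterS H => y; rewrite -addrA -scalerDl subrKC.
pose C : set R := [set x | sigma (v + x *: axis1) = sigma v].
suff E : `[0, s] `&` C = `[0, s]%classic.
  have : (`[0, s] `&` C) s by rewrite E /= in_itv /= s0 lexx.
  by case.
apply: segment_connected.
- by exists 0; split; [rewrite /= in_itv /= lexx|rewrite /C /= scale0r addr0].
- exists C => //; rewrite openE => x Cx.
  by apply: filterS (loc x) => y; rewrite Cx.
- exists C => //; rewrite -openC openE => x nCx.
  by apply: filterS (loc x) => y E Cy; apply: nCx; rewrite /C /= -E.
Qed.

End TranslationInvariance.

(** * Translations in the blow-up chart *)

Section BlowUp.
Context {R : realType} {n : nat} (hn : (1 < n)%N).
Local Notation i0 := (i0 hn).
Local Notation i1 := (i1 hn).

Lemma n_gt0 : (0 : R) < n%:R. Proof. by rewrite ltr0n ltnW. Qed.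

Definition alpha : R := (n%:R - 1) / n%:R.
(** The inverse of [rho] multiplies a vector by the power [n - 1] of its norm, that is by the power
    [beta] of its squared norm. *)
Definition beta : R := (n%:R - 1) / 2.

Lemma alphaE : 1 - alpha = n%:R^-1.
Proof. by rewrite /alpha; field; rewrite gt_eqF// n_gt0. Qed.

Lemma betaE : alpha / 2 = beta * n%:R^-1.
Proof. by rewrite /alpha /beta; field; rewrite gt_eqF// n_gt0. Qed.

(** The squared norm is polynomial, hence smooth everywhere, and its real powers are smooth away
    from 0. *)
Definition sqnorm (u : 'cV[R]_n) : R := \sum_i u i ord0 ^+ 2.

Lemma sqnorm_ge0 u : 0 <= sqnorm u.
Proof. by apply: sumr_ge0 => i _; exact: sqr_ge0. Qed.

Lemma sqnorm_gt0 (u : 'cV[R]_n) i : u i ord0 != 0 -> 0 < sqnorm u.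
Proof.
move=> ui; rewrite /sqnorm (bigD1 i)//= ltr_pwDl//; first by rewrite exprn_even_gt0.
by apply: sumr_ge0 => j _; exact: sqr_ge0.
Qed.

Lemma sqnormZ a u : sqnorm (a *: u) = a ^+ 2 * sqnorm u.
Proof. by rewrite /sqnorm mulr_sumr; apply: eq_bigr => i _; rewrite mxE exprMn. Qed.

Lemma enormE u : enorm u = sqnorm u `^ 2^-1.
Proof. by rewrite powR12_sqrt// sqnorm_ge0. Qed.

Lemma rhoE u : rho u = sqnorm u `^ (- (alpha / 2)) *: u.
Proof. by rewrite /rho enormE -powRrM; congr (_ `^ _ *: _); rewrite /alpha mulrN mulrC. Qed.

Definition rhoinv (u : 'cV[R]_n) : 'cV[R]_n := sqnorm u `^ beta *: u.

Lemma powRV (s a : R) : 0 < s -> s `^ a * s `^ (- a) = 1.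
Proof. by move=> s0; rewrite -powRD ?subrr ?powRr0// (gt_eqF s0) implybT. Qed.

Lemma sqr_powR (s a : R) : 0 < s -> (s `^ a) ^+ 2 = s `^ (2 * a).
Proof. by move=> s0; rewrite expr2 -powRD ?(gt_eqF s0) ?implybT// mulr2n mulrDl !mul1r. Qed.

(* [rho] and [rhoinv] are radial, with exponents [1 / n] and [n]. *)
Lemma radialK (s a b : R) (u : 'cV[R]_n) : 0 < sqnorm u -> a + b * (2 * a + 1) = 0 ->
  sqnorm (sqnorm u `^ a *: u) `^ b *: (sqnorm u `^ a *: u) = u.
Proof.
move=> u0 ab; have ne (x : R) : (x == 0) ==> (sqnorm u != 0) by rewrite (gt_eqF u0) implybT.
have -> : sqnorm (sqnorm u `^ a *: u) = sqnorm u `^ (2 * a + 1).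
  by rewrite sqnormZ sqr_powR// powRD// powRr1 ?ltW.
rewrite -powRrM scalerA -powRD//.
by rewrite addrC [_ * b]mulrC ab powRr0 scale1r.
Qed.

Lemma rhoK u : 0 < sqnorm u -> rhoinv (rho u) = u.
Proof.
move=> u0; rewrite rhoE; apply: (radialK 0) => //.
rewrite /beta (_ : 2 * _ + 1 = n%:R^-1).
  by rewrite /alpha; field; rewrite gt_eqF// n_gt0.
by rewrite -alphaE; field.
Qed.

Lemma rhoinvK u : 0 < sqnorm u -> rho (rhoinv u) = u.
Proof.
move=> u0; rewrite rhoE; apply: (radialK 0) => //.
by rewrite /beta /alpha; field; rewrite gt_eqF// n_gt0.
Qed.

Lemma sm_sqnorm u : sm sqnorm u.
Proof. by apply: sm_sum => i; apply: sm_exp; exact: sm_coord. Qed.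

Lemma smooth_radial a u : 0 < sqnorm u -> smooth_at (fun u => sqnorm u `^ a *: u) u.
Proof.
move=> u0; apply/smooth_atP => i.
rewrite (_ : (fun y => _) = fun y : 'cV[R]_n => sqnorm y `^ a * y i ord0).
  by apply: smM; [apply: sm_powR => //; exact: sm_sqnorm|exact: sm_coord].
by apply/funext => y; rewrite mxE.
Qed.

Lemma near_sqnorm_gt0 u : 0 < sqnorm u -> \forall v \near u, 0 < sqnorm v.
Proof. by move=> u0; exact: (cvgr_gt _ (sm_continuous (sm_sqnorm u))). Qed.

Lemma sqnorm_radial_gt0 a u : 0 < sqnorm u -> 0 < sqnorm (sqnorm u `^ a *: u).
Proof. by move=> u0; rewrite sqnormZ mulr_gt0// exprn_gt0// powR_gt0. Qed.

Lemma diffeo_rho u : 0 < sqnorm u -> diffeo_germ (@rho R n) u.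
Proof.
move=> u0; have rE : @rho R n = fun u => sqnorm u `^ (- (alpha / 2)) *: u.
  by apply/funext => v; rewrite rhoE.
have ru0 : 0 < sqnorm (rho u) by rewrite rhoE sqnorm_radial_gt0.
exists rhoinv; split.
- by rewrite rE; exact: smooth_radial.
- exact: smooth_radial.
- by apply: filterS (near_sqnorm_gt0 u0) => v; exact: rhoK.
- by apply: filterS (near_sqnorm_gt0 ru0) => v; exact: rhoinvK.
Qed.

Lemma diffeo_rhoinv u : 0 < sqnorm u -> diffeo_germ rhoinv u.
Proof.
move=> u0; have rE : @rho R n = fun u => sqnorm u `^ (- (alpha / 2)) *: u.
  by apply/funext => v; rewrite rhoE.
have ru0 : 0 < sqnorm (rhoinv u) by rewrite sqnorm_radial_gt0.
exists (@rho R n); split.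
- exact: smooth_radial.
- by rewrite rE; exact: smooth_radial.
- by apply: filterS (near_sqnorm_gt0 u0) => v; exact: rhoinvK.
- by apply: filterS (near_sqnorm_gt0 ru0) => v; exact: rhoK.
Qed.

Local Notation vv := (chart_vec i0 false).

Lemma chart_vecE (x : 'cV[R]_n) i : vv x i ord0 = if i == i0 then 1 else x i ord0.
Proof. by rewrite mxE expr0. Qed.

(* The map [q] of the blow-up, in the chart around the ray of the first basis
   vector. *)
Definition blow_down (x : 'cV[R]_n) : 'cV[R]_n := x i0 ord0 *: vv x.

(** The quotient by coordinate 0 is written with a real power so that [sm_powR] applies; it is meant
    only where this coordinate is positive. *)
Definition blow_down_inv (u : 'cV[R]_n) : 'cV[R]_n :=
  \col_i (if i == i0 then u i0 ord0 else u i ord0 * u i0 ord0 `^ (- 1)).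

Lemma blow_downE x i : blow_down x i ord0 = if i == i0 then x i0 ord0 else x i0 ord0 * x i ord0.
Proof. by rewrite mxE chart_vecE; case: eqP; rewrite ?mulr1. Qed.

Lemma blow_downK (x : 'cV[R]_n) : 0 < x i0 ord0 -> blow_down_inv (blow_down x) = x.
Proof.
move=> x0; apply/colP => i; rewrite mxE !blow_downE eqxx; case: eqP => [->//|_].
by rewrite powR_inv1 ?ltW// mulrAC divff ?mul1r// gt_eqF.
Qed.

Lemma blow_down_invK (u : 'cV[R]_n) : 0 < u i0 ord0 -> blow_down (blow_down_inv u) = u.
Proof.
move=> u0; apply/colP => i; rewrite blow_downE !mxE eqxx; case: eqP => [->//|_].
by rewrite powR_inv1 ?ltW// mulrCA divff ?mulr1// gt_eqF.
Qed.

Lemma smooth_blow_down x : smooth_at blow_down x.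
Proof.
apply/smooth_atP => i; under eq_fun do rewrite blow_downE.
by case: eqP => _; [exact: sm_coord|apply: smM; exact: sm_coord].
Qed.

Lemma smooth_blow_down_inv (u : 'cV[R]_n) : 0 < u i0 ord0 -> smooth_at blow_down_inv u.
Proof.
move=> u0; apply/smooth_atP => i; under eq_fun do rewrite mxE.
case: eqP => _; first exact: sm_coord.
by apply: smM; [exact: sm_coord|apply: sm_powR => //; exact: sm_coord].
Qed.

Lemma near_coord_gt0 (x : 'cV[R]_n) : 0 < x i0 ord0 -> \forall y \near x, 0 < (y : 'cV[R]_n) i0 ord0.
Proof. by move=> x0; exact: (cvgr_gt _ (@coord_continuous R n 1 i0 ord0 x)). Qed.

Lemma blow_down_gt0 (x : 'cV[R]_n) : 0 < x i0 ord0 -> 0 < blow_down x i0 ord0.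
Proof. by rewrite blow_downE eqxx. Qed.

Lemma blow_down_inv_gt0 (x : 'cV[R]_n) : 0 < x i0 ord0 -> 0 < blow_down_inv x i0 ord0.
Proof. by rewrite mxE eqxx. Qed.

Lemma diffeo_blow_down (x : 'cV[R]_n) : 0 < x i0 ord0 -> diffeo_germ blow_down x.
Proof.
move=> x0; exists blow_down_inv; split.
- exact: smooth_blow_down.
- exact/smooth_blow_down_inv/blow_down_gt0.
- by apply: filterS (near_coord_gt0 x0) => v; exact: blow_downK.
- by apply: filterS (near_coord_gt0 (blow_down_gt0 x0)) => v; exact: blow_down_invK.
Qed.

Lemma diffeo_blow_down_inv (u : 'cV[R]_n) : 0 < u i0 ord0 -> diffeo_germ blow_down_inv u.
Proof.
move=> x0; exists blow_down; split.
- exact: smooth_blow_down_inv.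
- exact: smooth_blow_down.
- by apply: filterS (near_coord_gt0 x0) => v; exact: blow_down_invK.
- by apply: filterS (near_coord_gt0 (blow_down_inv_gt0 x0)) => v; exact: blow_downK.
Qed.

Lemma coord_sqnorm_gt0 (u : 'cV[R]_n) : 0 < u i0 ord0 -> 0 < sqnorm u.
Proof. by move=> u0; apply: (@sqnorm_gt0 _ (i0)); rewrite gt_eqF. Qed.

(** The gluing map in chart coordinates: for [x_0 > 0] in the domain of the chart, the point [x] is
    glued to [l_plus (chi x)]. *)
Definition chi (x : 'cV[R]_n) : 'cV[R]_n := rho (blow_down x).

Lemma chi_gt0 (x : 'cV[R]_n) : 0 < x i0 ord0 -> 0 < chi x i0 ord0.
Proof.
move=> x0; rewrite /chi rhoE mxE mulr_gt0 ?blow_down_gt0// powR_gt0//.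
exact/coord_sqnorm_gt0/blow_down_gt0.
Qed.

Lemma diffeo_chi (x : 'cV[R]_n) : 0 < x i0 ord0 -> diffeo_germ chi x.
Proof.
move=> x0; apply: (@diffeo_germ_comp _ _ (@rho R n) blow_down); last exact: diffeo_blow_down.
exact/diffeo_rho/coord_sqnorm_gt0/blow_down_gt0.
Qed.

Definition chiinv (u : 'cV[R]_n) := blow_down_inv (rhoinv u).

Lemma chiK (x : 'cV[R]_n) : 0 < x i0 ord0 -> chiinv (chi x) = x.
Proof.
by move=> x0; rewrite /chiinv rhoK ?blow_downK//; exact/coord_sqnorm_gt0/blow_down_gt0.
Qed.

Lemma diffeo_chiinv (u : 'cV[R]_n) : 0 < u i0 ord0 -> diffeo_germ chiinv u.
Proof.
move=> u0; apply: (@diffeo_germ_comp _ _ blow_down_inv rhoinv); last exact/diffeo_rhoinv/coord_sqnorm_gt0.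
by apply: diffeo_blow_down_inv; rewrite mxE mulr_gt0// powR_gt0// coord_sqnorm_gt0.
Qed.

Definition chart_sqnorm (x : 'cV[R]_n) : R := sqnorm (vv x).

Lemma chart_sqnorm_gt0 x : 0 < chart_sqnorm x.
Proof. by apply: (@sqnorm_gt0 _ (i0)); rewrite chart_vecE eqxx oner_neq0. Qed.

Lemma chart_sqnorm_0 : chart_sqnorm 0 = 1.
Proof.
rewrite /chart_sqnorm /sqnorm (bigD1 i0)//= chart_vecE eqxx expr1n big1 ?addr0// => i ii.
by rewrite chart_vecE (negbTE ii) mxE expr0n.
Qed.

Lemma sm_chart_sqnorm x : sm chart_sqnorm x.
Proof.
apply: sm_sum => i; apply: sm_exp; under eq_fun do rewrite chart_vecE.
by case: eqP => _; [exact: sm_cst|exact: sm_coord].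
Qed.

(* The translation by [t] along the second axis of the torus, conjugated by
   [chi], is [conj_translation (tau t)]. *)
Definition tau (t : R) (x : 'cV[R]_n) : R :=
  t * x i0 ord0 `^ (- n%:R^-1) * chart_sqnorm x `^ (alpha / 2).

(** A translation along the axis 1 preserves coordinate 0 in the torus, which is
    [x_0 ^ (1/n) * S ^ (- alpha / 2)] with [S = chart_sqnorm x]. When [S] becomes [S'], this forces
    [x_0] to be multiplied by [(S' / S) ^ beta]. The function [f] is kept general because the limit
    of the [tau t] takes their place later. *)
Definition stretch (f : 'cV[R]_n -> R) (x : 'cV[R]_n) : R :=
  chart_sqnorm (x + f x *: delta_mx i1 ord0) `^ beta * chart_sqnorm x `^ (- beta).

Definition conj_translation (f : 'cV[R]_n -> R) (x : 'cV[R]_n) : 'cV[R]_n :=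
  \col_i (if i == i0 then x i0 ord0 * stretch f x
          else x i ord0 + f x * (i == i1)%:R).

Lemma chart_vec_conj f x : vv (conj_translation f x) = vv x + f x *: delta_mx i1 ord0.
Proof.
apply/colP => i; rewrite mxE [RHS]mxE [X in _ = _ + X]mxE [X in _ = _ + _ * X]mxE chart_vecE.
rewrite expr0 eqxx andbT; case: (eqVneq i i0) => [->|ii].
  by rewrite (negbTE (i0_neq_i1 hn)) mulr0 addr0.
by rewrite mxE (negbTE ii).
Qed.

Lemma chart_sqnorm_conj f x :
  chart_sqnorm (conj_translation f x) = chart_sqnorm (x + f x *: delta_mx i1 ord0).
Proof.
congr sqnorm; rewrite chart_vec_conj; apply/colP => i; rewrite mxE !chart_vecE.
by rewrite !mxE; case: (eqVneq i i0) => [->|//]; rewrite (negbTE (i0_neq_i1 hn)) mulr0 addr0.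
Qed.

Lemma chiE (x : 'cV[R]_n) : 0 < x i0 ord0 ->
  chi x = (x i0 ord0 `^ n%:R^-1 * chart_sqnorm x `^ (- (alpha / 2))) *: vv x.
Proof.
move=> x0; rewrite /chi rhoE sqnormZ -/(chart_sqnorm x) scalerA; congr (_ *: _).
have Sx := chart_sqnorm_gt0 x.
rewrite powRM ?exprn_ge0 ?ltW// mulrAC; congr (_ * _).
rewrite -{1}(@powRr1 _ (x i0 ord0)) ?ltW// sqr_powR// -powRrM -{2}(@powRr1 _ (x i0 ord0)) ?ltW//.
by rewrite -powRD ?(gt_eqF x0) ?implybT// -alphaE; congr (_ `^ _); field.
Qed.

Lemma conj_translation_gt0 f (x : 'cV[R]_n) : 0 < x i0 ord0 -> 0 < conj_translation f x i0 ord0.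
Proof. by move=> x0; rewrite mxE eqxx !mulr_gt0// powR_gt0// chart_sqnorm_gt0. Qed.

(** By [chiE], [chi x] is [y0] times the chart vector of [x]. The factor [stretch] keeps [y0]
    constant, and adding [t] to coordinate 1 of the product amounts to adding [tau t x = t / y0] to
    that of the chart vector. *)
Lemma chi_conj_translation t (x : 'cV[R]_n) : 0 < x i0 ord0 ->
  chi (conj_translation (tau t) x) = chi x + t *: delta_mx i1 ord0.
Proof.
move=> x0; have Sx := chart_sqnorm_gt0 x.
rewrite chiE ?conj_translation_gt0// chiE// chart_sqnorm_conj chart_vec_conj mxE eqxx /stretch.
set y0 := x i0 ord0 `^ n%:R^-1 * chart_sqnorm x `^ (- (alpha / 2)).
set Sv' := chart_sqnorm (x + _); have Sv'0 : 0 < Sv' by exact: chart_sqnorm_gt0.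
have -> : (x i0 ord0 * (Sv' `^ beta * chart_sqnorm x `^ (- beta))) `^ n%:R^-1 * Sv' `^ (- (alpha / 2)) = y0.
  rewrite !powRM ?mulr_ge0 ?powR_ge0 ?ltW// -!powRrM -betaE mulNr -betaE.
  by rewrite /y0 -mulrA; congr (_ * _); rewrite mulrAC powRV// mul1r.
rewrite scalerDr; congr (_ + _); rewrite scalerA; congr (_ *: _).
transitivity ((x i0 ord0 `^ n%:R^-1 * x i0 ord0 `^ (- n%:R^-1)) *
  (chart_sqnorm x `^ (alpha / 2) * chart_sqnorm x `^ (- (alpha / 2))) * t); first by rewrite /tau /y0; ring.
by rewrite !powRV// !mul1r.
Qed.

Lemma diffeo_conj_translation t (x : 'cV[R]_n) : 0 < x i0 ord0 -> diffeo_germ (conj_translation (tau t)) x.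
Proof.
move=> x0.
have E : \forall y \near x,
    (chiinv \o ((fun u => t *: delta_mx i1 ord0 + u) \o chi)) y = conj_translation (tau t) y.
  apply: filterS (near_coord_gt0 x0) => y y0 /=.
  by rewrite addrC -chi_conj_translation// chiK// conj_translation_gt0.
apply: (diffeo_germ_near_eq E); apply: diffeo_germ_comp.
  apply: diffeo_chiinv; rewrite /= mxE [X in 0 < X + _]mxE [X in _ * X]mxE.
  rewrite (negbTE (i0_neq_i1 hn)) mulr0 add0r.
  exact: chi_gt0.
by apply: diffeo_germ_comp; [exact: diffeo_germ_translation|exact: diffeo_chi].
Qed.

End BlowUp.

(** * Limits of the conjugated translations at a point of the exceptional divisor *)

Section LiftJets.
Context {R : realType} {n : nat} (hn : (1 < n)%N).
Local Notation i0 := (i0 hn).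
Local Notation i1 := (i1 hn).
Local Notation alpha := (@alpha R n).
Local Notation beta := (@beta R n).

Lemma pd_powR p q e a (f : 'M[R]_(p, q) -> R) x : 0 < f x -> sm f x ->
  \forall y \near x, pd e (fun z => f z `^ a) y = a * (f y `^ (a - 1) * pd e f y).
Proof.
move=> fx sf; have n0 : \forall y \near x, 0 < f y by exact: (cvgr_gt _ (sm_continuous sf)).
apply: filterS2 n0 (sm_open sf) => y fy sfy.
have [_] := is_derive_scalar_comp (is_derive1_powR a fy) (sm_derivable (e := e) sfy).
by rewrite mulrA.
Qed.

Lemma pd_expS p q e k (f : 'M[R]_(p, q) -> R) x : sm f x ->
  \forall y \near x, pd e (fun z => f z ^+ k.+1) y = k.+1%:R * (f y ^+ k * pd e f y).
Proof.
move=> sf; apply: filterS (sm_open sf) => y sfy.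
have := deriveX k.+1 (sm_derivable (e := e) sfy).
rewrite (_ : f ^+ k.+1 = fun z => f z ^+ k.+1); last by apply/funext => z; rewrite exprfctE.
by rewrite /pd => ->; rewrite /GRing.scale /= mulrA.
Qed.

(** The generalized binomial coefficient [a (a - 1) ... (a - N + 1) / N!]. *)
Fixpoint binom (a : R) (N : nat) : R :=
  if N is N'.+1 then a / N%:R * binom (a - 1) N' else 1.

Lemma binom_neq0 a N : a < 0 -> binom a N != 0.
Proof.
elim: N a => [|N IH] a a0 /=; first exact: oner_neq0.
rewrite mulf_neq0 ?IH//; last by rewrite (lt_trans _ a0)// ltrBlDr ltrDl.
by rewrite mulf_neq0 ?invr_eq0 ?pnatr_eq0// lt_eqF.
Qed.

Context (eps : nat -> R).
Hypothesis eps_gt0 : forall j, 0 < eps j.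
Hypothesis eps_cvg : eps @ \oo --> (0 : R).

Definition base (j : nat) : 'cV[R]_n := eps j *: delta_mx i0 ord0.

Lemma base_i0 j : base j i0 ord0 = eps j.
Proof. by rewrite !mxE eqxx mulr1. Qed.

Lemma base_cvg : base @ \oo --> (0 : 'cV[R]_n).
Proof.
have C : base @ \oo --> 0 *: (delta_mx i0 ord0 : 'cV[R]_n).
  exact: (cvgZ eps_cvg (cvg_cst (delta_mx i0 ord0 : 'cV[R]_n))).
by rewrite scale0r in C.
Qed.

(* The powers blow up at 0, but the scaling factor makes all their derivatives
   of order less than N tend to 0, and the one of order N converge. *)
Lemma power_jet_cvg N (a : R) :
  jet_cvg N (fun j (x : 'cV[R]_n) => eps j `^ (N%:R - a) * x i0 ord0 `^ a) base
    (fun x : 'cV[R]_n => binom a N * x i0 ord0 ^+ N) 0.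
Proof.
have sp b j : sm (fun x : 'cV[R]_n => x i0 ord0 `^ b) (base j).
  by apply: sm_powR; [rewrite base_i0|exact: sm_coord].
have B b (M : nat) : jet_cvg 0 (fun j (x : 'cV[R]_n) => eps j `^ (M%:R - b) * x i0 ord0 `^ b) base
    (fun x : 'cV[R]_n => binom b M * x i0 ord0 ^+ M) 0.
  apply: jet_cvg0.
  - by apply: nearW => j; apply: smM; [exact: sm_cst|exact: sp].
  - by apply: smM; [exact: sm_cst|apply: sm_exp; exact: sm_coord].
  - have -> : (fun j => eps j `^ (M%:R - b) * base j i0 ord0 `^ b) = (fun j => eps j ^+ M).
      apply/funext => j; rewrite base_i0 -powRD ?(gt_eqF (eps_gt0 j)) ?implybT//.
      by rewrite subrK powR_mulrn// ltW.
    rewrite mxE; case: M => [|M] /=.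
      by rewrite expr0 mulr1; under eq_fun do rewrite expr0; exact: cvg_cst.
    rewrite expr0n mulr0; elim: M => [|M IH]; first by under eq_fun do rewrite expr1.
    under eq_fun do rewrite exprS.
    have C : (fun j => eps j * eps j ^+ M.+1) @ \oo --> (0 * 0 : R) by apply: cvgM.
    by rewrite mulr0 in C.
elim: N a => [|N IH] a; first exact: B.
apply: jet_cvg_succ => // e.
have sx x : sm (fun x : 'cV[R]_n => x i0 ord0) x by exact: sm_coord.
pose d : R := (e == (i0, ord0))%:R.
(* Differentiation along the axis 0 replaces [(N + 1, a)] by [(N, a - 1)], which has the same
   scaling exponent; along the other axes, [d = 0] gives zero. *)
apply: (@jet_cvg_eq _ _ _ _ (fun j (x : 'cV[R]_n) =>
  (d * a) * (eps j `^ (N%:R - (a - 1)) * x i0 ord0 `^ (a - 1))) _ _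
  (fun x : 'cV[R]_n => (d * a) * (binom (a - 1) N * x i0 ord0 ^+ N))).
- apply: nearW => j; have x0 : 0 < base j i0 ord0 by rewrite base_i0.
  have P := pdM e (sm_cst (eps j `^ (N.+1%:R - a)) (base j)) (sp a j).
  apply: filterS2 P (pd_powR e a x0 (sx _)) => y -> ->.
  rewrite pd_cst mulr0 addr0 pd_coord -/d.
  rewrite (_ : N.+1%:R - a = N%:R - (a - 1)); last by rewrite -addn1 natrD; ring.
  by ring.
- have P := pdM e (sm_cst (binom a N.+1) (0 : 'cV[R]_n)) (sm_exp N.+1 (sx 0)).
  apply: filterS2 P (pd_expS e N (sx 0)) => y -> ->.
  rewrite pd_cst mulr0 addr0 pd_coord -/d /=.
  have N0 : N.+1%:R != 0 :> R by rewrite pnatr_eq0.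
  by field; rewrite addrC natr1.
- by apply: jet_cvgM; [exact: jet_cvg_cst|exact: IH].
Qed.

Context (m : nat).
Definition leading_coef : R := binom (- n%:R^-1) m.+1.
(** The scaling exponent [N - a] of [power_jet_cvg] for [N = m + 1] and [a = - 1/n], the exponent of
    [x_0] in [tau]. *)
Definition delta (j : nat) : R := eps j `^ (m.+1%:R + n%:R^-1).
Definition flat_monomial (x : 'cV[R]_n) : R := leading_coef * x i0 ord0 ^+ m.+1.

Lemma sm_flat_monomial x : sm flat_monomial x.
Proof. by apply: smM; [exact: sm_cst|apply: sm_exp; exact: sm_coord]. Qed.

Lemma jet_eq_refl M (f : 'cV[R]_n -> R) x : sm f x -> jet_eq M f f x.
Proof. by move=> sf; apply/jet_eqP. Qed.

Lemma jet_eq_flat_monomial : jet_eq m flat_monomial (fun=> 0) 0.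
Proof.
have H k : jet_eq k (fun x : 'cV[R]_n => x i0 ord0 ^+ k.+1) (fun=> 0) 0.
  elim: k => [|k IH].
    apply: jet_cvg0.
    - by apply: nearW => _; apply: sm_exp; exact: sm_coord.
    - exact: sm_cst.
    - by rewrite mxE expr1; exact: cvg_cst.
  have x0 : (0 : 'cV[R]_n) i0 ord0 = 0 by rewrite mxE.
  have := jet_eq_vanishM (sm_coord i0 ord0 0) x0 IH.
  rewrite (_ : (fun z : 'cV[R]_n => z i0 ord0 * 0) = fun=> 0 : R); last first.
    by apply/funext => z; rewrite mulr0.
  suff -> : (fun z : 'cV[R]_n => z i0 ord0 * z i0 ord0 ^+ k.+1) = fun z => z i0 ord0 ^+ k.+2 by [].
  by apply/funext => z; rewrite [RHS]exprS.
have := jet_cvgM (jet_cvg_cst m leading_coef (fun _ : nat => 0 : 'cV[R]_n) 0) (H m).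
by rewrite /= /jet_eq mulr0.
Qed.

(** The power of [chart_sqnorm] in [tau] equals 1 at 0. Its difference with 1 vanishes there and
    multiplies a monomial whose [m]-jet is zero, so it is invisible in the limit at order
    [m + 1]. *)
Lemma tau_jet_cvg : jet_cvg m.+1 (fun j => tau hn (delta j)) base flat_monomial 0.
Proof.
have sS : sm (fun x => chart_sqnorm hn x `^ (alpha / 2)) 0.
  by apply: sm_powR; [exact: chart_sqnorm_gt0|exact: sm_chart_sqnorm].
have C := jet_cvgM (power_jet_cvg m.+1 (- n%:R^-1)) (jet_cvg_sm m.+1 sS base_cvg).
apply: jet_cvg_trans (_ : jet_eq m.+1
  (fun z => flat_monomial z * chart_sqnorm hn z `^ (alpha / 2)) flat_monomial 0).
  rewrite (_ : (fun j => _) = (fun j (z : 'cV[R]_n) => eps j `^ (m.+1%:R - - n%:R^-1) *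
      z i0 ord0 `^ (- n%:R^-1) * chart_sqnorm hn z `^ (alpha / 2)))//.
  by rewrite opprK.
pose l z : R := chart_sqnorm hn z `^ (alpha / 2) - 1.
have sl : sm l 0 by apply: smD => //; exact: sm_cst.
have l0 : l 0 = 0 by rewrite /l chart_sqnorm_0 powR1 subrr.
have := jet_cvgD (jet_eq_refl m.+1 (sm_flat_monomial 0)) (jet_eq_vanishM sl l0 jet_eq_flat_monomial).
rewrite (_ : (fun=> fun z => flat_monomial z + l z * flat_monomial z) =
   fun=> fun z => flat_monomial z * chart_sqnorm hn z `^ (alpha / 2)); last first.
  by apply/funext => _; apply/funext => z; rewrite /l; ring.
rewrite (_ : (fun z => flat_monomial z + l z * 0) = flat_monomial); first exact.
by apply/funext => z; rewrite mulr0 addr0.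
Qed.

Lemma stretch_jet_cvg M f g x (y : 'cV[R]_n) : x @ \oo --> y -> jet_cvg M f x g y ->
  jet_cvg M (fun j => stretch hn (f j)) x (stretch hn g) y.
Proof.
move=> xy fg; rewrite /stretch; apply: jet_cvgM; last first.
  by apply: jet_cvg_sm xy; apply: sm_powR; [exact: chart_sqnorm_gt0|exact: sm_chart_sqnorm].
pose F z : R := chart_sqnorm hn z `^ beta.
have sF z : sm F z by apply: sm_powR; [exact: chart_sqnorm_gt0|exact: sm_chart_sqnorm].
have C i k : jet_cvg M (fun j z => (z + f j z *: delta_mx i1 ord0) i k) x
    (fun z => (z + g z *: delta_mx i1 ord0) i k) y.
  rewrite (_ : (fun j z => _) = fun j (z : 'cV[R]_n) => z i k + f j z * (delta_mx i1 ord0 : 'cV[R]_n) i k);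
    last by apply/funext => j; apply/funext => z; rewrite !mxE.
  rewrite [X in jet_cvg _ _ _ X](_ : _ = fun z : 'cV[R]_n => z i k + g z * (delta_mx i1 ord0 : 'cV[R]_n) i k);
    last by apply/funext => z; rewrite !mxE.
  apply: jet_cvgD; first by apply: jet_cvg_sm xy; exact: sm_coord.
  by apply: jet_cvgM => //; exact: jet_cvg_cst.
apply: (@jet_cvg_comp _ _ _ _ _ _ (fun=> F) F) => //.
exact: (jet_cvg_sm_comp (sF _) C).
Qed.

(** Order [m] is enough, as [stretch] enters [conj_translation] multiplied by [x_0], which vanishes
    at 0 and supplies the missing order. *)
Lemma jet_eq_stretch : jet_eq m (stretch hn flat_monomial) (fun=> 1) 0.
Proof.
have := stretch_jet_cvg (cvg_cst (0 : 'cV[R]_n)) jet_eq_flat_monomial.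
rewrite (_ : stretch hn (fun=> 0) = fun=> 1); first exact.
by apply/funext => z; rewrite /stretch scale0r addr0 powRV// chart_sqnorm_gt0.
Qed.

Definition perturb (x : 'cV[R]_n) : 'cV[R]_n := x + flat_monomial x *: delta_mx i1 ord0.

Lemma perturbE x i : perturb x i ord0 = x i ord0 + flat_monomial x * (i == i1)%:R.
Proof. by rewrite mxE [X in _ + X]mxE [X in _ * X]mxE eqxx andbT. Qed.

Lemma conj_translation_jet_cvg i :
  jet_cvg m.+1 (fun j z => conj_translation hn (tau hn (delta j)) z i ord0) base
    (fun z => perturb z i ord0) 0.
Proof.
rewrite (_ : (fun z => perturb z i ord0) =
  fun z : 'cV[R]_n => z i ord0 + flat_monomial z * (i == i1)%:R); last first.
  by apply/funext => z; rewrite perturbE.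
have sx k (x : 'cV[R]_n) : sm (fun x : 'cV[R]_n => x k ord0) x by exact: sm_coord.
have [->|ii] := eqVneq i i0.
  rewrite (_ : (fun j z => _) =
    fun j (z : 'cV[R]_n) => z i0 ord0 * stretch hn (tau hn (delta j)) z); last first.
    by apply/funext => j; apply/funext => z; rewrite mxE eqxx.
  apply: jet_cvg_trans (jet_cvgM (jet_cvg_sm m.+1 (sx i0 0) base_cvg)
     (stretch_jet_cvg base_cvg tau_jet_cvg)) _.
  have x0 : (0 : 'cV[R]_n) i0 ord0 = 0 by rewrite mxE.
  have := jet_eq_vanishM (sx i0 0) x0 jet_eq_stretch.
  congr jet_eq; apply/funext => z.
  by rewrite (negbTE (i0_neq_i1 hn)) mulr0 addr0 mulr1.
rewrite (_ : (fun j z => _) =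
  fun j (z : 'cV[R]_n) => z i ord0 + tau hn (delta j) z * (i == i1)%:R); last first.
  by apply/funext => j; apply/funext => z; rewrite mxE (negbTE ii).
apply: jet_cvgD; first exact: jet_cvg_sm base_cvg.
by apply: jet_cvgM; [exact: tau_jet_cvg|exact: jet_cvg_cst].
Qed.

Lemma sm_perturb i x : sm (fun y => perturb y i ord0) x.
Proof.
under eq_fun do rewrite perturbE.
apply: smD; first exact: sm_coord.
by apply: smM; [exact: sm_flat_monomial|exact: sm_cst].
Qed.

Lemma diffeo_perturb x : diffeo_germ perturb x.
Proof.
have monoE (y : 'cV[R]_n) t : flat_monomial (y + t *: delta_mx i1 ord0) = flat_monomial y.
  by rewrite /flat_monomial !mxE (negbTE (i0_neq_i1 hn)) mulr0 addr0.
exists (fun y => y + (- flat_monomial y) *: delta_mx i1 ord0); split.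
- by apply/smooth_atP => i; exact: sm_perturb.
- apply/smooth_atP => i.
  rewrite (_ : (fun y => _) = fun y : 'cV[R]_n => y i ord0 + flat_monomial y * (- (i == i1)%:R)).
    apply: smD; first exact: sm_coord.
    by apply: smM; [exact: sm_flat_monomial|exact: sm_cst].
  apply/funext => y; rewrite mxE [X in _ + X]mxE [X in _ * X]mxE eqxx andbT.
  by rewrite mulrN mulNr.
- apply: (filterS _ filterT) => y _; rewrite /perturb monoE scaleNr addrK//.
- apply: (filterS _ filterT) => y _; rewrite /perturb monoE scaleNr subrK//.
Qed.

Lemma perturb_0 : perturb 0 = 0.
Proof. by rewrite /perturb /flat_monomial mxE expr0n mulr0 scale0r addr0. Qed.

Lemma jet_eq_perturb i : jet_eq m (fun y => perturb y i ord0) (fun y => y i ord0) 0.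
Proof.
have := jet_cvgD (jet_eq_refl m (sm_coord i ord0 (0 : 'cV[R]_n)))
  (jet_cvgM jet_eq_flat_monomial (jet_cvg_cst m (i == i1)%:R (fun _ : nat => 0 : 'cV[R]_n) 0)).
rewrite (_ : (fun=> fun z : 'cV[R]_n => z i ord0 + flat_monomial z * (i == i1)%:R) =
  fun=> fun y => perturb y i ord0).
  rewrite (_ : (fun z : 'cV[R]_n => z i ord0 + 0 * (i == i1)%:R) = fun z => z i ord0); first exact.
  by apply/funext => z; rewrite mul0r addr0.
by apply/funext => _; apply/funext => z; rewrite perturbE.
Qed.

End LiftJets.

(** * The exceptional divisor *)

Section Chart.
Context {R : realType} {n : nat} (hn : (1 < n)%N).
Local Notation i0 := (i0 hn).
Local Notation i1 := (i1 hn).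
Context (l_minus : 'cV[R]_n -> torus R n) (B : 'M[int]_n).
Hypothesis detB : \det B = 1.
Local Notation BR := (map_mx intr B : 'M[R]_n).
Hypothesis l_minusE : forall v, l_minus v = to_torus (half_vec R n 1 + BR *m v).
Local Notation vv := (chart_vec i0 false).

Lemma mul_B_int (y : 'cV[R]_n) :
  (forall i, (BR *m y) i ord0 \is a Num.int) -> forall i, y i ord0 \is a Num.int.
Proof.
move=> By i; have uB : B \in unitmx by rewrite unitmxE detB unitr1.
have -> : y = map_mx intr (invmx B) *m (BR *m y).
  by rewrite mulmxA -map_mxM mulVmx// map_mx1 mul1mx.
rewrite mxE; apply: rpred_sum => j _.
by rewrite mxE rpredM// intr_int.
Qed.

Lemma int_small_eq0 (x : R) : x \is a Num.int -> `|x| < 1 -> x = 0.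
Proof.
move=> /intrP[k ->]; rewrite -intr_norm -[1]/(1%:~R) ltr_int ltz_nat.
by case: k => [[|]|].
Qed.

Lemma coord_lt (y : 'cV[R]_n) e i : 0 < e -> sqnorm y < e ^+ 2 -> `|y i ord0| < e.
Proof.
move=> e0 ye; rewrite -(@ltr_pXn2r _ 2)// ?nnegrE ?ltW//.
rewrite real_normK ?num_real//; apply: le_lt_trans ye.
by rewrite /sqnorm (bigD1 i)//= lerDl sumr_ge0// => j _; exact: sqr_ge0.
Qed.

(** The squared norm of [rho u] is the [n]-th root of that of [u]; the radius [10 ^- n] of [V] thus
    becomes 1/10 in the torus. *)
Lemma sqnorm_rho_lt (u : 'cV[R]_n) e : 0 < e -> sqnorm u < e ^+ n -> sqnorm (rho u) < e.
Proof.
move=> e0 ue; have [u0|u0] := ltrP 0 (sqnorm u); last first.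
  have s0 : sqnorm u = 0 by apply/eqP; rewrite eq_le u0 sqnorm_ge0.
  by rewrite rhoE sqnormZ s0 mulr0.
rewrite rhoE sqnormZ sqr_powR// -{2}(@powRr1 _ (sqnorm u)) ?sqnorm_ge0//.
rewrite -powRD ?(gt_eqF u0) ?implybT//.
rewrite (_ : 2 * _ + 1 = n%:R^-1); last by rewrite -(alphaE hn); field.
have n0 := n_gt0 (R := R) hn.
have -> : e = (e ^+ n) `^ n%:R^-1.
  by rewrite -powR_mulrn ?ltW// -powRrM divff ?powRr1 ?ltW ?gt_eqF.
by apply: gt0_ltr_powR => //; rewrite ?invr_gt0// nnegrE ?ltW// exprn_gt0.
Qed.

Definition exc_chart : M'idx R n := inr (i0, false).
Definition par_exc (x : 'cV[R]_n) : M' l_minus := @par _ _ (M' l_minus) exc_chart x.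

Lemma dom_sqnorm (x : 'cV[R]_n) : M'dom exc_chart x -> sqnorm (blow_down hn x) < (10^-1 ^+ 2) ^+ n.
Proof.
rewrite /= -/(blow_down hn x) enormE => H.
have -> : sqnorm (blow_down hn x) = (sqnorm (blow_down hn x) `^ 2^-1) ^+ 2.
  by rewrite -powR_mulrn ?powR_ge0// -powRrM mulVf// powRr1// sqnorm_ge0.
by rewrite exprAC ltr_pXn2r// ?nnegrE ?powR_ge0// exprVn.
Qed.

Lemma dom_rho (x : 'cV[R]_n) i : M'dom exc_chart x -> `|rho (blow_down hn x) i ord0| < 10^-1.
Proof. by move=> /dom_sqnorm xd; apply: coord_lt => //; apply: sqnorm_rho_lt. Qed.

Lemma near_dom : \forall x \near (0 : 'cV[R]_n), M'dom exc_chart x.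
Proof.
have c : {for (0 : 'cV[R]_n), continuous (fun x => sqnorm (blow_down hn x))}.
  apply: sm_continuous; apply: (@sm_comp _ _ _ _ _ (@sqnorm R n)); first exact: sm_sqnorm.
  by move=> i j; exact/smooth_at_sm/smooth_blow_down.
have b0 : sqnorm (blow_down hn (0 : 'cV[R]_n)) < (10^-1 ^+ n) ^+ 2.
  by rewrite /blow_down mxE scale0r /sqnorm big1 ?exprn_gt0// => i _; rewrite mxE expr0n.
apply: filterS (cvgr_lt _ c _ b0) => x xs.
rewrite /= -/(blow_down hn x) enormE -exprVn -(@ltr_pXn2r _ 2)// ?nnegrE ?powR_ge0// ?exprn_ge0//.
by rewrite -powR_mulrn ?powR_ge0// -powRrM mulVf// powRr1// sqnorm_ge0.
Qed.

(** The inner product is [x_0] times the norm of the chart vector, so [V_map] separates the two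
    sides of [E] by the sign of [x_0]. *)
Lemma V_map_sign (x : 'cV[R]_n) :
  (0 < ((val (ray_of (chart_vec_neq0 i0 false x)))^T *m blow_down hn x) ord0 ord0)
  = (0 < x i0 ord0).
Proof.
rewrite /= mxE (eq_bigr (fun j => ((enorm (vv x))^-1 * x i0 ord0) * vv x j ord0 ^+ 2)); last first.
  by move=> j _; rewrite mxE [X in X * _]mxE [X in _ * X]mxE expr2; ring.
rewrite -mulr_sumr -/(sqnorm (vv x)) -/(chart_sqnorm hn x) pmulr_lgt0 ?chart_sqnorm_gt0//.
by rewrite pmulr_rgt0// invr_gt0 enorm_gt0// chart_vec_neq0.
Qed.

Lemma blow_down_eq0 (x : 'cV[R]_n) : (blow_down hn x == 0) = (x i0 ord0 == 0).
Proof. by rewrite scaler_eq0 (negbTE (chart_vec_neq0 _ _ _)) orbF. Qed.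

Lemma par_exc0 (x : 'cV[R]_n) : x i0 ord0 = 0 -> par_exc x = inr (ray_of (chart_vec_neq0 i0 false x)).
Proof. by move=> x0; rewrite /par_exc /= -/(blow_down hn x) blow_down_eq0 x0 eqxx. Qed.

Definition torus_coord (x : 'cV[R]_n) : 'cV[R]_n :=
  if 0 < x i0 ord0 then half_vec R n 0 + rho (blow_down hn x)
  else half_vec R n 1 + BR *m rho (blow_down hn x).

Lemma rho_neq0 (x : 'cV[R]_n) : x i0 ord0 != 0 -> rho (blow_down hn x) != 0.
Proof.
move=> x0; have u0 : 0 < sqnorm (blow_down hn x) by apply: (@sqnorm_gt0 _ _ _ i0); rewrite blow_downE eqxx.
by rewrite rhoE scaler_eq0 blow_down_eq0 negb_or x0 andbT gt_eqF// powR_gt0.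
Qed.

Lemma torus_coord_strip (x : 'cV[R]_n) : 0 < x i0 ord0 -> M'dom exc_chart x ->
  strip hn (half_vec R n 0 + chi hn x).
Proof.
move=> x0 xd; have := dom_rho i0 xd; have := chi_gt0 x0.
rewrite -/(chi hn x) => c0; rewrite gtr0_norm// => c1.
rewrite /strip /= mxE [X in X + _]mxE /=; apply/andP; split; lra.
Qed.

(** This makes [insub] succeed in [V_map] away from [E]. *)
Lemma torus_coord_punctured (x : 'cV[R]_n) : x i0 ord0 != 0 -> M'dom exc_chart x ->
  (to_torus (torus_coord x) != p_plus R n) && (to_torus (torus_coord x) != p_minus R n).
Proof.
move=> x0 xd; rewrite /torus_coord; case: ifPn => x_pos.
  by apply/andP; exact: strip_punctured (torus_coord_strip x_pos xd).
set y := rho _; have y0 : y != 0 by exact: rho_neq0.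
(* On the negative side, reaching either puncture would make [BR *m (2 *: y)] integral, as doubling
   clears the halves. Then [2 *: y] is integral because [B] is unimodular, and it vanishes because
   its entries are below 1/5. *)
have key : ~ forall i, (BR *m (2 *: y)) i ord0 \is a Num.int.
  move=> /mul_B_int yi; move/eqP: y0; apply; apply/colP => i; rewrite [RHS]mxE.
  have := yi i; rewrite mxE => /int_small_eq0; rewrite normrM ger0_norm// => H.
  have /eqP : 2 * y i ord0 = 0 by apply: H; have := dom_rho i xd; rewrite -/y; lra.
  by rewrite mulf_eq0 pnatr_eq0 /= => /eqP.
have i2 (z : R) : z \is a Num.int -> 2 * z \is a Num.int.
  by move=> zi; apply: rpredM => //; exact: (intr_int _ 2).
have E i : (half_vec R n 1 + BR *m y) i ord0 = half_vec R n 1 i ord0 + (BR *m y) i ord0.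
  by rewrite mxE.
have h_int k i : 2 * half_vec R n k i ord0 \is a Num.int.
  by rewrite mxE; case: ifP => _; rewrite ?mulr0 ?rpred0// divff ?rpred1.
apply/andP; split; apply/eqP => /to_torus_eq H; apply: key => i;
  rewrite -scalemxAr mxE; move: (H i); rewrite E => /i2; set z := (BR *m y) i ord0 => zi.
  rewrite (_ : 2 * z = 2 * (half_vec R n 1 i ord0 + z - half_vec R n 0 i ord0) -
    2 * half_vec R n 1 i ord0 + 2 * half_vec R n 0 i ord0); last by ring.
  by rewrite rpredD// rpredB.
by move: zi; rewrite addrAC subrr add0r.
Qed.

Lemma par_exc_neq0 (x : 'cV[R]_n) : x i0 ord0 != 0 -> M'dom exc_chart x ->
  exists2 w : punctured_torus R n, par_exc x = inl w & val w = to_torus (torus_coord x).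
Proof.
move=> x0 xd; have tp := torus_coord_punctured x0 xd.
exists (exist (fun t : torus R n => (t != p_plus R n) && (t != p_minus R n)) _ tp) => //.
rewrite /par_exc /= -/(blow_down hn x) blow_down_eq0 (negbTE x0) V_map_sign.
have -> : (if 0 < x i0 ord0 then l_plus (rho (blow_down hn x)) else l_minus (rho (blow_down hn x)))
    = to_torus (torus_coord x).
  by rewrite /torus_coord l_minusE /l_plus; case: ifP.
by case: insubP => [w _ wE|]; [congr inl; exact: val_inj|rewrite tp].
Qed.

Lemma par_exc_pos w (x : 'cV[R]_n) : 0 < x i0 ord0 -> M'dom exc_chart x ->
  par_exc x = parU w (half_vec R n 0 + chi hn x).
Proof.
move=> x0 xd; have xn0 : x i0 ord0 != 0 by rewrite gt_eqF.
have [w' -> wE] := par_exc_neq0 xn0 xd; congr inl; apply: val_inj; rewrite wE /torus_coord x0.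
apply/esym/insubdK/andP.
exact: (strip_punctured (torus_coord_strip x0 xd)).
Qed.

End Chart.

(** * Injectivity of the exceptional chart near its origin *)

Section ChartInjectivity.
Context {R : realType} {n : nat} (hn : (1 < n)%N).
Local Notation i0 := (i0 hn).
Local Notation i1 := (i1 hn).
Context (l_minus : 'cV[R]_n -> torus R n) (B : 'M[int]_n).
Hypothesis detB : \det B = 1.
Local Notation BR := (map_mx intr B : 'M[R]_n).
Hypothesis l_minusE : forall v, l_minus v = to_torus (half_vec R n 1 + BR *m v).
Local Notation vv := (chart_vec i0 false).
Local Notation exc_chart := (exc_chart hn).
Local Notation par_exc := (par_exc hn l_minus).

Definition exc_point : M' l_minus := par_exc 0.

Lemma ray_of_inj (u v : 'cV[R]_n) (u0 : u != 0) (v0 : v != 0) :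
  ray_of u0 = ray_of v0 -> exists2 a, 0 < a & u = a *: v.
Proof.
move=> /(congr1 val) /= E; exists (enorm u / enorm v).
  by rewrite divr_gt0// enorm_gt0.
rewrite -scalerA -E scalerA divff ?scale1r//.
by rewrite gt_eqF// enorm_gt0.
Qed.

Lemma par_exc_inr (x : 'cV[R]_n) s : M'dom exc_chart x -> par_exc x = inr s ->
  x i0 ord0 = 0 /\ s = ray_of (chart_vec_neq0 i0 false x).
Proof.
move=> xd; have [x0|x0] := eqVneq (x i0 ord0) 0; last first.
  by have [w -> _] := par_exc_neq0 detB l_minusE x0 xd.
by rewrite par_exc0// => -[].
Qed.

Lemma V_map_inr (l : rays R n * 'cV[R]_n) s : V_map l_minus l = inr s -> s = l.1.
Proof. by case: l => a u /=; case: ifP => [_ []//|_]; case: insub => // -[]. Qed.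

(* This point is the class of the first basis vector, which lies in only one of
   the standard charts of the blow-up. *)
Lemma par_exc_point (i : pidx (M' l_minus)) (x : 'cV[R]_n) : pdom i x -> par i x = exc_point ->
  i = exc_chart /\ x = 0.
Proof.
rewrite /exc_point par_exc0 ?mxE//; case: i => [w|[j b]] // xd E.
have := V_map_inr E => /= /esym/ray_of_inj[a a0 xE].
have xiE i : chart_vec j b x i ord0 = a * (if i == i0 then 1 else 0).
  by rewrite xE mxE mxE expr0 mxE.
have ji : j = i0.
  have := xiE j; rewrite mxE eqxx; case: eqVneq => // _.
  by rewrite mulr0 => /eqP; rewrite signr_eq0.
subst j; have bf : b = false.
  have := xiE i0; rewrite mxE eqxx mulr1; case: (b) => //= aE.
  by move: a0; rewrite -aE expr1 ltr0N1.
subst b; split=> //; have [x0 _] := par_exc_inr xd E.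
apply/colP => i; rewrite [RHS]mxE; have [->//|ii] := eqVneq i i0.
by have := xiE i; rewrite mxE (negbTE ii) mulr0.
Qed.

Lemma blow_down_inj (x y : 'cV[R]_n) : x i0 ord0 != 0 -> blow_down hn x = blow_down hn y -> x = y.
Proof.
move=> x0 E; have E' i : blow_down hn x i ord0 = blow_down hn y i ord0 by rewrite E.
have e0 := E' i0; rewrite !blow_downE eqxx in e0.
apply/colP => i; have [->//|ii] := eqVneq i i0.
by have := E' i; rewrite !blow_downE (negbTE ii) -e0 => /(mulfI x0).
Qed.

Lemma rho_blow_down_inj (x y : 'cV[R]_n) : x i0 ord0 != 0 -> y i0 ord0 != 0 ->
  rho (blow_down hn x) = rho (blow_down hn y) -> x = y.
Proof.
move=> x0 y0 E; apply: blow_down_inj => //.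
have p (z : 'cV[R]_n) : z i0 ord0 != 0 -> 0 < sqnorm (blow_down hn z).
  by move=> z0; apply: (@sqnorm_gt0 _ _ _ i0); rewrite blow_downE eqxx.
by rewrite -(rhoK hn (p _ x0)) E rhoK// p.
Qed.

(** As [B] may be large, the domain of the chart alone does not keep the two sides of [E] apart in
    the torus. The bound 1/4 places the negative side within 1/4 of 0 in coordinate 0, modulo
    integers, while the positive side lies between 1/2 and 3/5. *)
Definition good : set 'cV[R]_n := [set x | M'dom exc_chart x /\
    `|(BR *m rho (blow_down hn x)) i0 ord0| < 4^-1].

Lemma near_good : \forall x \near (0 : 'cV[R]_n), good x.
Proof.
(* The entries of row [i0] of [B] bound the coordinate by [C - 1] times the largest entry of the
   vector; the added 1 makes [C] positive and the final inequality strict. *)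
pose C : R := \sum_j `|BR i0 j| + 1.
have C0 : 0 < C by rewrite ltr_wpDl// sumr_ge0.
pose e : R := 4^-1 / C; have e0 : 0 < e by rewrite divr_gt0.
have c : {for (0 : 'cV[R]_n), continuous (fun x => sqnorm (blow_down hn x))}.
  apply: sm_continuous; apply: (@sm_comp _ _ _ _ _ (@sqnorm R n)); first exact: sm_sqnorm.
  by move=> i j; exact/smooth_at_sm/smooth_blow_down.
have b0 : sqnorm (blow_down hn (0 : 'cV[R]_n)) < (e ^+ 2) ^+ n.
  by rewrite /blow_down mxE scale0r /sqnorm big1 ?exprn_gt0// => i _; rewrite mxE expr0n.
apply: filterS2 (near_dom hn) (cvgr_lt _ c _ b0) => x xd xs; split=> //.
have ye i : `|rho (blow_down hn x) i ord0| < e.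
  by apply: coord_lt => //; apply: sqnorm_rho_lt => //; exact: exprn_gt0.
rewrite mxE; apply: le_lt_trans (ler_norm_sum _ _ _) _.
apply: (@le_lt_trans _ _ ((C - 1) * e)).
  rewrite /C addrK mulr_suml; apply: ler_sum => j _.
  by rewrite normrM ler_wpM2l// ltW.
by rewrite mulrBl mul1r {1}/e mulrCA divff ?mulr1 ?gt_eqF// ltrBlDr ltrDl.
Qed.

Lemma good_inj x y : good x -> good y -> par_exc x = par_exc y -> x = y.
Proof.
move=> [xd xB] [yd yB] E.
have [x0|x0] := eqVneq (x i0 ord0) 0.
  move: E; rewrite (par_exc0 _ x0) => /esym Ey.
  have [y0 /ray_of_inj[a a0 vE]] := par_exc_inr yd Ey.
  have a1 : a = 1.
    by have := congr1 (fun v : 'cV[R]_n => v i0 ord0) vE; rewrite [RHS]mxE !chart_vecE eqxx mulr1.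
  apply/colP => i; have [->|ii] := eqVneq i i0; first by rewrite x0 y0.
  have := congr1 (fun v : 'cV[R]_n => v i ord0) vE.
  by rewrite a1 scale1r !chart_vecE (negbTE ii).
have [y0|y0] := eqVneq (y i0 ord0) 0.
  by move: E; rewrite (par_exc0 _ y0) => Ex; have [x00] := par_exc_inr xd Ex; rewrite x00 eqxx in x0.
have [w wE wv] := par_exc_neq0 detB l_minusE x0 xd.
have [w' wE' wv'] := par_exc_neq0 detB l_minusE y0 yd.
have {}E : to_torus (torus_coord hn B x) = to_torus (torus_coord hn B y).
  by rewrite -wv -wv'; move: E; rewrite wE wE' => -[->].
apply: rho_blow_down_inj => //.
(* On a common side, the two vectors differ by an integral one, up to [B]; entries below 1 in
   absolute value force it to vanish. *)
have small i : `|rho (blow_down hn x) i ord0 - rho (blow_down hn y) i ord0| < 1.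
  have := dom_rho i xd; have := dom_rho i yd.
  have := ler_normB (rho (blow_down hn x) i ord0) (rho (blow_down hn y) i ord0).
  lra.
(* Points on opposite sides have coordinates 0 whose difference is strictly between 0 and 1. *)
have mix (u v : 'cV[R]_n) : good u -> 0 < u i0 ord0 ->
    `|(BR *m rho (blow_down hn v)) i0 ord0| < 4^-1 ->
    half_vec R n 0 i0 ord0 + rho (blow_down hn u) i0 ord0 -
    (half_vec R n 1 i0 ord0 + (BR *m rho (blow_down hn v)) i0 ord0) \isn't a Num.int.
  move=> [ud _] u0; have := dom_rho i0 ud; have := chi_gt0 u0; rewrite -/(chi hn u) => c0.
  rewrite gtr0_norm// => c1; set t := (BR *m _) i0 ord0; rewrite ltr_norml => /andP[t1 t2].
  have -> : half_vec R n 0 i0 ord0 = 2^-1 by rewrite mxE.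
  have -> : half_vec R n 1 i0 ord0 = 0 by rewrite mxE.
  rewrite /chi in c0 c1 *; move: c0 c1; set c := rho _ _ _ => c0 c1.
  by apply: (@not_int_between _ _ 0); rewrite add0r; apply/andP; split; lra.
move/to_torus_eq: E; rewrite /torus_coord; case: ifPn => xp; case: ifPn => yp E.
- apply/colP => i; apply/eqP; rewrite -subr_eq0; apply/eqP/int_small_eq0 => //.
  by have := E i; rewrite mxE [X in _ - X]mxE opprD addrACA subrr add0r.
- have := E i0; rewrite mxE [X in _ - X]mxE => H.
  by have := mix x y (conj xd xB) xp yB; rewrite H.
- have := E i0; rewrite mxE [X in _ - X]mxE => H.
  by have := mix y x (conj yd yB) yp xB; rewrite -rpredN opprB H.
- apply/colP => i; apply/eqP; rewrite -subr_eq0; apply/eqP/int_small_eq0 => //.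
  have := @mul_B_int _ _ _ detB (rho (blow_down hn x) - rho (blow_down hn y)).
  have subE (a b : 'cV[R]_n) j : (a - b) j ord0 = a j ord0 - b j ord0 by rewrite !mxE.
  move=> /(_ _ i); rewrite subE; apply=> {}i.
  have := E i; rewrite mxE [X in _ - X]mxE opprD addrACA subrr add0r.
  by rewrite mulmxBr subE.
Qed.

End ChartInjectivity.

(** * The structure read in the exceptional chart *)

Section ChartInvariance.
Context {R : realType} {n : nat} (hn : (1 < n)%N).
Local Notation i0 := (i0 hn).
Local Notation i1 := (i1 hn).
Context (l_minus : 'cV[R]_n -> torus R n) (B : 'M[int]_n).
Hypothesis detB : \det B = 1.
Local Notation BR := (map_mx intr B : 'M[R]_n).
Hypothesis l_minusE : forall v, l_minus v = to_torus (half_vec R n 1 + BR *m v).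
Local Notation exc_chart := (exc_chart hn).
Local Notation par_exc := (par_exc hn l_minus).
Context {k : nat} {Z : variety R} {act : Z -> 'M[R]_(n, njet n k) -> Z}
  {phi : ('cV[R]_n -> M' l_minus) -> Z}.
Hypothesis actA : algebraic_action act.
Hypothesis phiA : A_structure act phi.
Hypothesis phiI : forall g : 'M[int]_n, Gamma2 g -> is_isometry phi (M'act g).
Context (w : punctured_torus R n).

Lemma open_dom (x : 'cV[R]_n) : M'dom exc_chart x -> \forall y \near x, M'dom exc_chart y.
Proof.
have domE (y : 'cV[R]_n) : M'dom exc_chart y <-> sqnorm (blow_down hn y) < (10 ^- n) ^+ 2.
  rewrite /= -/(blow_down hn y) enormE -(@ltr_pXn2r _ 2)// ?nnegrE ?powR_ge0// ?invr_ge0 ?exprn_ge0//.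
  by rewrite -powR_mulrn ?powR_ge0// -powRrM mulVf// powRr1// sqnorm_ge0.
have c : {for x, continuous (fun x => sqnorm (blow_down hn x))}.
  apply: sm_continuous; apply: (@sm_comp _ _ _ _ _ (@sqnorm R n)); first exact: sm_sqnorm.
  by move=> i j; exact/smooth_at_sm/smooth_blow_down.
by move=> /domE xs; apply: filterS (cvgr_lt _ c _ xs) => y ys; apply/domE.
Qed.

(** Where [x_0 > 0], a frame in the exceptional chart is also a frame in the flat chart, read
    through [chi]; equivariance splits its value into [sigma] at the base point and a recentred
    jet. *)
Lemma phi_chart (g : 'cV[R]_n -> 'cV[R]_n) x : diffeo_germ g x -> M'dom exc_chart (g x) -> 0 < g x i0 ord0 ->
  phi (par_exc \o (fun t => g (x + t))) =
  act (sigma (phi := phi) w (half_vec R n 0 + chi hn (g x)))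
    (jet k (fun t => - chi hn (g x) + chi hn (g (x + t))) 0).
Proof.
move=> dg gd gx; set h := half_vec R n 0.
have cg := diffeo_germ_continuous dg.
have de : diffeo_germ (fun t => h + chi hn (g t)) x.
  apply: (@diffeo_germ_comp _ _ (fun t => h + t) (fun t => chi hn (g t))).
    exact: diffeo_germ_translation.
  by apply: (@diffeo_germ_comp _ _ (chi hn) g) => //; exact: diffeo_chi.
have := phi_equivariant phiA (i := inl w) de (strip_dom w (torus_coord_strip gx gd)).
rewrite (_ : (fun t => - (h + chi hn (g x)) + (h + chi hn (g (x + t)))) =
   fun t => - chi hn (g x) + chi hn (g (x + t))); last first.
  by apply/funext => t; rewrite opprD addrACA addNr add0r.
move=> <-; apply: (phi_near_eq phiA).
  apply: (@frame_par _ _ (M' l_minus) exc_chart (fun t => g (x + t))); first exact: diffeo_germ_shift.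
  by rewrite addr0.
have n1 : \forall y \near x, M'dom exc_chart (g y) := cg _ (open_dom gd).
have n2 : \forall y \near x, 0 < g y i0 ord0 := cg _ (near_coord_gt0 gx).
apply: filterS2 (near_translation n1) (near_translation n2) => t d1 d2 /=.
exact: (par_exc_pos detB l_minusE).
Qed.

(** The conjugated translation adds a constant vector to [chi \o g]: [sigma] is unchanged by
    [sigma_invariant], and recentring removes the constant from the jet. *)
Lemma phi_chart_invariant (g : 'cV[R]_n -> 'cV[R]_n) s x :
  diffeo_germ g x -> M'dom exc_chart (g x) -> 0 < g x i0 ord0 ->
  M'dom exc_chart (conj_translation hn (tau hn s) (g x)) ->
  phi (par_exc \o (fun t => conj_translation hn (tau hn s) (g (x + t)))) =
  phi (par_exc \o (fun t => g (x + t))).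
Proof.
move=> dg gd gx gd'.
have cg := diffeo_germ_continuous dg.
have dl : diffeo_germ (conj_translation hn (tau hn s) \o g) x.
  by apply: diffeo_germ_comp dg; exact: diffeo_conj_translation.
have A1 := phi_chart dl gd' (conj_translation_gt0 _ gx).
have A2 := phi_chart dg gd gx.
apply: (etrans A1 (etrans _ (esym A2))); congr act.
  rewrite -(sigma_invariant actA phiA phiI w s (torus_coord_strip gx gd)).
  by congr sigma; rewrite -addrA; congr (_ + _); exact: chi_conj_translation.
apply: jet_near_eq.
have n2 : \forall y \near x, 0 < g y i0 ord0 := cg _ (near_coord_gt0 gx).
apply: filterS (near_translation n2) => t d2.
have E1 := chi_conj_translation s gx; have E2 := chi_conj_translation s d2.
transitivity (- (chi hn (g x) + s *: delta_mx i1 ord0) + (chi hn (g (x + t)) + s *: delta_mx i1 ord0)).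
  by congr (- _ + _).
by rewrite opprD addrACA addNr addr0.
Qed.

End ChartInvariance.

(** * Failure of rigidity at a point of the exceptional divisor *)

Section NonRigidity.
Context {R : realType} {n : nat} (hn : (1 < n)%N).
Local Notation i0 := (i0 hn).
Local Notation i1 := (i1 hn).
Context (l_minus : 'cV[R]_n -> torus R n) (B : 'M[int]_n).
Hypothesis detB : \det B = 1.
Local Notation BR := (map_mx intr B : 'M[R]_n).
Hypothesis l_minusE : forall v, l_minus v = to_torus (half_vec R n 1 + BR *m v).
Local Notation exc_chart := (exc_chart hn).
Local Notation par_exc := (par_exc hn l_minus).
Local Notation exc_point := (exc_point hn l_minus).
Local Notation good := (good hn B).

Local Notation eps := (fun j : nat => j.+1%:R^-1 : R).
Lemma eps_gt0 j : 0 < eps j. Proof. by rewrite invr_gt0. Qed.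

Context (m : nat).
Local Notation perturb := (@perturb R n hn m).

(** Representatives of germs are maps of the whole of [M']: [perturb] is transported by the chart,
    injective on [good], and extended by the identity, whose values away from [exc_point] do not
    affect jets there. *)
Definition perturb_germ (p : M' l_minus) : M' l_minus :=
  if pselect (exists x, good x /\ par_exc x = p) is left e
  then par_exc (perturb (sval (cid e))) else p.

Lemma perturb_germE x : good x -> perturb_germ (par_exc x) = par_exc (perturb x).
Proof.
move=> gx; rewrite /perturb_germ; case: pselect => [e|[]]; last by exists x.
by case: cid => y /= [gy E]; rewrite (good_inj detB l_minusE gy gx E).
Qed.

Lemma frame_exc_point (f : 'cV[R]_n -> M' l_minus) : frame f -> f 0 = exc_point ->
  exists2 g, diffeo_germ g 0 /\ g 0 = 0 & \forall t \near (0 : 'cV[R]_n), f t = par_exc (g t).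
Proof.
move=> [i [g [dg ig fg]]] f0.
have [ik g00] := par_exc_point detB l_minusE ig (etrans (esym (nbhs_singleton fg)) f0).
by subst i; exists g.
Qed.

Lemma near_perturb_germ (f : 'cV[R]_n -> M' l_minus) (g : 'cV[R]_n -> 'cV[R]_n) :
  {for (0 : 'cV[R]_n), continuous g} -> g 0 = 0 ->
  (\forall t \near (0 : 'cV[R]_n), f t = par_exc (g t)) ->
  \forall t \near (0 : 'cV[R]_n), perturb_germ (f t) = par_exc (perturb (g t)).
Proof.
move=> cg g00 fg; have ng : \forall y \near g 0, good y by rewrite g00; exact: (near_good hn B).
have {}ng : \forall t \near (0 : 'cV[R]_n), good (g t) := cg _ ng.
by apply: filterS2 fg ng => t -> gt; rewrite perturb_germE.
Qed.

Lemma perturb_germ_exc_point : perturb_germ exc_point = exc_point.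
Proof. by rewrite perturb_germE ?perturb_0//; exact: nbhs_singleton (near_good hn B). Qed.

Lemma dom0 : M'dom exc_chart (0 : 'cV[R]_n).
Proof. exact: nbhs_singleton (near_dom hn). Qed.

Lemma diffeo_perturb_comp (g : 'cV[R]_n -> 'cV[R]_n) : diffeo_germ g 0 -> diffeo_germ (perturb \o g) 0.
Proof. by move=> dg; apply: diffeo_germ_comp => //; exact: diffeo_perturb. Qed.

Lemma germ_fixing_perturb : germ_fixing exc_point perturb_germ.
Proof.
split; first exact: perturb_germ_exc_point.
move=> f fr f0; have [g [dg g00] fg] := frame_exc_point fr f0.
have H := near_perturb_germ (diffeo_germ_continuous dg) g00 fg.
apply: (@frame_near_eq _ _ _ (par_exc \o (perturb \o g))); first by apply: filterS H => t E; exact/esym.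
apply: (@frame_par _ _ (M' l_minus) exc_chart); first exact: diffeo_perturb_comp.
by rewrite /= g00 perturb_0; exact: dom0.
Qed.

Lemma jet_eq_perturb_comp (g : 'cV[R]_n -> 'cV[R]_n) i : diffeo_germ g 0 -> g 0 = 0 ->
  jet_eq m (fun y => perturb (g y) i ord0) (fun y => g y i ord0) 0.
Proof.
move=> [g' [sg _ _ _]] g00.
apply: (@jet_cvg_comp _ m _ _ _ _ (fun=> fun y => perturb y i ord0) (fun y => y i ord0) (fun=> g)).
  by rewrite g00; exact: jet_eq_perturb.
by move=> a b; apply: jet_eq_refl; exact: smooth_at_sm.
Qed.

Lemma same_jet_perturb : same_jet_at m exc_point id perturb_germ.
Proof.
move=> f fr f0; have [g [dg g00] fg] := frame_exc_point fr f0.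
have H := near_perturb_germ (diffeo_germ_continuous dg) g00 fg.
have [g' [sg _ _ _]] := dg; have [g1 [sg0 _ _ _]] := diffeo_perturb_comp dg.
exists exc_chart, g, (perturb \o g); split=> //.
  by split=> //; rewrite g00; exact: dom0.
by apply/esym/jet_eq_jet => i; exact: jet_eq_perturb_comp.
Qed.

Context {k : nat} (km : (k <= m)%N) {Z : variety R} {act : Z -> 'M[R]_(n, njet n k) -> Z}
  {phi : ('cV[R]_n -> M' l_minus) -> Z}.
Hypothesis actA : algebraic_action act.
Hypothesis phiA : A_structure act phi.
Hypothesis phiI : forall g : 'M[int]_n, Gamma2 g -> is_isometry phi (M'act g).
Context (w : punctured_torus R n).

(** Replaces the prolongation by an explicit composite of [F] with the jets of [g], to which
    convergence of jets applies. *)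
Lemma prolong_chart F (f : 'cV[R]_n -> M' l_minus) (g : 'cV[R]_n -> 'cV[R]_n) :
  (forall g, diffeo_germ g 0 -> M'dom exc_chart (g 0) -> phi (par_exc \o g) = F (jet k g 0)) ->
  diffeo_germ g 0 -> g 0 = 0 ->
  (\forall t \near (0 : 'cV[R]_n), f t = par_exc (g t)) ->
  \forall x \near (0 : 'cV[R]_n), prolong phi f x = F (jet k g x).
Proof.
move=> phiF dg g00 fg.
have nd : \forall y \near g 0, M'dom exc_chart y by rewrite g00; exact: near_dom.
have {}nd : \forall x \near (0 : 'cV[R]_n), M'dom exc_chart (g x) := diffeo_germ_continuous dg nd.
apply: filterS2 (filterI nd (diffeo_germ_near dg)) (near_join fg) => x [xd dgx] fx.
rewrite -(jet_translation k g x) -phiF ?addr0//; last exact: diffeo_germ_shift.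
rewrite /prolong; apply/esym/(phi_near_eq phiA).
  by apply: (@frame_par _ _ (M' l_minus) exc_chart); [exact: diffeo_germ_shift|rewrite addr0].
by apply: filterS (near_translation fx) => t ->.
Qed.

(** Both sides are limits of the same sequence of jets: by invariance, the composites for [u j] and
    for [g] agree near [x j], and limits are unique. The chart [c] is fixed because [F] is smooth
    into it at the common [k]-jet of [g] and [perturb \o g]. *)
Lemma jet_invariant F c (g : 'cV[R]_n -> 'cV[R]_n) (a : 'I_(vdim c)) :
  smooth_into (@frame_coord _ _ (M' l_minus) k exc_chart) F ->
  (forall g, diffeo_germ g 0 -> M'dom exc_chart (g 0) -> phi (par_exc \o g) = F (jet k g 0)) ->
  diffeo_germ g 0 -> g 0 = 0 -> vdom c (F (jet k g 0)) ->
  jet_eq (m.+1 - k) (fun x => vcoord c (F (jet k (perturb \o g) x)) a ord0)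
    (fun x => vcoord c (F (jet k g x)) a ord0) 0.
Proof.
move=> sF phiF dg g00 Fc; set r := (m.+1 - k)%N.
(* The [r]-jets of maps built on [k]-jets see exactly the order [m + 1] at which the conjugated
   translations converge. *)
have rk : (r + k)%N = m.+1 by rewrite subnK// (leq_trans km).
have phiF' (v : 'cV[R]_n -> 'cV[R]_n) z : diffeo_germ v z -> M'dom exc_chart (v z) ->
    phi (par_exc \o (fun t => v (z + t))) = F (jet k v z).
  move=> dv vz; rewrite -(jet_translation k v z); apply: phiF; first exact: diffeo_germ_shift.
  by rewrite addr0.
have d0 : jet k (perturb \o g) 0 = jet k g 0.
  by apply: jet_eq_jet => i; apply: jet_cvg_le km _; exact: jet_eq_perturb_comp.
have [|_ /smooth_atP/(_ a) spsi] := sF (jet k g 0) _ c Fc.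
  by exists g => //; split=> //=; rewrite g00; exact: dom0.
pose psi (D : 'M[R]_(n, njet n k)) := vcoord c (F D) a ord0.
have [g' [sg sg' g'g gg']] := dg.
pose p := base hn eps.
have p0 : p @ \oo --> (0 : 'cV[R]_n) by apply: base_cvg; exact: cvg_natSinv.
(* Pulling the points [p j] back by [g] makes [g] send the base points [x j] to the axis [x_0 > 0],
   along which [conj_translation_jet_cvg] applies. *)
pose x j := g' (p j).
have x0 : x @ \oo --> (0 : 'cV[R]_n).
  have g'0 : g' 0 = 0 by have := nbhs_singleton g'g; rewrite g00.
  have c' := smooth_at_continuous sg'; rewrite g00 in c'.
  by rewrite -[X in _ --> X]g'0; exact: (cvg_comp _ _ p0 c').
have gx : \forall j \near \oo, g (x j) = p j by rewrite g00 in gg'; exact: p0 _ gg'.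
pose u j := conj_translation hn (tau hn (delta (n := n) eps m j)) \o g.
have cu i : jet_cvg m.+1 (fun j z => u j z i ord0) x (fun z => (perturb \o g) z i ord0) 0.
  apply: (@jet_cvg_comp _ m.+1 _ _ _ _
    (fun j z => conj_translation hn (tau hn (delta (n := n) eps m j)) z i ord0)
    (fun z => perturb z i ord0) (fun=> g)); last first.
    by move=> a' b; apply: jet_cvg_sm x0; exact: smooth_at_sm.
  rewrite g00; apply: (@jet_cvg_points _ _ _ _ _ p); first by apply: filterS gx => j ->.
  by apply: conj_translation_jet_cvg; [exact: eps_gt0|exact: cvg_natSinv].
have cjet (v : nat -> 'cV[R]_n -> 'cV[R]_n) (v' : 'cV[R]_n -> 'cV[R]_n) :
    (forall i, jet_cvg m.+1 (fun j z => v j z i ord0) x (fun z => v' z i ord0) 0) ->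
    forall a' b, jet_cvg r (fun j z => jet k (v j) z a' b) x (fun z => jet k v' z a' b) 0.
  move=> cv a' b; have := cv a'; rewrite -rk => /(@jet_cvg_jet _ _ k _ _ _ v x v' 0 a' (enum_val b)).
  congr jet_cvg; last by apply/funext => z; rewrite mxE.
  by apply/funext => j; apply/funext => z; rewrite mxE.
have C1 : jet_cvg r (fun j z => psi (jet k (u j) z)) x (fun z => psi (jet k (perturb \o g) z)) 0.
  apply: (@jet_cvg_comp _ r _ _ _ _ (fun=> psi) psi (fun j => jet k (u j)) (jet k (perturb \o g)) x 0);
    last exact: cjet.
  apply: (@jet_cvg_sm_comp _ r _ _ _ _ psi (fun j => jet k (u j)) (jet k (perturb \o g)) x 0).
    by rewrite d0; exact: spsi.
  exact: cjet.
have cg i : jet_cvg m.+1 (fun j z => g z i ord0) x (fun z => g z i ord0) 0.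
  by apply: jet_cvg_sm x0; exact: smooth_at_sm.
have C2 : jet_cvg r (fun j z => psi (jet k g z)) x (fun z => psi (jet k g z)) 0.
  apply: (@jet_cvg_comp _ r _ _ _ _ (fun=> psi) psi (fun=> jet k g) (jet k g) x 0);
    last exact: (cjet (fun=> g)).
  apply: (@jet_cvg_sm_comp _ r _ _ _ _ psi (fun=> jet k g) (jet k g) x 0); first exact: spsi.
  exact: (cjet (fun=> g)).
apply: jet_cvg_unique C1 _; apply: jet_cvg_eq C2; last first.
  exact: (filterS (fun y _ => erefl _) filterT).
have ndg : \forall j \near \oo, diffeo_germ g (x j) := x0 _ (diffeo_germ_near dg).
have nd : \forall j \near \oo, M'dom exc_chart (p j) := p0 _ (near_dom hn).
have ndu : \forall j \near \oo, M'dom exc_chart (u j (x j)).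
  have : (fun j => u j (x j)) @ \oo --> (perturb \o g) 0.
    by apply: cvg_mx => i b; rewrite ord1; exact: jet_cvg_value (cu i).
  by rewrite /= g00 perturb_0 => H; exact: H _ (near_dom hn).
have su : \forall j \near \oo, forall i, sm (fun z => u j z i ord0) (x j).
  by apply: filter_forall => i; have [] := cu i.
near=> j.
have gxj : g (x j) = p j by near: j.
have dgj : diffeo_germ g (x j) by near: j.
have dpj : M'dom exc_chart (p j) by near: j.
have duj : M'dom exc_chart (u j (x j)) by near: j.
have suj : forall i, sm (fun z => u j z i ord0) (x j) by near: j.
have cgj := diffeo_germ_continuous dgj.
have cuj : {for x j, continuous (u j)}.
  by apply: continuous_mx => i b; rewrite ord1; exact: sm_continuous.
have n1 : \forall z \near x j, M'dom exc_chart (g z).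
  by apply: (cgj); rewrite /= gxj; exact: open_dom.
have n2 : \forall z \near x j, M'dom exc_chart (u j z) by apply: (cuj); exact: open_dom.
have n3 : \forall z \near x j, 0 < g z i0 ord0.
  have gx0 : 0 < g (x j) i0 ord0 by rewrite gxj base_i0 eps_gt0.
  exact: cgj _ (near_coord_gt0 gx0).
have n4 := diffeo_germ_near dgj.
apply: filterS2 (filterI n1 n2) (filterI n3 n4) => z [z1 z2] [z3 z4].
rewrite /psi; congr (vcoord c _ a ord0).
have dz : diffeo_germ (u j) z.
  by apply: diffeo_germ_comp => //; exact: diffeo_conj_translation.
have inv := phi_chart_invariant detB l_minusE actA phiA phiI w z4 z1 z3 z2.
exact: (etrans (esym (phiF' g z z4 z1)) (etrans (esym inv) (phiF' (u j) z dz z2))).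
Unshelve. all: by end_near. Qed.

Lemma Is_perturb : Is k phi m.+1 exc_point perturb_germ.
Proof.
split; first exact: germ_fixing_perturb.
move=> f fr f0; have [g [dg g00] fg] := frame_exc_point fr f0.
have H := near_perturb_germ (diffeo_germ_continuous dg) g00 fg.
have [_ /(_ exc_chart)[F [sF phiF]] _] := phiA.
have P1 := prolong_chart phiF dg g00 fg.
have P2 := prolong_chart phiF (diffeo_perturb_comp dg) (etrans (congr1 perturb g00) (perturb_0 hn m)) H.
have d0 : jet k (perturb \o g) 0 = jet k g 0.
  by apply: jet_eq_jet => i; apply: jet_cvg_le km _; exact: jet_eq_perturb_comp.
split; first by rewrite (nbhs_singleton P1) -d0; exact: nbhs_singleton P2.
move=> c; rewrite (nbhs_singleton P2) d0 => Fc.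
have E1 : jet (m.+1 - k) (vcoord c \o prolong phi (perturb_germ \o f)) 0 =
    jet (m.+1 - k) (fun x => vcoord c (F (jet k (perturb \o g) x))) 0.
  by apply: jet_near_eq; apply: filterS P2 => x E; exact: (congr1 (vcoord c) E).
have E2 : jet (m.+1 - k) (vcoord c \o prolong phi f) 0 =
    jet (m.+1 - k) (fun x => vcoord c (F (jet k g x))) 0.
  by apply: jet_near_eq; apply: filterS P1 => x E; exact: (congr1 (vcoord c) E).
apply: (etrans E1 (etrans _ (esym E2))).
apply: jet_eq_jet => a; exact: jet_invariant.
Qed.

Lemma Is_id : Is k phi m.+1 exc_point id.
Proof. by split=> // f fr f0; split. Qed.

Lemma partials_cst0 p q s (x : 'M[R]_(p, q)) : partials s (fun=> 0 : R) x = 0.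
Proof. by elim/last_ind: s => // s e IH; rewrite partials_rcons pd_cst. Qed.

Lemma partials_monomial j (x : 'cV[R]_n) :
  partials (nseq j (i0, ord0)) (fun x : 'cV[R]_n => x i0 ord0 ^+ j) x = j`!%:R.
Proof.
elim: j => [|j IH]; first by rewrite /= expr0.
have -> : nseq j.+1 (i0, ord0 : 'I_1) = rcons (nseq j (i0, ord0)) (i0, ord0).
  by rewrite -cats1 -[[:: _]]/(nseq 1 _) -nseqD addn1.
rewrite partials_rcons.
rewrite (@partials_near_eq _ _ _ _ (fun x => 0 + j.+1%:R * x i0 ord0 ^+ j)).
  rewrite partialsDZ; [|exact: sm_cst|by apply: sm_exp; exact: sm_coord].
  by rewrite partials_cst0 add0r IH factS natrM.
apply: filterS (pd_expS (i0, ord0) j (sm_coord i0 ord0 x)) => y ->.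
by rewrite pd_coord eqxx mulr1 add0r.
Qed.

Lemma pure_multi_index (a : multi_index n m.+1) : val a i0 = m.+1 :> nat ->
  flatten [seq nseq (val a i) (i, ord0 : 'I_1) | i <- enum 'I_n] = nseq m.+1 (i0, ord0).
Proof.
move=> ai; set L := flatten _.
have sa := valP a; rewrite (bigD1 i0)//= ai -[X in (_ <= X)%N]addn0 leq_add2l leqn0 in sa.
have a0 i : i != i0 -> val a i = 0%N :> nat.
  by move=> ii; move: sa; rewrite sum_nat_eq0 => /forallP/(_ i); rewrite ii => /eqP.
have sL : size L = m.+1.
  rewrite /L size_flatten /shape -map_comp sumnE big_map /= big_enum /=.
  under eq_bigr do rewrite size_nseq.
  by rewrite (bigD1 i0)//= ai big1 ?addn0.
rewrite -sL; apply/all_pred1P/allP => e /flattenP[_ /mapP[i _ ->]].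
rewrite mem_nseq => /andP[ia /eqP ->] /=.
by have [->//|ii] := eqVneq i i0; rewrite a0 in ia.
Qed.

(** The relation [same_jet] only provides some lifts with equal jets in some chart. Injectivity on
    [good] identifies them with the identity and [perturb] near 0, and the derivative of order
    [m + 1] along the axis 0 tells these apart. *)
Lemma not_same_jet_perturb : ~ same_jet_at m.+1 exc_point id perturb_germ.
Proof.
move=> /(_ (par_exc \o id)) H.
have dgid : diffeo_germ (@id 'cV[R]_n) 0.
  apply: diffeo_germ_near_eq (diffeo_germ_translation 0 0).
  by apply: (filterS _ filterT) => y _; rewrite add0r.
have fr : frame (par_exc \o id) by apply: (@frame_par _ _ (M' l_minus) exc_chart) => //; exact: dom0.
have [i [g1 [g2 [[s1 s2 ig1] E1 E2 jE]]]] := H fr erefl.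
have [ik g10] := par_exc_point detB l_minusE ig1 (esym (nbhs_singleton E1)).
subst i.
(* The null multi-index extracts the values at 0 from the jets, so the second lift also fixes the
   origin. *)
have am : (\sum_(i < n) [ffun i : 'I_n => (ord0 : 'I_m.+2)] i <= m.+1)%N.
  by rewrite big1// => i _; rewrite ffunE.
pose z0 : multi_index n m.+1 := exist (fun a : {ffun 'I_n -> 'I_m.+2} => (\sum_(i < n) a i <= m.+1)%N) _ am.
have g20 : g2 0 = 0.
  rewrite -[RHS]g10; apply/colP => i.
  have := congr1 (fun J : 'M[R]_(n, njet n m.+1) => J i (enum_rank z0)) jE.
  rewrite !mxE enum_rankK /partial_multi /=.
  rewrite (_ : flatten _ = [::]); first exact: esym.
  by apply/size0nil; rewrite size_flatten /shape -map_comp sumnE big_map big1// => j _;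
    rewrite /= size_nseq ffunE.
have near0 (g : 'cV[R]_n -> 'cV[R]_n) : smooth_at g 0 -> g 0 = 0 ->
    \forall t \near (0 : 'cV[R]_n), good (g t).
  move=> /smooth_at_continuous cg g00; have ng : \forall y \near g 0, good y.
    by rewrite g00; exact: (near_good hn B).
  exact: cg _ ng.
have n0 := @near_good R n hn B; have n1 := near0 _ s1 g10; have n2 := near0 _ s2 g20.
have n3 : \forall t \near (0 : 'cV[R]_n), good (perturb t).
  by apply: near0 (perturb_0 hn m); have [? []] := @diffeo_perturb R n hn m 0.
have eg1 : \forall t \near (0 : 'cV[R]_n), g1 t = t.
  apply: filterS2 (filterI n0 n1) E1 => t [t0 t1] E.
  exact/esym/(good_inj detB l_minusE t0 t1 E).
have eg2 : \forall t \near (0 : 'cV[R]_n), g2 t = perturb t.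
  apply: filterS2 (filterI n0 (filterI n2 n3)) E2 => t [t0 [t2 t3]] E.
  by apply: (good_inj detB l_minusE t2 t3); rewrite -perturb_germE//; exact/esym.
rewrite (jet_near_eq _ eg1) (jet_near_eq _ eg2) in jE.
(* The multi-index concentrated on the axis 0 extracts [leading_coef] times the factorial of [m + 1]
   from entry 1 of [perturb], against 0 for the identity. *)
have bm : (\sum_(i < n) [ffun i : 'I_n => if i == i0 then ord_max : 'I_m.+2 else ord0] i <= m.+1)%N.
  by rewrite (bigD1 i0)//= ffunE eqxx big1 ?addn0// => i ii; rewrite ffunE (negbTE ii).
pose b : multi_index n m.+1 := exist (fun a : {ffun 'I_n -> 'I_m.+2} => (\sum_(i < n) a i <= m.+1)%N) _ bm.
have := congr1 (fun J : 'M[R]_(n, njet n m.+1) => J i1 (enum_rank b)) jE.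
rewrite [LHS]mxE [RHS]mxE enum_rankK /partial_multi pure_multi_index; last by rewrite /= ffunE eqxx.
rewrite [X in _ = X](@partials_near_eq _ _ _ _
  (fun y : 'cV[R]_n => y i1 ord0 + @leading_coef R n m * y i0 ord0 ^+ m.+1)).
  rewrite partialsDZ; [|exact: sm_coord|by apply: sm_exp; exact: sm_coord].
  rewrite partials_monomial => /eqP; rewrite -subr_eq0 opprD addrA subrr add0r oppr_eq0.
  rewrite mulf_eq0 pnatr_eq0 gtn_eqF ?fact_gt0// orbF; apply/negP.
  by apply: binom_neq0; rewrite oppr_lt0 invr_gt0 n_gt0.
by apply: (filterS _ filterT) => y _; rewrite perturbE eqxx mulr1.
Qed.

End NonRigidity.

(** Both gluings at [p_minus] have an integral linear part of determinant 1: [A] itself, as [A]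
    sends [p_plus] to [p_minus], or the identity. The chart lemmas above depend only on this
    form. *)
Lemma l_minus_affine (R : realType) (n : nat) (A : 'M[int]_n) (l_minus : 'cV[R]_n -> torus R n) :
  \det A = 1 -> torus_act A (p_plus R n) = p_minus R n ->
  (forall v, l_minus v = torus_act A (l_plus v)) \/
    (forall v, l_minus v = to_torus (half_vec R n 1 + v)) ->
  exists2 B : 'M[int]_n, \det B = 1 &
    forall v, l_minus v = to_torus (half_vec R n 1 + map_mx intr B *m v).
Proof.
move=> detA; rewrite /p_plus torus_act_to_torus => /to_torus_eq hA [lE|lE]; last first.
  by exists 1%:M; [rewrite det1|move=> v; rewrite lE map_mx1 mul1mx].
exists A => // v; rewrite lE /l_plus torus_act_to_torus; apply/to_torus_eq => i.
rewrite mulmxDr.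
have E (a b c : 'cV[R]_n) : (a + c) i ord0 - (b + c) i ord0 = a i ord0 - b i ord0.
  by rewrite !mxE; ring.
by rewrite E.
Qed.


Theorem proposition5p2 (R : realType) (n : nat) (hn : (1 < n)%N)
    (A : 'M[int]_n) (detA : \det A = 1)
    (hA : torus_act A (p_plus R n) = p_minus R n)
    (l_minus : 'cV[R]_n -> torus R n)
    (hl_minus : (forall v, l_minus v = torus_act A (l_plus v)) \/
                (forall v, l_minus v = to_torus (half_vec R n 1 + v))) :
  ~ exists (k : nat) (Z : variety R) (act : Z -> 'M[R]_(n, njet n k) -> Z)
           (phi : ('cV[R]_n -> M' l_minus) -> Z),
      [/\ algebraic_action act,
          A_structure act phi,
          forall g : 'M[int]_n, Gamma2 g -> is_isometry phi (M'act g) &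
          rigid k phi].
Proof.
case=> k [Z [act [phi [actA phiA phiI [m [km rig]]]]]].
have [B detB lE] := l_minus_affine detA hA hl_minus.
(* Any point of the punctured torus can serve as index of the flat chart; 5/8 is the middle of the
   strip. *)
have su : strip hn (const_mx (5 / 8) : 'cV[R]_n) by rewrite /strip /= mxE; apply/andP; split; lra.
have /andP pu := strip_punctured su.
pose w : punctured_torus R n :=
  exist (fun t : torus R n => (t != p_plus R n) && (t != p_minus R n)) _ pu.
apply: (not_same_jet_perturb (m := m) detB lE).
apply: rig; first exact: Is_id.
- exact: (Is_perturb hn detB lE km actA phiA phiI w).
- exact: (same_jet_perturb detB lE m).
Qed.
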